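(* Let $a\in(0,1/2]$, let $q,\tilde q\in L_2(0,1)$ be complex-valued, and let there exist an operator $P:L_2(0,a)\to L_2(0,a)$ with injective $I+P$ ($I$ being the identity operator) such that $$ q(a-x)=P(q(a+x)),\qquad \tilde q(a-x)=P(\tilde q(a+x))\quad\text{a.e. on }(0,a). $$ For $\alpha=0,1$ let $\{\lambda_{n,\alpha}\}_{n\ge0}$ and $\{\tilde\lambda_{n,\alpha}\}_{n\ge0}$ be the spectra of the boundary value problems $\mathcal L_\alpha(q(x),a)$ and $\mathcal L_\alpha(\tilde q(x),a)$, respectively. Then coincidence of the spectra $\{\lambda_{n,\alpha}\}_{n\ge0}=\{\tilde\lambda_{n,\alpha}\}_{n\ge0}$ for both $\alpha=0$ and $\alpha=1$ implies $q(x)=\tilde q(x)$ a.e. on $(0,1)$.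
   Context: For a complex-valued $q\in L_2(0,1)$, $a\in[0,1]$ and $\gamma\in\mathbb C\setminus\{0\}$, $\mathcal L(q(x),a,\gamma)$ denotes the boundary value problem $$-y''(x)+q(x)y(a)=\lambda y(x),\quad 0<x<1,\qquad y^{(\nu)}(0)=\gamma y^{(\nu)}(1),\quad \nu=0,1,$$ for $y\in W_2^2[0,1]$, with spectral parameter $\lambda\in\mathbb C$. For $\alpha\in\{0,1\}$, $\mathcal L_\alpha(q(x),a):=\mathcal L(q(x),a,(-1)^\alpha)$ (periodic problem for $\alpha=0$, antiperiodic for $\alpha=1$). Let $C(x,\lambda)$, $S(x,\lambda)$ be the solutions of the equation with $C(a,\lambda)=S'(a,\lambda)=1$, $S(a,\lambda)=C'(a,\lambda)=0$; with $\rho^2=\lambda$, $$C(x,\lambda)=\cos\rho(x-a)+\int_a^x\frac{\sin\rho(x-t)}{\rho}q(t)\,dt,\qquad S(x,\lambda)=\frac{\sin\rho(x-a)}{\rho}.$$ The eigenvalues of $\mathcal L(q(x),a,\gamma)$ are the zeros of the characteristic function $$\Delta(\lambda)=\begin{vmatrix} C(0,\lambda)-\gamma C(1,\lambda) & S(0,\lambda)-\gamma S(1,\lambda)\\ C'(0,\lambda)-\gamma C'(1,\lambda) & S'(0,\lambda)-\gamma S'(1,\lambda)\end{vmatrix},$$ and the spectrum is the collection of zeros of $\Delta$ counted with multiplicity; equality of spectra is equality of multisets. ''Operator'' here means an arbitrary map, not necessarily linear (e.g. constant maps are allowed). The notation $P(q(a+x))$ means $P$ applied to the function $x\mapsto q(a+x)$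 on $(0,a)$, evaluated at $x$. *)

(* Defs.v *)
Set Warnings "-notation-overridden,-notation-incompatible-prefix".
From HB Require Import structures.
From mathcomp Require Import all_boot all_order all_algebra.
From mathcomp Require Export complex.
From mathcomp Require Export all_classical all_reals all_analysis.

Set Implicit Arguments.
Unset Strict Implicit.
Unset Printing Implicit Defensive.

Import Order.TTheory GRing.Theory Num.Theory.
Export numFieldNormedType.Exports.

Local Open Scope classical_set_scope.
Local Open Scope complex_scope.
Local Open Scope ring_scope.

Section frozen_argument.
Variable R : realType.
Implicit Types (q y f g : R -> R[i]) (a b x t : R) (lam z gamma rho : R[i]).

Local Notation mu := (@lebesgue_measure R).

(* Elements of L_2(0,b) are represented by functions on the whole line: their
   values outside ]0,b[ are junk, and equality in L_2(0,b) is aeq b. *)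
Definition inL2 b f : Prop :=
  [/\ measurable_fun `]0, b[ (fun x => complex.Re (f x)),
      measurable_fun `]0, b[ (fun x => complex.Im (f x)) &
      mu.-integrable `]0, b[
        (fun x => (complex.Re (f x) ^+ 2 + complex.Im (f x) ^+ 2)%:E)].

Definition aeq b f g : Prop := 
  {ae mu, forall x, x \in `]0, b[ -> f x = g x}.

(* An arbitrary map of the quotient space L_2(0,b) into itself, given on
   representatives. *)
Definition L2_operator b (P : (R -> R[i]) -> (R -> R[i])) : Prop :=
  (forall f, inL2 b f -> inL2 b (P f)) /\
  (forall f g, inL2 b f -> inL2 b g -> aeq b f g -> aeq b (P f) (P g)).

Definition L2_injective b (T : (R -> R[i]) -> (R -> R[i])) : Prop :=
  forall f g, inL2 b f -> inL2 b g -> aeq b (T f) (T g) -> aeq b f g.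

Definition integralC (D : set R) f : R[i] :=
  (\int[mu]_(t in D) complex.Re (f t)) +i* (\int[mu]_(t in D) complex.Im (f t)).

(* \int_a^x f(t) dt, with the usual sign when x < a. *)
Definition oriented_integral a x f : R[i] :=
  if a <= x then integralC `]a, x[ f else - integralC `]x, a[ f.

Definition expC z : R[i] :=
  (expR (complex.Re z) * cos (complex.Im z)) +i*
  (expR (complex.Re z) * sin (complex.Im z)).
Definition cosC z : R[i] := (expC ('i%C * z) + expC (- ('i%C * z))) / 2%:R.
Definition sinC z : R[i] :=
  (expC ('i%C * z) - expC (- ('i%C * z))) / (2%:R * 'i%C).

(* cos (rho t) and sin (rho t) / rho with rho ^ 2 = lam; both are even in rho,
   so the choice of the square root is immaterial. *)
Definition cos_sqrt lam t : R[i] := cosC (sqrtc lam * t%:C).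
Definition sin_sqrt lam t : R[i] :=
  if lam == 0 then t%:C else sinC (sqrtc lam * t%:C) / sqrtc lam.

(* The solutions C and S of - y'' + q(x) y(a) = lam y on (0,1) with
   C(a) = S'(a) = 1 and S(a) = C'(a) = 0. *)
Definition solC q a lam x : R[i] :=
  cos_sqrt lam (x - a) +
  oriented_integral a x (fun t => sin_sqrt lam (x - t) * q t).
Definition solS a lam x : R[i] := sin_sqrt lam (x - a).

(* y'(x) for y defined on [0,1]: one-sided at the end points. *)
Definition deriv01 y x : R[i] :=
  lim (((y t - y x) / (t - x)%:C : R[i]^o) @[t --> within `[0, 1] x^']).

Definition charfun q a gamma lam : R[i] :=
  let C := solC q a lam in
  let S := solS a lam in
  \det (\matrix_(i < 2, j < 2)
    (if i == 0
     then if j == 0 then C 0 - gamma * C 1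
                    else S 0 - gamma * S 1
     else if j == 0 then deriv01 C 0 - gamma * deriv01 C 1
                    else deriv01 S 0 - gamma * deriv01 S 1)).

Definition zero_of_mult (F : R[i] -> R[i]) z (m : nat) : Prop :=
  (forall k, (k < m)%N -> derive1n k (F : R[i] -> R[i]^o) z = 0) /\
  derive1n m (F : R[i] -> R[i]^o) z <> 0.

(* The multiset of zeros of the characteristic function, encoded as its set of
   pairs (eigenvalue, multiplicity). *)
Definition spectrum q a gamma : set (R[i] * nat) :=
  [set zm | (0 < zm.2)%N /\ zero_of_mult (charfun q a gamma) zm.1 zm.2].

(* alpha = 0: periodic, alpha = 1: antiperiodic. *)
Definition spectrum_alpha q a (alpha : nat) := spectrum q a ((-1) ^+ alpha).

End frozen_argument.

(* Main.v *)
(* Since gamma^2 = 1, the characteristic function is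
     2 - 2 gamma cos rho - int_0^1 (s(|t-a|) + gamma s(1-|t-a|)) q(t) dt,
   with s(t) = sin(rho t)/rho and rho^2 = lam; it is an entire function of lam.
   On the contours |lam| + |Re lam| = 2 r^2, r = pi/2 + 2 pi n, its integral
   term is negligible, so that two such functions with the same zeros have a
   quotient tending to 1 along the contours and coincide, by the maximum
   principle. Comparing Taylor coefficients for gamma = 1 and gamma = -1 shows
   that p = q - qt is orthogonal to all odd powers of |t-a|, hence to the
   functions |t-a| on {|t-a| < x}; differentiating in x,
   p(a+x) + p(a-x) = 0 almost everywhere, p being extended by zero outside
   (0,1). On (0,a) this says that q(a+x) and qt(a+x) have the same image under
   I + P, and on (a,1-a) it says that p(a+x) = 0. *)
Require Import Defs.
From HB Require Import structures.
From mathcomp Require Import all_boot all_order all_algebra.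
From mathcomp Require Import complex all_classical all_reals all_analysis.
From mathcomp Require Import measurable_realfun ring lra.
Set Implicit Arguments.
Unset Strict Implicit.
Unset Printing Implicit Defensive.
Import Order.TTheory GRing.Theory Num.Theory.
Import numFieldNormedType.Exports.
Local Open Scope classical_set_scope.
Local Open Scope complex_scope.
Local Open Scope ring_scope.

(** Neither Hadamard factorization nor contour integration enters. An entire function is a
    coefficient sequence whose series converges everywhere, and the quotient of two such functions
    with equal zeros is described only locally, as a quotient of nonvanishing series. This suffices
    for the maximum principle, which needs no more than a local form f z + h^m g(h) with g
    continuous at 0. The contours are the images under rho -> rho^2 of the squares max(|Re rho|, |Im
    rho|) = r. On the vertical sides cos(Re rho) = 0, so cos rho is purely imaginary and stays away
    from 1 and -1; on the horizontal sides |cos rho| is large. Hence the main term dominates a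
    multiple of exp |Im rho|, while the integral term is O(exp |Im rho| / |rho|). The moments of
    |t-a| and of 1-|t-a| occur as M + gamma M', so that both spectra together isolate M. Since p is
    merely integrable, odd powers are turned into a truncated |t-a| by polynomials in |t-a|^2 that
    are bounded by 1 and converge pointwise to an indicator. Once q(a+x) is known on (0,a), a second
    use of P gives q(a-x). *)

Local Notation nc := Normc.normc.

(** * The real-valued modulus of a complex number *)

Section complex_norm.
Context {R : realType}.
Implicit Types (x y z : R[i]) (r : R).

Lemma nc_normE z : `|z| = (nc z)%:C. Proof. by case: z. Qed.

Lemma nc_ge0 z : 0 <= nc z.
Proof. by case: z => u v /=; exact: sqrtr_ge0. Qed.

Lemma nc0 : nc (0 : R[i]) = 0. Proof. exact: (Normc.normc0 R). Qed.

Lemma nc1 : nc (1 : R[i]) = 1. Proof. exact: (Normc.normc1 R). Qed.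

Lemma ncM x y : nc (x * y) = nc x * nc y. Proof. exact: Normc.normcM. Qed.

Lemma ncV x : nc x^-1 = (nc x)^-1. Proof. exact: Normc.normcV. Qed.

Lemma ncD x y : nc (x + y) <= nc x + nc y. Proof. exact: le_normcD. Qed.

Lemma ncN x : nc (- x) = nc x. Proof. exact: (@normcN R x). Qed.

Lemma ncB x y : nc (x - y) <= nc x + nc y.
Proof. by rewrite -[leRHS]/(nc x + nc y) -(ncN y); exact: ncD. Qed.

Lemma nc_distC x y : nc (x - y) = nc (y - x).
Proof. by rewrite -ncN opprB. Qed.

Lemma nc_distD x y z : nc (x - z) <= nc (x - y) + nc (y - z).
Proof. by rewrite -(subrKA y); exact: ncD. Qed.

Lemma nc_lerB x y : nc x - nc y <= nc (x - y).
Proof. by rewrite lerBlDr -{1}(subrK y x); exact: ncD. Qed.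

Lemma nc_eq0 x : (nc x == 0) = (x == 0).
Proof. by apply/eqP/eqP => [/Normc.eq0_normc//|->]; exact: nc0. Qed.

Lemma nc_gt0 x : (0 < nc x) = (x != 0).
Proof. by rewrite lt_def nc_ge0 andbT nc_eq0. Qed.

Lemma ncX x n : nc (x ^+ n) = nc x ^+ n.
Proof. by elim: n => [|n IH]; rewrite ?expr0 ?nc1// !exprS ncM IH. Qed.

Lemma nc_real r : nc r%:C = `|r|.
Proof. by rewrite /= expr0n addr0 sqrtr_sqr. Qed.

Lemma nc_nat n : nc (n%:R : R[i]) = n%:R.
Proof. by rewrite -(rmorph_nat (real_complex R)) nc_real normr_nat. Qed.

Lemma nc_i : nc ('i%C : R[i]) = 1.
Proof. by rewrite /= expr0n expr1n add0r sqrtr1. Qed.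

Lemma nc_sum n (F : nat -> R[i]) :
  nc (\sum_(k < n) F k) <= \sum_(k < n) nc (F k).
Proof.
elim: n => [|n IH]; first by rewrite !big_ord0 nc0.
by rewrite !big_ord_recr /=; apply: le_trans (ncD _ _) _; rewrite lerD2r.
Qed.

Lemma nc_ge_Re z : `|complex.Re z| <= nc z.
Proof.
by rewrite -lecR -nc_normE; exact: normc_ge_Re.
Qed.

Lemma nc_ge_Im z : `|complex.Im z| <= nc z.
Proof.
case: z => u v /=; rewrite -(sqrtr_sqr v) ler_wsqrtr// lerDr; exact: sqr_ge0.
Qed.

Lemma nc_le_ReIm z : nc z <= `|complex.Re z| + `|complex.Im z|.
Proof.
rewrite [in leLHS](complexE z); apply: le_trans (ncD _ _) _.
by rewrite ncM nc_i mul1r !nc_real.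
Qed.

End complex_norm.

(** * Complex series with geometrically decreasing tails *)

Section geometric_sums.
Context {R : realType}.
Implicit Types (u v : nat -> R[i]) (l m c : R[i]).

(* All the series below converge geometrically, so that a bound on the tails
   can replace limits along filters. *)
Definition gsum u l :=
  exists C : R, forall N, nc (l - \sum_(k < N) u k) <= C / 2 ^+ N.

Lemma pow2_gt0 n : (0 : R) < 2 ^+ n. Proof. by rewrite exprn_gt0. Qed.

(** A positive [x] would give [2 ^+ n <= C / x] for every [n], against [C / x < n < 2 ^+ n] for an
    Archimedean [n]. *)
Lemma geometric_le0 (x C : R) : (forall N, x <= C / 2 ^+ N) -> x <= 0.
Proof.
move=> H; rewrite leNgt; apply/negP => x0.
pose n := Num.Def.archi_bound (C / x).
have C0 : 0 <= C by have := H 0%N; rewrite expr0 divr1; apply: le_trans; exact: ltW.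
have Cn : C / x < n%:R by apply: Num.Theory.archi_boundP; rewrite divr_ge0// ltW.
have := H n; rewrite ler_pdivlMr ?pow2_gt0//.
rewrite ltr_pdivrMr// in Cn; move=> /le_lt_trans/(_ Cn).
rewrite mulrC ltr_pM2r// -natrX ltr_nat => /ltn_trans/(_ (ltn_expl n (ltnSn 1))).
by rewrite ltnn.
Qed.

Lemma gsum_uniq u l m : gsum u l -> gsum u m -> l = m.
Proof.
move=> [C HC] [D HD]; apply/eqP; rewrite -subr_eq0 -nc_eq0 eq_le nc_ge0 andbT.
apply: (@geometric_le0 _ (C + D)) => N; rewrite mulrDl.
apply: le_trans (nc_distD _ (\sum_(k < N) u k) _) _.
by rewrite lerD ?HC// nc_distC.
Qed.

Lemma gsumD u v l m : gsum u l -> gsum v m -> gsum (fun n => u n + v n) (l + m).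
Proof.
move=> [C HC] [D HD]; exists (C + D) => N; rewrite big_split/= mulrDl opprD addrACA.
exact: le_trans (ncD _ _) (lerD (HC N) (HD N)).
Qed.

Lemma gsumZ c u l : gsum u l -> gsum (fun n => c * u n) (c * l).
Proof.
move=> [C HC]; exists (nc c * C) => N.
by rewrite -mulr_sumr -mulrBr ncM -mulrA ler_wpM2l ?nc_ge0.
Qed.

Lemma gsum_eq u v l : u =1 v -> gsum u l -> gsum v l.
Proof. by move=> /funext ->. Qed.

Lemma gsumB u v l m : gsum u l -> gsum v m -> gsum (fun n => u n - v n) (l - m).
Proof.
move=> Hu /(gsumZ (-1)) Hv; have := gsumD Hu Hv.
by rewrite mulN1r; apply: gsum_eq => n; rewrite mulN1r.
Qed.

Lemma gsum0 : gsum (fun=> 0) 0.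
Proof. by exists 0 => N; rewrite big1// subrr nc0 mul0r. Qed.

Lemma gsum_sum (I : Type) (s : seq I) (u : I -> nat -> R[i]) (l : I -> R[i]) :
  (forall i, gsum (u i) (l i)) ->
  gsum (fun n => \sum_(i <- s) u i n) (\sum_(i <- s) l i).
Proof.
move=> H; elim: s => [|i s IH].
  by rewrite big_nil; apply: gsum_eq gsum0 => n; rewrite big_nil.
by rewrite big_cons; apply: gsum_eq (gsumD (H i) IH) => n; rewrite big_cons.
Qed.

Lemma sum_ord_split (V : zmodType) (F : nat -> V) (m n : nat) : (m <= n)%N ->
  \sum_(k < n) F k = \sum_(k < m) F k + \sum_(k < n - m) F (m + k)%N.
Proof.
by move=> /subnKC; move: (n - m)%N => j <-; rewrite big_split_ord.
Qed.

Lemma gsum_finite u N : (forall n, (N <= n)%N -> u n = 0) ->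
  gsum u (\sum_(k < N) u k).
Proof.
(* From [N] on the error is zero; before [N] it is at most the sum of all norms, and the factor
   [2 ^+ N] outweighs the division by [2 ^+ M]. *)
move=> H; exists (2 ^+ N * \sum_(k < N) nc (u k)) => M.
have [MN|NM] := leqP N M.
  have -> : \sum_(k < M) u k = \sum_(k < N) u k.
    rewrite (sum_ord_split _ MN) [X in _ + X]big1 ?addr0// => i _.
    by rewrite H// leq_addr.
  rewrite subrr nc0 divr_ge0 ?mulr_ge0 ?exprn_ge0// sumr_ge0// => i _.
  exact: nc_ge0.
have ineq : \sum_(k < N) nc (u k) <= 2 ^+ N * (\sum_(k < N) nc (u k)) / 2 ^+ M.
  rewrite -mulrA mulrCA ler_peMr// ?sumr_ge0// => [i _|]; first exact: nc_ge0.
  by rewrite ler_pdivlMr ?pow2_gt0// mul1r ler_weXn2l// ?ler1n// ltnW.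
apply: le_trans ineq.
rewrite (sum_ord_split _ (ltnW NM)) (sum_ord_split (fun k =>
  nc (u k)) (ltnW NM)) addrAC subrr add0r.
apply: le_trans (nc_sum _ (fun i => u (M + i)%N)) _.
by rewrite lerDr sumr_ge0// => i _; exact: nc_ge0.
Qed.

Lemma gsum_shift u l : gsum u l -> gsum (fun n => u n.+1) (l - u 0%N).
Proof.
move=> [C HC]; exists (C / 2) => N; have := HC N.+1.
by rewrite big_ord_recl exprS invfM mulrA opprD addrA.
Qed.

Lemma gsum_shiftn u l (m : nat) : gsum u l ->
  (forall k, (k < m)%N -> u k = 0) -> gsum (fun n => u (n + m)%N) l.
Proof.
move=> ul u0.
have sh k : gsum (fun n => u (n + k)%N) (l - \sum_(i < k) u i).
  elim: k => [|k /gsum_shift].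
    by rewrite big_ord0 subr0; apply: gsum_eq ul => n; rewrite addn0.
  by rewrite add0n big_ord_recr/= opprD addrA; apply: gsum_eq => n; rewrite addSnnS.
by have := sh m; rewrite big1 ?subr0// => i _; rewrite u0.
Qed.

(** The intervals of centre [S N] and radius [2 * C / 2 ^+ N] are nested: the radius drops by
    [C / 2 ^+ N], which is at least the move of the centre. The supremum of the lower ends lies in
    all of them. *)
Lemma real_gsum_exists (u : nat -> R) (C : R) : (forall n, `|u n| <= C / 2 ^+ n) ->
  exists l : R, forall N, `|l - \sum_(k < N) u k| <= 2 * C / 2 ^+ N.
Proof.
move=> H; pose S N := \sum_(k < N) u k.
pose lo N := S N - 2 * C / 2 ^+ N; pose hi N := S N + 2 * C / 2 ^+ N.
have C0 : 0 <= C by have := H 0%N; rewrite expr0 divr1; apply: le_trans.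
have half n : 2 * C / 2 ^+ n.+1 = C / 2 ^+ n.
  by rewrite exprS invfM mulrACA divff// mul1r.
have dbl n : 2 * C / 2 ^+ n = C / 2 ^+ n + C / 2 ^+ n by rewrite -mulrA -mulr2n mulr_natl.
have SS n : S n.+1 = S n + u n by rewrite /S big_ord_recr.
have Un n : - (C / 2 ^+ n) <= u n <= C / 2 ^+ n by rewrite -ler_norml.
have loS n : lo n <= lo n.+1.
  by rewrite /lo half SS dbl; have /andP[] := Un n; lra.
have hiS n : hi n.+1 <= hi n.
  by rewrite /hi half SS dbl; have /andP[] := Un n; lra.
have lohi (n m : nat) : lo n <= hi m.
  have lom : {homo lo : i j / (i <= j)%N >-> i <= j}.
    by apply: homo_leq => //; exact: le_trans.
  have him : {homo hi : i j / (i <= j)%N >-> j <= i}.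
    by move=> i j /subnK <-; elim: (j - i)%N => // k IH; exact: le_trans (hiS _) IH.
  apply: le_trans (lom _ _ (leq_maxl n m)) (le_trans _ (him _ _ (leq_maxr n m))).
  rewrite /lo /hi; have : 0 <= 2 * C / 2 ^+ maxn n m by rewrite divr_ge0 ?mulr_ge0 ?exprn_ge0.
  lra.
exists (sup (range lo)) => N; rewrite ler_distl; apply/andP; split.
  by apply: ub_le_sup; [exists (hi 0%N) => _ [n _ <-]|exists N].
by apply: ge_sup; [exists (lo 0%N), 0%N|move=> _ [n _ <-]; exact: (lohi n N)].
Qed.

Lemma ReD (x y : R[i]) : complex.Re (x + y) = complex.Re x + complex.Re y.
Proof. by case: x; case: y. Qed.

Lemma ImD (x y : R[i]) : complex.Im (x + y) = complex.Im x + complex.Im y.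
Proof. by case: x; case: y. Qed.

Lemma Re_sum (I : Type) (s : seq I) (u : I -> R[i]) :
  complex.Re (\sum_(k <- s) u k) = \sum_(k <- s) complex.Re (u k).
Proof. by elim: s => [|i s IH]; rewrite ?big_nil// !big_cons ReD IH. Qed.

Lemma Im_sum (I : Type) (s : seq I) (u : I -> R[i]) :
  complex.Im (\sum_(k <- s) u k) = \sum_(k <- s) complex.Im (u k).
Proof. by elim: s => [|i s IH]; rewrite ?big_nil// !big_cons ImD IH. Qed.

Lemma ReB (x y : R[i]) : complex.Re (x - y) = complex.Re x - complex.Re y.
Proof. by case: x; case: y. Qed.

Lemma ImB (x y : R[i]) : complex.Im (x - y) = complex.Im x - complex.Im y.
Proof. by case: x; case: y. Qed.

Lemma gsum_exists_tail u (C : R) : (forall n, nc (u n) <= C / 2 ^+ n) ->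
  exists l, forall N, nc (l - \sum_(k < N) u k) <= 4 * C / 2 ^+ N.
Proof.
move=> H.
have [x Hx] := @real_gsum_exists (fun n => complex.Re (u n)) C
  (fun n => le_trans (nc_ge_Re _) (H n)).
have [y Hy] := @real_gsum_exists (fun n => complex.Im (u n)) C
  (fun n => le_trans (nc_ge_Im _) (H n)).
exists (x +i* y) => N; apply: le_trans (nc_le_ReIm _) _.
rewrite ReB ImB Re_sum Im_sum /=.
by apply: le_trans (lerD (Hx N) (Hy N)) _; rewrite -mulrDl -mulrDl -natrD.
Qed.

Lemma gsum_exists u (C : R) : (forall n, nc (u n) <= C / 2 ^+ n) ->
  exists l, gsum u l.
Proof. by move=> /gsum_exists_tail[l Hl]; exists l; exists (4 * C). Qed.

(** By uniqueness, the tail bound of the sum that [gsum_exists_tail] constructs holds for any sum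
    already at hand. *)
Lemma gsum_le u l (C : R) : gsum u l -> (forall n, nc (u n) <= C / 2 ^+ n) ->
  nc l <= 4 * C.
Proof.
move=> ul /gsum_exists_tail[m Hm].
have -> : l = m by apply: gsum_uniq ul _; exists (4 * C).
by have := Hm 0%N; rewrite big_ord0 subr0 expr0 divr1.
Qed.

End geometric_sums.

(** * Everywhere convergent power series and their re-expansion *)

Section power_series.
Context {R : realType}.
Implicit Types (a b c : nat -> R[i]) (F G : R[i] -> R[i]) (z w h : R[i]).

(** Infinite radius of convergence, stated by boundedness so that no limit is involved; geometric
    decay at radius [r] follows from the bound at [2 * r]. *)
Definition entire a :=
  forall r : R, 0 <= r -> exists C, forall n, nc (a n) * r ^+ n <= C.

Definition has_ps a F := forall z, gsum (fun n => a n * z ^+ n) (F z).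

Lemma entire_geometric a (r : R) : entire a -> 0 <= r ->
  exists C, forall n, nc (a n) * r ^+ n <= C / 2 ^+ n.
Proof.
move=> ea r0; have [C HC] := ea (2 * r) (mulr_ge0 (ler0n _ _) r0).
exists C => n; rewrite ler_pdivlMr ?pow2_gt0//; apply: le_trans (HC n).
by rewrite exprMn mulrCA mulrC.
Qed.

Lemma entire_geometric_le a (r : R) : entire a -> 0 <= r ->
  exists C, forall z, nc z <= r -> forall n, nc (a n * z ^+ n) <= C / 2 ^+ n.
Proof.
move=> ea r0; have [C HC] := entire_geometric ea r0; exists C => w wr n.
apply: le_trans (HC n); rewrite ncM ncX ler_wpM2l ?nc_ge0//.
by rewrite lerXn2r ?nnegrE ?nc_ge0.
Qed.

Lemma has_ps_exists a : entire a -> exists F, has_ps a F.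
Proof.
move=> ea; suff /choice[F HF] : forall z, exists l, gsum (fun n => a n * z ^+ n) l by exists F.
move=> z.
have [C HC] := entire_geometric_le ea (nc_ge0 z).
exact: (gsum_exists (HC z (lexx _))).
Qed.

Lemma has_ps0 a F : has_ps a F -> F 0 = a 0%N.
Proof.
move=> aF; apply: gsum_uniq (aF 0) _.
have -> : a 0%N = \sum_(k < 1) (a k * 0 ^+ k) by rewrite big_ord1 mulr1.
by apply: (gsum_finite (u := fun k => a k * 0 ^+ k)) => -[//|n] _; rewrite expr0n mulr0.
Qed.

Lemma taylor_term_le (x y : R) n k : 0 <= x -> 0 <= y ->
  (x ^+ (n - k) *+ 'C(n, k)) * y ^+ k <= (x + y) ^+ n.
Proof.
move=> x0 y0; have [nk|kn] := ltnP n k.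
  by rewrite bin_small// mulr0n mul0r exprn_ge0// addr_ge0.
rewrite exprDn (bigD1 (inord k)) //= inordK ?ltnS// mulrnAl lerDl sumr_ge0// => i _.
by rewrite mulrn_wge0// mulr_ge0// exprn_ge0.
Qed.

(** Replacing [nc h] by [2 * nc h] multiplies the term of index [K + k] by [2 ^+ (K + k)], at least
    [2 ^+ K]; the tail is then dominated by a full binomial expansion. *)
Lemma taylor_tail_le z h n K :
  nc ((z + h) ^+ n - \sum_(k < K) (z ^+ (n - k) *+ 'C(n, k)) * h ^+ k) <=
  (nc z + 2 * nc h) ^+ n / 2 ^+ K.
Proof.
pose f (k : nat) := (z ^+ (n - k) *+ 'C(n, k)) * h ^+ k.
(* Padding with vanishing terms up to [maxn n.+1 K] allows a split at [K] even when [n < K]. *)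
have fE : (z + h) ^+ n = \sum_(k < maxn n.+1 K) f k.
  rewrite (sum_ord_split _ (leq_maxl _ _)) [X in _ = _ + X]big1 => [|i _].
    by rewrite addr0 exprDn; apply: eq_bigr => i _; rewrite /f mulrnAl.
  by rewrite /f bin_small ?mulr0n ?mul0r// ltnS -ltnS -addSn leq_addr.
rewrite -/(f _) fE (sum_ord_split f (leq_maxr n.+1 K)) addrAC subrr add0r.
apply: le_trans (nc_sum _ (fun k => f (K + k)%N)) _.
pose g (k : nat) := (nc z ^+ (n - k) *+ 'C(n, k)) * (2 * nc h) ^+ k.
have fg k : nc (f (K + k)%N) <= g (K + k)%N / 2 ^+ K.
  rewrite /f /g ncM -mulr_natr ncM nc_nat !ncX mulr_natr exprMn mulrCA.
  rewrite mulrAC ler_peMl ?mulr_ge0 ?mulrn_wge0 ?exprn_ge0 ?nc_ge0//.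
  by rewrite exprD mulrAC divff ?expf_neq0// mul1r exprn_ege1// ler1n.
have g0 k : 0 <= g k by rewrite mulr_ge0 ?mulrn_wge0 ?exprn_ge0 ?mulr_ge0 ?nc_ge0.
apply: (@le_trans _ _ (\sum_(k < maxn n.+1 K) g k / 2 ^+ K)).
  rewrite (sum_ord_split (fun k => g k / 2 ^+ K) (leq_maxr n.+1 K)).
  apply: (@le_trans _ _ (\sum_(k < maxn n.+1 K - K) (g (K + k)%N / 2 ^+ K))).
    by apply: ler_sum => k _; exact: fg.
  rewrite lerDr sumr_ge0// => i _.
  by rewrite divr_ge0// exprn_ge0.
rewrite -mulr_suml ler_wpM2r ?invr_ge0 ?exprn_ge0//.
rewrite (sum_ord_split _ (leq_maxl n.+1 K)) [X in _ + X <= _]big1 => [|i _].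
  by rewrite addr0 exprDn ler_sum// => i _; rewrite /g mulrnAl.
by rewrite /g bin_small ?mulr0n ?mul0r// ltnS -ltnS -addSn leq_addr.
Qed.

(* The majorants [nc z + 2 * nc h] make the double series of the re-expansion
   converge geometrically in both indices. *)
Lemma taylor a F z : entire a -> has_ps a F ->
  exists c, [/\ entire c, has_ps c (fun h => F (z + h)) &
    forall k, gsum (fun n => a n * (z ^+ (n - k) *+ 'C(n, k))) (c k)].
Proof.
move=> ea aF.
have bnd (r : R) : 0 <= r -> exists C, forall n, nc (a n) * (nc z + r) ^+ n <= C / 2 ^+ n.
  by move=> r0; apply: entire_geometric => //; rewrite addr_ge0 ?nc_ge0.
have termE n k : nc (a n * (z ^+ (n - k) *+ 'C(n, k))) =
    nc (a n) * (nc z ^+ (n - k) *+ 'C(n, k)).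
  by rewrite ncM -[in LHS]mulr_natr ncM nc_nat ncX mulr_natr.
have /choice[c Hc] : forall k, exists l, gsum (fun n => a n * (z ^+ (n - k) *+ 'C(n, k))) l.
  move=> k; have [C HC] := bnd 1 ler01; apply: (@gsum_exists _ _ C) => n.
  apply: le_trans (HC n); rewrite termE ler_wpM2l ?nc_ge0//.
  by have := @taylor_term_le (nc z) 1 n k (nc_ge0 _) ler01; rewrite expr1n mulr1.
have ec : entire c.
  move=> r r0; have [C HC] := bnd r r0; exists (4 * C) => k.
  have -> : nc (c k) * r ^+ k = nc (r%:C ^+ k * c k).
    by rewrite ncM ncX nc_real (ger0_norm r0) mulrC.
  apply: gsum_le (gsumZ _ (Hc k)) _ => n.
  rewrite ncM termE ncX nc_real (ger0_norm r0) mulrCA; apply: le_trans (HC n).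
  by rewrite ler_wpM2l ?nc_ge0// mulrC taylor_term_le ?nc_ge0.
exists c; split => // h.
have [C HC] := bnd (2 * nc h) (mulr_ge0 (ler0n _ _) (nc_ge0 _)).
exists (4 * C) => K.
(* The [K]-th partial sum in [h] is itself a sum over [n], so its distance to [F (z + h)] can be
   estimated term by term in [n], without exchanging two infinite sums. *)
have Hs := gsum_sum (index_enum 'I_K) (fun k => gsumZ (h ^+ (k : 'I_K)) (Hc k)).
have := gsumB (aF (z + h)) Hs => /(@gsum_le _ _ _ (C / 2 ^+ K)).
rewrite mulrA; under [X in _ - X]eq_bigr do rewrite mulrC.
apply => n; rewrite mulrAC; apply: le_trans (_ : _ <= nc (a n) * (nc z +
  2 * nc h) ^+ n / 2 ^+ K) _; last first.
  by rewrite ler_wpM2r ?invr_ge0 ?exprn_ge0.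
rewrite -mulrA; apply: le_trans (ler_wpM2l (nc_ge0 _) (taylor_tail_le z h n K)).
rewrite -ncM mulrBr mulr_sumr le_eqVlt; apply/orP; left; apply/eqP; congr (nc (_ - _)).
by apply: eq_bigr => i _; rewrite mulrC mulrA.
Qed.

(** This remainder bound is what yields both continuity and the derivative at the centre of
    expansion. *)
Lemma ps_quadratic c G : entire c -> has_ps c G ->
  exists2 B, 0 <= B & forall h, nc h <= 1 -> nc (G h - c 0%N - c 1%N * h) <= B * nc h ^+ 2.
Proof.
move=> ec cG; have [C HC] := entire_geometric ec ler01.
have C0 : 0 <= C by have := HC 0%N; rewrite !expr0 divr1 mulr1; apply: le_trans; exact: nc_ge0.
exists (4 * C); first by rewrite mulr_ge0.
move=> h h1; pose u n := if (n < 2)%N then c n * h ^+ n else 0.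
have -> : c 0%N = u 0%N by rewrite /u/= mulr1.
have -> : c 1%N * h = u 1%N by [].
rewrite -addrA -opprD; have -> : u 0%N + u 1%N = \sum_(k < 2) u k
  by rewrite big_ord_recr big_ord1.
have u0 n : (2 <= n)%N -> u n = 0 by move=> n2; rewrite /u ltnNge n2.
rewrite -mulrA; apply: gsum_le (gsumB (cG h) (gsum_finite u0)) _ => n.
rewrite /u; case: ltnP => [_|n2].
  by rewrite subrr nc0 divr_ge0 ?mulr_ge0 ?exprn_ge0 ?nc_ge0.
rewrite subr0 ncM ncX mulrAC -(subnK n2) exprD mulrA ler_wpM2r ?exprn_ge0 ?nc_ge0//.
rewrite subnK//; apply: le_trans (HC n); rewrite expr1n mulr1 ler_piMr ?nc_ge0//.
by rewrite exprn_ile1 ?nc_ge0.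
Qed.

Lemma entireD a b : entire a -> entire b -> entire (fun n => a n + b n).
Proof.
move=> ea eb r r0; have [C HC] := ea r r0; have [D HD] := eb r r0.
exists (C + D) => n; apply: le_trans (lerD (HC n) (HD n)).
by rewrite -mulrDl ler_wpM2r ?exprn_ge0// ncD.
Qed.

Lemma entireZ z a : entire a -> entire (fun n => z * a n).
Proof.
move=> ea r r0; have [C HC] := ea r r0.
by exists (nc z * C) => n; rewrite ncM -mulrA ler_wpM2l ?nc_ge0.
Qed.

Lemma has_psD a b F G : has_ps a F -> has_ps b G ->
  has_ps (fun n => a n + b n) (fun z => F z + G z).
Proof. by move=> aF bG z; apply: gsum_eq (gsumD (aF z) (bG z)) => n; rewrite mulrDl. Qed.

Lemma has_psZ w a F : has_ps a F -> has_ps (fun n => w * a n) (fun z => w * F z).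
Proof. by move=> aF z; apply: gsum_eq (gsumZ w (aF z)) => n; rewrite mulrA. Qed.

Lemma entire_shift m a : entire a -> entire (fun n => a (n + m)%N).
Proof.
move=> ea r r0; have [C HC] := ea (1 + r) (addr_ge0 ler01 r0).
exists C => n; apply: le_trans (HC (n + m)%N); rewrite ler_wpM2l ?nc_ge0//.
have r1 : 1 <= 1 + r by rewrite lerDl.
apply: (@le_trans _ _ ((1 + r) ^+ n)).
  by rewrite lerXn2r ?nnegrE ?addr_ge0// lerDr.
by rewrite ler_weXn2l// leq_addr.
Qed.

Lemma entire_deriv a : entire a -> entire (fun n => a n.+1 *+ n.+1).
Proof.
(* The factor 2 pays for [n.+1 <= 2 ^+ n.+1], and [1 + r] for the exponent raised by one. *)
move=> ea r r0; have r2 : 0 <= 2 * (1 + r) by rewrite mulr_ge0 ?addr_ge0.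
have [C HC] := ea _ r2; exists C => n; apply: le_trans (HC n.+1).
rewrite -[a n.+1 *+ _]mulr_natr ncM nc_nat -mulrA ler_wpM2l ?nc_ge0// exprMn ler_pM ?exprn_ge0//.
  by rewrite -natrX ler_nat ltnW// ltn_expl.
rewrite exprS; apply: (@le_trans _ _ ((1 + r) ^+ n)).
  by rewrite lerXn2r ?nnegrE ?addr_ge0// lerDr.
by rewrite ler_peMl ?exprn_ge0 ?addr_ge0// lerDl.
Qed.

End power_series.

(** * Limits and derivatives in [R[i]] through the real modulus *)

Section complex_topology.
Context {R : realType}.
Implicit Types (z w h l : R[i]).

(** The norm of [R[i]^o] takes values in [R[i]]; a positive element of [R[i]] has zero imaginary
    part, which reduces its epsilons to real ones. *)
Lemma cvg_nc (T : Type) (F : set_system T) {FF : Filter F} (f : T -> R[i]^o) l :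
  nc (f x - l) @[x --> F] --> (0 : R) -> f x @[x --> F] --> (l : R[i]^o).
Proof.
move=> H; apply/cvgrPdist_lt => e e0.
have [eE Re0] : e = (complex.Re e)%:C /\ 0 < complex.Re e.
  by move: e0; rewrite ltcE; case: e => x y /= /andP[/eqP -> ?].
have Hn := (@cvgrPdist_lt _ _ T F FF _ _).1 H _ Re0; apply: filterS Hn => x.
rewrite sub0r normrN ger0_norm ?nc_ge0// => xe.
by rewrite nc_normE nc_distC eE ltcR.
Qed.

Lemma nc_cvg (T : Type) (F : set_system T) {FF : Filter F} (f : T -> R[i]^o) l :
  f x @[x --> F] --> (l : R[i]^o) -> nc (f x - l) @[x --> F] --> (0 : R).
Proof.
move=> H; apply/cvgrPdist_lt => e e0.
have e0' : 0 < e%:C :> R[i] by rewrite ltcR.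
have Hn := (@cvgrPdist_lt _ _ T F FF _ _).1 H _ e0'; apply: filterS Hn => x.
by rewrite nc_normE ltcR sub0r normrN ger0_norm ?nc_ge0// nc_distC.
Qed.

Lemma near_nc (P : R[i] -> Prop) z (e : R) : 0 < e ->
  (forall w, nc (w - z) < e -> P w) -> \forall w \near (z : R[i]^o), P w.
Proof.
move=> e0 H; apply/nbhs_normP; exists e%:C; first by rewrite /= ltcR.
by move=> w /=; rewrite nc_normE ltcR nc_distC => /H.
Qed.

Lemma nearP_nc (P : R[i] -> Prop) z : (\forall w \near (z : R[i]^o), P w) ->
  exists2 e : R, 0 < e & forall w, nc (w - z) < e -> P w.
Proof.
move=> /nbhs_normP[e /= e0 H].
have [eE Re0] : e = (complex.Re e)%:C /\ 0 < complex.Re e.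
  by move: e0; rewrite ltcE; case: e {H} => x y /= /andP[/eqP -> ?].
exists (complex.Re e) => // w wz; apply: H => /=.
by rewrite nc_normE eE ltcR nc_distC.
Qed.

Lemma lipschitz_cvg (f : R[i] -> R[i]) z (B : R) :
  (forall h, nc h <= 1 -> nc (f (z + h) - f z) <= B * nc h) ->
  (f : R[i]^o -> R[i]^o) w @[w --> (z : R[i]^o)] --> (f z : R[i]^o).
Proof.
move=> H; apply: (@cvg_nc _ (nbhs (z : R[i]^o)) _ (f : R[i]^o -> R[i]^o)).
apply/cvgrPdist_lt => e e0.
have B1 : 0 < `|B| + 1 by rewrite ltr_wpDl.
apply: (@near_nc _ _ (Num.min 1 (e / (`|B| + 1)))).
  by rewrite lt_min ltr01 divr_gt0.
move=> w; rewrite lt_min => /andP[w1 w2].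
rewrite sub0r normrN ger0_norm ?nc_ge0//; have := H _ (ltW w1).
rewrite [z + _]addrC subrK => /le_lt_trans; apply.
rewrite ltr_pdivlMr// in w2; apply: le_lt_trans w2.
by rewrite mulrC ler_wpM2l ?nc_ge0// (le_trans (ler_norm _))// lerDl.
Qed.

Lemma derive1_quadratic (f : R[i] -> R[i]) z l (B : R) :
  (forall h, nc h <= 1 -> nc (f (z + h) - f z - l * h) <= B * nc h ^+ 2) ->
  derive1 (f : R[i] -> R[i]^o) z = l.
Proof.
move=> H; apply: cvg_lim; first exact: norm_hausdorff.
apply: cvg_nc; apply/cvgrPdist_lt => e e0.
have B1 : 0 < `|B| + 1 by rewrite ltr_wpDl.
apply: (@near_nc _ 0 (Num.min 1 (e / (`|B| + 1)))).
  by rewrite lt_min ltr01 divr_gt0.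
move=> h; rewrite subr0 lt_min => /andP[h1 h2] h0.
rewrite sub0r normrN ger0_norm ?nc_ge0//.
have -> : h^-1 *: ((f : R[i] -> R[i]^o) (h + z) - f z) - l = h^-1 * (f (z + h) - f z - l * h).
  by rewrite [h + z]addrC mulrBr [l * h]mulrC mulKf.
have h3 : 0 < nc h by rewrite nc_gt0.
rewrite ncM ncV ltr_pdivrMl//.
apply: le_lt_trans (H _ (ltW h1)) _; rewrite expr2 mulrA mulrC ltr_pM2l//.
rewrite ltr_pdivlMr// in h2; apply: le_lt_trans h2.
by rewrite [B * _]mulrC ler_wpM2l ?nc_ge0// (le_trans (ler_norm _))// lerDl.
Qed.

End complex_topology.

(** * Derivatives and orders of vanishing of power series *)

Section derivatives.
Context {R : realType}.
Implicit Types (a b c : nat -> R[i]) (F G : R[i] -> R[i]) (z w h : R[i]).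

Lemma ps_lipschitz c G : entire c -> has_ps c G ->
  exists B, forall h, nc h <= 1 -> nc (G (0 + h) - G 0) <= B * nc h.
Proof.
move=> ec cG; have [B B0 HB] := ps_quadratic ec cG; exists (B + nc (c 1%N)) => h h1.
rewrite add0r (has_ps0 cG) -(subrK (c 1%N * h) (G h - _)).
apply: le_trans (ncD _ _) _; rewrite mulrDl ncM lerD2r; apply: le_trans (HB _ h1) _.
by rewrite expr2 mulrA ler_piMr// mulr_ge0 ?nc_ge0.
Qed.

Lemma ps_cvg c G : entire c -> has_ps c G ->
  (G : R[i]^o -> R[i]^o) h @[h --> (0 : R[i]^o)] --> (c 0%N : R[i]^o).
Proof.
move=> ec cG; rewrite -(has_ps0 cG); have [B HB] := ps_lipschitz ec cG.
exact: lipschitz_cvg HB.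
Qed.

(** After re-expansion at [z] the derivative is the linear coefficient; its expression as a sum over
    [n] starts with a zero term, and dropping that term shifts the index to [n.+1]. *)
Lemma has_ps_derive1 a F : entire a -> has_ps a F ->
  has_ps (fun n => a n.+1 *+ n.+1) (derive1 (F : R[i] -> R[i]^o)).
Proof.
move=> ea aF z; have [c [ec cF Hc]] := taylor z ea aF.
have [B B0 HB] := ps_quadratic ec cF.
have -> : derive1 (F : R[i] -> R[i]^o) z = c 1%N.
  apply: (@derive1_quadratic _ _ _ _ B) => h h1; have := HB h h1.
  by rewrite -(has_ps0 cF) addr0.
have := gsum_shift (Hc 1%N); rewrite bin0n mulr0n mulr0 subr0.
by apply: gsum_eq => n; rewrite subn1 bin1 mulrnAl mulrnAr.
Qed.

Lemma entire_derive1n k a F : entire a -> has_ps a F ->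
  let b n := a (n + k)%N *+ (n + k) ^_ k in
  entire b /\ has_ps b (derive1n k (F : R[i] -> R[i]^o)).
Proof.
move=> ea aF /=; elim: k => [|k [eb bF]].
  have -> : (fun n => a (n + 0)%N *+ (n + 0) ^_ 0) = a.
    by apply/funext => n; rewrite addn0 ffactn0.
  by [].
have -> : (fun n => a (n + k.+1)%N *+ (n + k.+1) ^_ k.+1) =
    (fun n => (a (n.+1 + k)%N *+ (n.+1 + k) ^_ k) *+ n.+1).
  apply/funext => n; rewrite -addSnnS ffactnSr -mulrnA; congr (_ *+ (_ * _)).
  by rewrite addnK.
by split; [exact: (entire_deriv eb)|rewrite derive1nS; exact: (has_ps_derive1 eb bF)].
Qed.

Lemma derive1n_shift k F z h :
  derive1n k ((fun h => F (z + h)) : R[i] -> R[i]^o) h =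
  derive1n k (F : R[i] -> R[i]^o) (z + h).
Proof.
elim: k h => [//|k IH] h; rewrite !derive1nS /derive1.
have -> : derive1n k ((fun h => F (z + h)) : R[i] -> R[i]^o) =
    (fun h => derive1n k (F : R[i] -> R[i]^o) (z + h)) by apply/funext => w.
by under eq_fun do rewrite addrCA.
Qed.

Lemma derive1n_taylor c F z k : entire c -> has_ps c (fun h => F (z + h)) ->
  derive1n k (F : R[i] -> R[i]^o) z = c k *+ k`!.
Proof.
move=> ec cF; have [_ H] := entire_derive1n k ec cF.
by rewrite -[z in LHS]addr0 -derive1n_shift (has_ps0 H) add0n ffactnn.
Qed.

(** Factorials being nonzero, multiplicity in the sense of derivatives becomes the order of
    vanishing of the Taylor coefficients. *)
Lemma zero_of_multP c F z m : entire c -> has_ps c (fun h => F (z + h)) ->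
  zero_of_mult F z m <-> (forall k, (k < m)%N -> c k = 0) /\ c m <> 0.
Proof.
move=> ec cF; have E k : derive1n k (F : R[i] -> R[i]^o) z = 0 <-> c k = 0.
  rewrite (derive1n_taylor _ ec cF); split=> [/eqP|->]; last by rewrite mul0rn.
  by rewrite mulrn_eq0 -leqn0 leqNgt fact_gt0 => /eqP.
split=> -[H1 H2]; split=> [k /H1/E//|/E//].
Qed.

Lemma ps_factor m c G : entire c -> has_ps c G -> (forall k, (k < m)%N -> c k = 0) ->
  exists2 g, has_ps (fun n => c (n + m)%N) g & forall h, G h = h ^+ m * g h.
Proof.
move=> ec cG c0; have [g Hg] := has_ps_exists (entire_shift m ec).
exists g => // h.
have H : gsum (fun n => c (n + m)%N * h ^+ (n + m)) (G h).
  by apply: (gsum_shiftn (cG h)) => k km; rewrite c0 ?mul0r.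
apply: gsum_uniq H _; apply: gsum_eq (gsumZ (h ^+ m) (Hg h)) => n.
by rewrite exprD; ring.
Qed.

Lemma ps_eq0 c G : has_ps c G -> (forall k, c k = 0) -> forall h, G h = 0.
Proof.
by move=> cG c0 h; apply: gsum_uniq (cG h) (gsum_eq _ gsum0) => n; rewrite c0 mul0r.
Qed.

(** Both sequences are read off from the derivatives of [F] at 0. This later turns an equality of
    characteristic functions into equalities of moments. *)
Lemma ps_coef_uniq a b F : entire a -> entire b -> has_ps a F -> has_ps b F -> a = b.
Proof.
move=> ea eb aF bF; apply/funext => k.
have E0 : (fun h => F (0 + h)) = F by apply/funext => h; rewrite add0r.
have := derive1n_taylor (F := F) (z := 0) k ea; rewrite E0 => /(_ aF).
have := derive1n_taylor (F := F) (z := 0) k eb; rewrite E0 => /(_ bF) -> /eqP.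
rewrite -subr_eq0 -mulrnBl mulrn_eq0 -leqn0 leqNgt fact_gt0 subr_eq0 => /eqP.
by move->.
Qed.

End derivatives.

(** * A maximum principle without complex integration *)

Section maximum_principle.
Context {R : realType}.
Implicit Types (f g : R[i] -> R[i]) (z w h : R[i]).

Definition ccontinuous f := continuous (f : R[i]^o -> R[i]^o).

Definition locally_const f z :=
  exists2 e : R, 0 < e & forall h, nc h < e -> f (z + h) = f z.

(** The local form of a nonconstant analytic function. Only continuity of [g] at 0 is asked, so that
    quotients of power series qualify without being expanded again. *)
Definition locally_power f z := exists m g (e : R),
  [/\ (0 < m)%N, 0 < e, forall h, nc h < e -> f (z + h) = f z + h ^+ m * g h,
      g 0 != 0 & (g : R[i]^o -> R[i]^o) h @[h --> (0 : R[i]^o)] --> (g 0 : R[i]^o)].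

(** Take [zeta] with [zeta ^+ m * g 0 = f z] and [h = t * zeta]: then [f (z + h)] is
    [(1 + t ^+ m) * f z] up to an error of at most half of [t ^+ m * nc (f z)]. If [f z = 0], any
    small nonzero [h] works. *)
Lemma locally_power_gt f z (e : R) : locally_power f z -> 0 < e ->
  exists2 h, nc h < e & nc (f z) < nc (f (z + h)).
Proof.
move=> [m [g [d [m0 d0 fg g0 gc]]]] e0.
have G0 : 0 < nc (g 0) by rewrite nc_gt0.
have [d1 d10 Hd1] : exists2 d1 : R, 0 < d1 & forall h, nc h < d1 ->
  nc (g h - g 0) <= nc (g 0) / 2.
  have G2 : 0 < nc (g 0) / 2 by rewrite divr_gt0.
  have [d1 d10 H] := nearP_nc ((cvgrPdist_lt _ _).1 (nc_cvg gc) _ G2).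
  exists d1 => // h hd; have := H h; rewrite subr0 => /(_ hd).
  by rewrite sub0r normrN ger0_norm ?nc_ge0// => /ltW.
pose r := Num.min e (Num.min d d1).
have r0 : 0 < r by rewrite !lt_min e0 d0 d10.
have small (zeta : R[i]) : exists2 t : R, 0 < t & nc (t%:C * zeta) < r.
  exists (r / (nc zeta + 1)); first by rewrite divr_gt0// ltr_wpDl// nc_ge0.
  rewrite ncM nc_real ger0_norm ?divr_ge0 ?addr_ge0 ?nc_ge0 ?(ltW r0)//.
  have z1 : 0 < nc zeta + 1 by rewrite ltr_wpDl// nc_ge0.
  by rewrite mulrAC ltr_pdivrMr// ltr_pM2l// ltrDl.
have [fz0|fz0] := eqVneq (f z) 0.
  have [t t0 tr] := small 1; rewrite mulr1 in tr.
  move: (tr); rewrite !lt_min => /and3P[te td td1]; exists t%:C => //.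
  rewrite fg// fz0 add0r nc0 ncM ncX mulr_gt0//.
    by rewrite exprn_gt0// nc_real ger0_norm ?ltW.
  rewrite nc_gt0; apply/eqP => g00; have := Hd1 _ td1; rewrite g00 sub0r ncN.
  lra.
pose zeta := m.-root (f z / g 0).
have zetaE : zeta ^+ m * g 0 = f z by rewrite rootCK// divfK.
have [t t0 tr] := small zeta; move: (tr); rewrite !lt_min => /and3P[te td td1].
exists (t%:C * zeta) => //; rewrite fg//; set h := t%:C * zeta.
have -> : f z + h ^+ m * g h = (1 + t ^+ m)%:C * f z + h ^+ m * (g h - g 0).
  rewrite mulrBr [h ^+ m * g 0](_ : _ = (t ^+ m)%:C * f z); last first.
    by rewrite exprMn -mulrA zetaE rmorphXn.
  by rewrite rmorphD rmorph1 mulrDl mul1r -!addrA; congr (_ + _); rewrite addrCA subrr addr0.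
have F0 : 0 < nc (f z) by rewrite nc_gt0.
have T0 : 0 < t ^+ m by rewrite exprn_gt0.
apply: (@lt_le_trans _ _ ((1 + t ^+ m) * nc (f z) - t ^+ m * nc (f z) / 2)).
  by rewrite mulrDl mul1r -addrA ltrDl subr_gt0 ltr_pdivrMr// ltr_pMr ?mulr_gt0// ltr1n.
rewrite -[X in _ <= nc (_ + X)]opprK; apply: le_trans (nc_lerB _ _).
apply: lerB; first by rewrite ncM nc_real ger0_norm// addr_ge0// ltW.
rewrite ncN ncM.
apply: le_trans (ler_wpM2l (nc_ge0 _) (Hd1 _ td1)) _.
rewrite /h exprMn ncM ncX nc_real ger0_norm ?(ltW t0)// -mulrA mulrA.
have -> : nc (f z) = nc (zeta ^+ m) * nc (g 0) by rewrite -ncM zetaE.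
by rewrite !mulrA.
Qed.

(** For z = rho^2 this is 2 max((Re rho)^2, (Im rho)^2), so its level sets are the contours. *)
Let N z := nc z + `|complex.Re z|.

(** [N] is positively homogeneous, so away from 0 a radial move increases it. *)
Lemma tilted_norm_grows z (e : R) : 0 < e -> exists2 h, nc h < e & N z < N (z + h).
Proof.
move=> e0; have [->|z0] := eqVneq z 0.
  exists (e / 2)%:C; first by rewrite nc_real ger0_norm ?ltW ?divr_gt0//; lra.
  rewrite add0r /N nc0 normr0 addr0 ltr_wpDr ?normr_ge0// nc_real normr_gt0; lra.
have N0 : 0 < nc z by rewrite nc_gt0.
pose t := e / (2 * nc z).
have t0 : 0 < t by rewrite divr_gt0// mulr_gt0.
exists (t%:C * z).
  rewrite ncM nc_real ger0_norm ?ltW// /t invfM mulrA mulfVK ?gt_eqF//; lra.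
have -> : z + t%:C * z = (1 + t)%:C * z by rewrite rmorphD mulrDl mul1r.
rewrite /N ncM nc_real.
have -> : complex.Re ((1 + t)%:C * z) = (1 + t) * complex.Re z.
  by case: (z) => u v /=; rewrite mul0r subr0.
rewrite normrM ger0_norm ?addr_ge0 ?ltW// mulrDl mul1r [(1 + t) * _]mulrDl mul1r.
have := mulr_gt0 t0 N0; have := mulr_ge0 (ltW t0) (normr_ge0 (complex.Re z)); lra.
Qed.

Lemma nc_lipschitz_continuous (g : R[i] -> R) :
  (forall z w, `|g z - g w| <= nc (z - w)) -> continuous (g : R[i]^o -> R).
Proof.
move=> H z.
apply/(@cvgrPdist_lt _ _ (R[i]^o) (nbhs (z : R[i]^o)) (nbhs_filter _) g (g z)) => e e0.
apply: (@near_nc _ _ z e) => // w wz; apply: le_lt_trans (H _ _) _.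
by rewrite nc_distC.
Qed.

Lemma nc_continuous : continuous (@Normc.normc R : R[i]^o -> R).
Proof.
apply: nc_lipschitz_continuous => z w; rewrite ler_norml lerBlDr -lerBlDr nc_lerB andbT.
by rewrite lerNl opprB nc_distC nc_lerB.
Qed.

Lemma complex_continuous : continuous (fun p : R * R => (p.1 +i* p.2 : R[i]^o)).
Proof.
move=> p; apply: (@cvg_nc _ _ (nbhs p) (nbhs_filter _)).
apply/(@cvgrPdist_lt _ _ _ (nbhs p) (nbhs_filter _)) => e e0.
have e2 : 0 < e / 2 by rewrite divr_gt0.
have H1 := (cvgrPdist_lt _ _).1 (@cvg_fst _ _ (nbhs p.1) (nbhs p.2) _) _ e2.
have H2 := (cvgrPdist_lt _ _).1 (@cvg_snd _ _ (nbhs p.1) (nbhs p.2) _) _ e2.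
near=> x; rewrite sub0r normrN ger0_norm ?nc_ge0//.
apply: le_lt_trans (nc_le_ReIm _) _ => /=.
rewrite (splitr e) ltrD// distrC; near: x; [exact: H1|exact: H2].
Unshelve. all: by end_near. Qed.

Lemma tilted_norm_continuous : continuous (N : R[i]^o -> R).
Proof.
move=> z; apply: (@cvgD _ _ (R[i]^o) (nbhs (z : R[i]^o)) (nbhs_filter _)).
  exact: nc_continuous.
apply: (@cvg_norm _ _ (R[i]^o) (nbhs (z : R[i]^o)) (nbhs_filter _)).
apply: (@nc_lipschitz_continuous (@complex.Re R)) => u v.
by rewrite -ReB nc_ge_Re.
Qed.

(* Among the maximizers of [nc (f z)] on the compact set, one with [N] maximal
   cannot be interior. *)
Lemma maximum_principle f (s M : R) : ccontinuous f ->
  (forall z, locally_const f z \/ locally_power f z) ->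
  (forall z, N z = s -> nc (f z) <= M) ->
  forall z, N z <= s -> nc (f z) <= M.
Proof.
move=> cf loc HM z0 z0s; rewrite leNgt; apply/negP => Mz0.
(* The region is pulled back to the real plane, where it is a closed subset of a product of
   segments. *)
pose c (p : R * R) : R[i]^o := p.1 +i* p.2.
pose K := [set p | N (c p) <= s].
have Nc : continuous (fun p => N (c p)).
  move=> p; apply: (@continuous_comp _ (R[i]^o) _ c N).
    exact: complex_continuous.
  exact: tilted_norm_continuous.
have fc : continuous (fun p => nc (f (c p))).
  move=> p; apply: (@continuous_comp _ (R[i]^o) _ (fun p => f (c p) : R[i]^o) (@Normc.normc R)).
    apply: (@continuous_comp _ (R[i]^o) (R[i]^o) c f); first exact: complex_continuous.
    exact: cf.
  exact: nc_continuous.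
have clK : closed K.
  by apply: (@closed_comp _ _ (fun p => N (c p)) [set x | x <= s]) => //; exact: closed_le.
have cK : compact K.
  apply: (@subclosed_compact _ _ (`[- s, s]%classic `*` `[- s, s]%classic)) => //.
    by apply: compact_setX; exact: segment_compact.
  move=> [x y] /=; rewrite /K /= !in_itv/= -!ler_norml => Ns.
  have [Nx Ny] := (nc_ge_Re (x +i* y), nc_ge_Im (x +i* y)).
  by split; [apply: le_trans Nx _|apply: le_trans Ny _]; apply: le_trans Ns; rewrite lerDl.
have cE w : c (complex.Re w, complex.Im w) = w by case: w.
have KE w : N w <= s -> K (complex.Re w, complex.Im w) by rewrite -{1}(cE w).
have [p Kp pmax] := @compact_EVT_max _ _ (fun p => nc (f (c p))) K
  (ex_intro _ _ (KE _ z0s)) cK (continuous_subspaceT fc).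
pose K' := K `&` [set p' | nc (f (c p)) <= nc (f (c p'))].
have cK' : compact K'.
  apply: compact_closedI => //.
  by apply: (@closed_comp _ _ (fun p => nc (f (c p))) [set x | _ <= x]) => //; exact: closed_ge.
have [p' /set_mem[Kp' pp'] p'max] := @compact_EVT_max _ _ (fun p => N (c p)) K'
  (ex_intro _ p (conj (set_mem Kp) (lexx _))) cK' (continuous_subspaceT Nc).
set w := c p' in pp' p'max.
have wmax v : N v <= s -> nc (f v) <= nc (f w).
  move=> vs; apply: le_trans pp'; rewrite -(cE v); apply: pmax.
  exact/mem_set/KE.
(* A maximizer on the boundary would obey the bound [M], which the value at [z0] exceeds. *)
have Ns : N w < s.
  rewrite lt_neqAle (Kp' : N w <= s) andbT; apply/eqP => /HM; apply/negP; rewrite -ltNge.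
  exact: lt_le_trans Mz0 (wmax _ z0s).
have [e e0 He] : exists2 e : R, 0 < e & forall h, nc h < e -> N (w + h) <= s.
  exists ((s - N w) / 2); first by rewrite divr_gt0// subr_gt0.
  move=> h hs; have := ncD w h; have := nc_ge_Re h; rewrite /N ReD.
  have := ler_normD (complex.Re w) (complex.Re h); rewrite ltr_pdivlMr// in hs.
  by move: hs; rewrite /N; lra.
(* If [f] is constant near [w], some nearby maximizer has a larger [N]; otherwise some nearby value
   of [f] is larger. *)
have [[d d0 fd]|pw] := loc w.
  have ed : 0 < Num.min e d by rewrite lt_min e0.
  have [h] := @tilted_norm_grows w _ ed.
  rewrite lt_min => /andP[he hd]; rewrite ltNge => /negP; apply.
  rewrite -(cE (w + h)); apply: p'max; apply/mem_set; split; first exact/KE/He.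
  by rewrite /= cE fd.
have [h he] := locally_power_gt pw e0; rewrite ltNge => /negP; apply.
exact: wmax (He _ he).
Unshelve. all: by end_near. Qed.

End maximum_principle.

(** * Entire functions determined by their zeros and a contour estimate *)

Section zero_determination.
Context {R : realType}.
Implicit Types (a b c d : nat -> R[i]) (F G : R[i] -> R[i]) (z w h : R[i]).

Lemma zero_of_mult_uniq F z m n : zero_of_mult F z m -> zero_of_mult F z n -> m = n.
Proof.
by move=> [H1 H2] [K1 K2]; case: (ltngtP m n) => // [/K1|/H1].
Qed.

(** If all Taylor coefficients at [z] vanished, [F] would vanish everywhere, in particular at [w];
    [m] is the index of the first nonzero one. *)
Lemma order_exists a F z w : entire a -> has_ps a F -> F w != 0 ->
  exists m d g, [/\ entire d, has_ps d g, d 0%N != 0,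
    forall h, F (z + h) = h ^+ m * g h & zero_of_mult F z m].
Proof.
move=> ea aF Fw; have [c [ec cF _]] := taylor z ea aF.
have [k ck] : exists k, c k != 0.
  apply/not_existsP => c0; move/eqP: Fw; apply.
  have /(_ (w - z)) := ps_eq0 cF (fun k => ltac:(have := c0 k; move/negP;
    rewrite negbK => /eqP; exact)).
  by rewrite addrC subrK.
case: (ex_minnP (ex_intro (fun k => c k != 0) k ck)) => m cm mmin.
have c0 i : (i < m)%N -> c i = 0.
  by move=> im; apply: contraTeq im => /mmin; rewrite -leqNgt.
have [g dg Fg] := ps_factor ec cF c0.
exists m, (fun n => c (n + m)%N), g; split => //; first exact: entire_shift.
by apply/(zero_of_multP _ ec cF); split => //; exact/eqP.
Qed.

(** The hypothesis speaks of positive multiplicities only. If one order is 0 and the other positive,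
    the positive one transfers to the other function and contradicts uniqueness there. *)
Lemma same_order F G z m n :
  (forall m, (0 < m)%N -> zero_of_mult F z m <-> zero_of_mult G z m) ->
  zero_of_mult F z m -> zero_of_mult G z n -> m = n.
Proof.
move=> FG Fm Gn; case: m Fm => [|m] Fm; last exact: zero_of_mult_uniq ((FG m.+1 isT).1 Fm) Gn.
case: n Gn => [//|n] Gn; exact: zero_of_mult_uniq Fm ((FG n.+1 isT).2 Gn).
Qed.

Lemma ps_nonzero_near d g : entire d -> has_ps d g -> d 0%N != 0 ->
  exists2 e : R, 0 < e & forall h, nc h < e -> g h != 0.
Proof.
move=> ed dg d0; have D0 : 0 < nc (d 0%N) by rewrite nc_gt0.
have [e e0 He] := nearP_nc ((cvgrPdist_lt _ _).1 (nc_cvg (ps_cvg ed dg)) _ D0).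
exists e => // h he; have := He h; rewrite subr0 => /(_ he).
rewrite sub0r normrN ger0_norm ?nc_ge0// => H; apply/eqP => gh.
by move: H; rewrite gh sub0r ncN ltxx.
Qed.

Lemma cvgM_C (f g : R[i] -> R[i]) (x y : R[i]) :
  (f : R[i]^o -> R[i]^o) h @[h --> (0 : R[i]^o)] --> (x : R[i]^o) ->
  (g : R[i]^o -> R[i]^o) h @[h --> (0 : R[i]^o)] --> (y : R[i]^o) ->
  ((fun h => f h * g h) : R[i]^o -> R[i]^o) h @[h --> (0 : R[i]^o)] --> (x * y : R[i]^o).
Proof.
by move=> fx gy; exact: (cvgM fx gy).
Qed.

Lemma cvgV_C (f : R[i] -> R[i]) (x : R[i]) : x != 0 ->
  (f : R[i]^o -> R[i]^o) h @[h --> (0 : R[i]^o)] --> (x : R[i]^o) ->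
  ((fun h => (f h)^-1) : R[i]^o -> R[i]^o) h @[h --> (0 : R[i]^o)] --> (x^-1 : R[i]^o).
Proof.
by move=> x0 fx; exact: (@cvgV R[i] (R[i]^o) (nbhs (0 : R[i]^o)) (nbhs_filter _) f x x0).
Qed.

(** Both functions have the same order at each point, so the powers of [h] cancel and leave a
    quotient of series with nonzero constant terms; [H z] is the quotient of these constants. *)
Lemma ratio_extension a b F G w1 w2 : entire a -> has_ps a F -> F w1 != 0 ->
  entire b -> has_ps b G -> G w2 != 0 ->
  (forall z m, (0 < m)%N -> zero_of_mult F z m <-> zero_of_mult G z m) ->
  exists H, [/\ forall z, G z != 0 -> H z = F z / G z, ccontinuous H &
    forall z, locally_const H z \/ locally_power H z].
Proof.
move=> ea aF F0 eb bG G0 FG.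
have loc z : exists p : (nat -> R[i]) * (R[i] -> R[i]) * ((nat -> R[i]) * (R[i] -> R[i])) * nat,
    let: (d, f, (d', g), m) := p in
    [/\ [/\ entire d, has_ps d f & d 0%N != 0], [/\ entire d', has_ps d' g & d' 0%N != 0],
     forall h, F (z + h) = h ^+ m * f h & forall h, G (z + h) = h ^+ m * g h].
  have [m [d [f [ed df d0 Ff Fm]]]] := order_exists z ea aF F0.
  have [n [d' [g [ed' d'g d'0 Gg Gn]]]] := order_exists z eb bG G0.
  by exists (d, f, (d', g), m); split => //; rewrite (same_order (FG z) Fm Gn).
have /choice[H HH] : forall z, exists y, exists d f d' g m,
    [/\ y = d 0%N / d' 0%N, [/\ entire d, has_ps d f & d 0%N != 0],
     [/\ entire d', has_ps d' g & d' 0%N != 0],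
     forall h, F (z + h) = h ^+ m * f h & forall h, G (z + h) = h ^+ m * g h].
  move=> z; have [[[[d f] [d' g]] m] [A B C D]] := loc z.
  by exists (d 0%N / d' 0%N), d, f, d', g, m.
have HE z : G z != 0 -> H z = F z / G z.
  move=> Gz; have [d [f [d' [g [m [-> [ed df d0] [ed' d'g d'0] Ff Gg]]]]]] := HH z.
  have := Gg 0; have := Ff 0; rewrite addr0 => -> Gz0.
  have [m0|m0] := posnP m; last by move: Gz; rewrite Gz0 expr0n eqn0Ngt m0 mul0r eqxx.
  by rewrite Gz0 m0 !expr0 !mul1r (has_ps0 df) (has_ps0 d'g).
have Hloc z : exists d f d' g, exists2 e : R, 0 < e &
    [/\ [/\ entire d, has_ps d f & d 0%N != 0], [/\ entire d', has_ps d' g & d' 0%N != 0],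
     (forall h, nc h < e -> g h != 0) & forall h, nc h < e -> H (z + h) = f h / g h].
  have [d [f [d' [g [m [Hz [ed df d0] [ed' d'g d'0] Ff Gg]]]]]] := HH z.
  have [e e0 He] := ps_nonzero_near ed' d'g d'0.
  exists d, f, d', g, e => //; split => // h he.
  have [->|h0] := eqVneq h 0.
    by rewrite addr0 Hz (has_ps0 df) (has_ps0 d'g).
  have hm : h ^+ m != 0 by rewrite expf_neq0.
  by rewrite HE Gg ?mulf_neq0 ?He// Ff -mulf_div divff// mul1r.
exists H; split => // z.
  have [d [f [d' [g [e e0 [[ed df d0] [ed' d'g d'0] g0 Hh]]]]]] := Hloc z.
  have fg := cvgM_C (ps_cvg ed df) (cvgV_C d'0 (ps_cvg ed' d'g)).
  have Hz : H z = d 0%N / d' 0%N.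
    by rewrite -[z]addr0 Hh ?nc0// (has_ps0 df) (has_ps0 d'g).
  apply: (@cvg_nc _ _ (nbhs (z : R[i]^o)) (nbhs_filter _)).
  apply/(@cvgrPdist_lt _ _ _ (nbhs (z : R[i]^o)) (nbhs_filter _)) => eps eps0.
  have [e1 e10 He1] := nearP_nc ((cvgrPdist_lt _ _).1 (nc_cvg fg) _ eps0).
  apply: (@near_nc _ _ z (Num.min e e1)); first by rewrite lt_min e0.
  move=> w; rewrite lt_min => /andP[we we1].
  have := He1 (w - z); rewrite subr0 => /(_ we1); rewrite -Hz -Hh//.
  by rewrite [z + _]addrC subrK.
have [d [f [d' [g [e e0 [[ed df d0] [ed' d'g d'0] g0 Hh]]]]]] := Hloc z.
have Hz : H z = d 0%N / d' 0%N by rewrite -[z]addr0 Hh ?nc0// (has_ps0 df) (has_ps0 d'g).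
(* The numerator of [H (z + h) - H z] over the common denominator is again a power series: either it
   vanishes identically, or its leading term gives the local form. *)
pose k n := d' 0%N * d n + - d 0%N * d' n.
have ek : entire k by apply: entireD; exact: entireZ.
have kD : has_ps k (fun h => d' 0%N * f h + - d 0%N * g h) by apply: has_psD; exact: has_psZ.
have diff h : nc h < e -> H (z + h) = H z + (d' 0%N * f h + - d 0%N * g h) / (g h * d' 0%N).
  by move=> he; rewrite Hh// Hz; field; rewrite d'0 g0.
have [[w kw]|k0] := pselect (exists w, d' 0%N * f w + - d 0%N * g w != 0); last first.
  left; exists e => // h he; rewrite diff//.
  have [->|nz] := eqVneq (d' 0%N * f h + - d 0%N * g h) 0; first by rewrite mul0r addr0.
  by case: k0; exists h.
have [m [c [p [ec cp c0 kp km]]]] := order_exists 0 ek kD kw.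
right; exists m, (fun h => p h / (g h * d' 0%N)), e; split => //.
(* The numerator vanishes at [h = 0], so its order there is positive. *)
- rewrite lt0n; apply/eqP => m0; have [_] := km; rewrite m0 derive1n0; apply.
  by rewrite (has_ps0 df) (has_ps0 d'g); ring.
- by move=> h he; rewrite diff// -[h in f h]add0r -[h in g h]add0r kp add0r mulrA.
- by rewrite (has_ps0 cp) (has_ps0 d'g) mulf_neq0 ?invr_eq0 ?mulf_neq0.
- rewrite (has_ps0 cp) (has_ps0 d'g); apply: cvgM_C (ps_cvg ec cp) _.
  apply: cvgV_C; first by rewrite mulf_neq0.
  apply: cvgM_C (ps_cvg ed' d'g) _.
  exact: (@cvg_cst (R[i]^o) (d' 0%N : R[i]^o) (R[i]^o) (nbhs (0 : R[i]^o)) (nbhs_filter _)).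
Qed.

(* [H - 1], with [H] the entire extension of [F / G], is small on the large
   contours, hence everywhere by the maximum principle. *)
Lemma zeros_determine a b F G : entire a -> has_ps a F -> entire b -> has_ps b G ->
  (forall z m, (0 < m)%N -> zero_of_mult F z m <-> zero_of_mult G z m) ->
  (forall e s0 : R, 0 < e -> exists2 s, s0 <= s & forall z, nc z + `|complex.Re z| = s ->
    [/\ F z != 0, G z != 0 & nc (F z / G z - 1) <= e]) ->
  F = G.
Proof.
move=> ea aF eb bG FG contour.
have [w Fw Gw] : exists2 w, F w != 0 & G w != 0.
  (* The point ['i * s] has real part 0 and modulus [s], hence lies on the contour. *)
  have [s s0 Hs] := contour 1 0 ltr01; exists ('i%C * s%:C).
    by have [] := Hs ('i%C * s%:C);
      rewrite ?ncM ?nc_i ?nc_real /= ?mul0r ?mul1r ?subrr ?subr0 ?normr0 ?addr0 ?ger0_norm.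
  by have [] := Hs ('i%C * s%:C);
    rewrite ?ncM ?nc_i ?nc_real /= ?mul0r ?mul1r ?subrr ?subr0 ?normr0 ?addr0 ?ger0_norm.
have [H [HE cH lH]] := ratio_extension ea aF Fw eb bG Gw FG.
pose H1 z := H z - 1.
have cH1 : ccontinuous H1.
  move=> z; apply: (@cvgB R[i] (R[i]^o) (R[i]^o) (nbhs (z : R[i]^o)) (nbhs_filter _) H (fun=> 1)).
    exact: cH.
  exact: (@cvg_cst (R[i]^o) (1 : R[i]^o) (R[i]^o) (nbhs (z : R[i]^o)) (nbhs_filter _)).
have lH1 z : locally_const H1 z \/ locally_power H1 z.
  have [[e e0 He]|[m [g [e [m0 e0 He g0 gc]]]]] := lH z; [left|right].
    by exists e => // h /He; rewrite /H1 => ->.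
  by exists m, g, e; split => // h /He; rewrite /H1 => ->; rewrite addrAC.
have HE1 z : H z = 1.
  apply/eqP; rewrite -subr_eq0 -nc_eq0 eq_le nc_ge0 andbT; apply/ler_addgt0Pr => e e0.
  rewrite add0r; have [s s0 Hs] := contour e (nc z + `|complex.Re z|) e0.
  apply: (maximum_principle cH1 lH1 _ s0) => v /Hs[Fv Gv].
  by rewrite /H1 HE.
apply/funext => z.
have [c [ec cF _]] := taylor z ea aF; have [d [ed dG _]] := taylor z eb bG.
have [Gz|Gz] := eqVneq (G z) 0; last first.
  by have := HE z Gz; rewrite HE1 => /(congr1 (fun x => x * G z)); rewrite mul1r divfK.
(* At a zero of [G] the quotient says nothing; there the common order is positive, so [F] vanishes
   as well. *)
have [m [_ [f [_ _ _ Ff Fm]]]] := order_exists z ea aF Fw.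
have [n [d' [g [_ d'g d'0 Gg Gn]]]] := order_exists z eb bG Gw.
have mn := same_order (FG z) Fm Gn.
have := Gg 0; rewrite addr0 Gz => /esym/eqP;
  rewrite mulf_eq0 (has_ps0 d'g) (negbTE d'0) orbF => n0.
by have := Ff 0; rewrite addr0 mn (eqP n0) mul0r.
Qed.

End zero_determination.

(** * Complex exponential and trigonometric functions as power series *)

Section exponential.
Context {R : realType}.
Implicit Types (z w lam : R[i]) (x y t : R).

Lemma gsum_even (u : nat -> R[i]) (l : R[i]) : gsum u l ->
  (forall n, u n.*2.+1 = 0) -> gsum (fun n => u n.*2) l.
Proof.
move=> [C HC] u0; have C0 : 0 <= C.
  by have := HC 0%N; rewrite expr0 divr1; apply: le_trans; exact: nc_ge0.
exists C => N; have -> : \sum_(k < N) u k.*2 = \sum_(k < N.*2) u k.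
  elim: N => [|N IH]; first by rewrite !big_ord0.
  by rewrite big_ord_recr/= IH doubleS !big_ord_recr/= u0 addr0.
apply: le_trans (HC _) _; rewrite ler_wpM2l// lef_pV2 ?posrE ?pow2_gt0//.
by rewrite ler_weXn2l ?ler1n// -addnn leq_addr.
Qed.

Lemma gsum_odd (u : nat -> R[i]) (l : R[i]) : gsum u l ->
  (forall n, u n.*2 = 0) -> gsum (fun n => u n.*2.+1) l.
Proof.
move=> ul u0; have := gsum_shift ul; rewrite (u0 0%N) subr0 => H.
by apply: gsum_even H _ => n; rewrite -doubleS u0.
Qed.

Lemma geometric_cvg0 (S : nat -> R) l (C : R) :
  (forall N, `|l - S N| <= C / 2 ^+ N) -> S n @[n --> \oo] --> l.
Proof.
move=> H; apply/cvgrPdist_lt => e e0.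
have h2 : `|2^-1 : R| < 1 by rewrite ger0_norm ?invr_ge0// invf_lt1// ltr1n.
have /cvgrPdist_lt/(_ _ e0) := @cvg_geometric R C _ h2.
apply: filterS => n; rewrite sub0r normrN => /(le_lt_trans (ler_norm _)).
by rewrite /geometric/= exprVn; apply: le_lt_trans; exact: H.
Qed.

Lemma gsum_Re (u : nat -> R[i]) (l : R[i]) : gsum u l ->
  lim (series (fun n => complex.Re (u n)) @ \oo) = complex.Re l.
Proof.
move=> [C HC]; apply: cvg_lim; first exact: Rhausdorff.
apply: (@geometric_cvg0 _ _ C) => N; apply: le_trans (HC N).
by rewrite /series/= big_mkord -Re_sum -ReB nc_ge_Re.
Qed.

Lemma gsum_Im (u : nat -> R[i]) (l : R[i]) : gsum u l ->
  lim (series (fun n => complex.Im (u n)) @ \oo) = complex.Im l.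
Proof.
move=> [C HC]; apply: cvg_lim; first exact: Rhausdorff.
apply: (@geometric_cvg0 _ _ C) => N; apply: le_trans (HC N).
by rewrite /series/= big_mkord -Im_sum -ImB nc_ge_Im.
Qed.

Definition exp_coef (n : nat) : R[i] := (n`!%:R)^-1.

Lemma nc_exp_coef n : nc (exp_coef n) = (n`!%:R)^-1.
Proof. by rewrite /exp_coef ncV nc_nat. Qed.

Lemma entire_exp : entire exp_coef.
Proof.
move=> r r0; exists (expR r) => n; rewrite nc_exp_coef.
case: n => [|n]; first by rewrite fact0 invr1 mul1r expr0 -expR0 ler_expR.
by rewrite mulrC; apply: le_trans (expR_ge1Dxn n r0); rewrite lerDr.
Qed.

Lemma binE n k : exp_coef (n + k) * ('C(n + k, k))%:R = exp_coef k * exp_coef n.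
Proof.
rewrite /exp_coef -(bin_fact (leq_addl n k)) addnK !natrM.
have f0 m : (m`!%:R : R[i]) != 0 by rewrite pnatr_eq0 -lt0n fact_gt0.
have b0 : ('C(n + k, k)%:R : R[i]) != 0 by rewrite pnatr_eq0 -lt0n bin_gt0 leq_addl.
by field; rewrite !f0 b0.
Qed.

(** The re-expansion at [z] has the coefficients [E z * exp_coef k], by the factorial formula for
    binomial coefficients. *)
Lemma exp_ps_add E z w : has_ps exp_coef E -> E (z + w) = E z * E w.
Proof.
move=> eE; have [c [ec cE Hc]] := taylor z entire_exp eE.
have cE' k : c k = E z * exp_coef k.
  have H : gsum (fun n => exp_coef (n + k) * (z ^+ (n + k - k) *+ 'C(n + k, k))) (c k).
    by apply: gsum_shiftn (Hc k) _ => i ik; rewrite bin_small// mulr0n mulr0.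
  rewrite mulrC; apply: gsum_uniq H (gsum_eq _ (gsumZ (exp_coef k) (eE z))) => n.
  by rewrite mulrA -(binE n k) -[z ^+ _ *+ _]mulr_natr addnK; ring.
by apply: gsum_uniq (cE w) (gsum_eq _ (gsumZ (E z) (eE w))) => n; rewrite cE' mulrA.
Qed.

Lemma exprI n : ('i%C : R[i]) ^+ n.*2 = (-1) ^+ n.
Proof. by rewrite -muln2 mulnC exprM sqr_i. Qed.

Lemma exp_ps_real E x : has_ps exp_coef E -> E x%:C = (expR x)%:C.
Proof.
move=> eE; have term n : exp_coef n * x%:C ^+ n = (exp_coeff x n)%:C.
  by rewrite /exp_coef/exp_coeff/= rmorphM rmorphXn fmorphV rmorph_nat mulrC.
apply/eqP; rewrite eq_complex /= -(gsum_Re (eE x%:C)) -(gsum_Im (eE x%:C)); apply/andP; split.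
  by apply/eqP; congr (lim (series _ @ \oo)); apply/funext => n; rewrite term.
apply/eqP; under eq_fun do rewrite term/=.
rewrite (_ : series _ = fun=> 0) ?lim_cst//.
by apply/funext => n; rewrite /series/= big1.
Qed.

Lemma exp_ps_imag E y : has_ps exp_coef E -> E ('i%C * y%:C) = cos y +i* sin y.
Proof.
move=> eE; have term n : exp_coef n * ('i%C * y%:C) ^+ n = cos_coeff y n +i* sin_coeff y n.
  rewrite /cos_coeff/sin_coeff/= exprMn -rmorphXn.
  have -> : exp_coef n = ((n`!%:R)^-1 : R)%:C by rewrite fmorphV rmorph_nat.
  rewrite -{2}(odd_double_half n) exprD exprI.
  have -> : ((-1) ^+ n./2 : R[i]) = ((-1) ^+ n./2)%:C by rewrite rmorphXn rmorphN rmorph1.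
  apply/eqP; rewrite eq_complex; case: (boolP (odd n)) => on.
    have -> : n.-1./2 = n./2 by rewrite -{1}(odd_double_half n) on add1n/= doubleK.
    by apply/andP; split; apply/eqP; rewrite /=; ring.
  by apply/andP; split; apply/eqP; rewrite /= -?exprnP; ring.
rewrite cos.unlock sin.unlock; apply/eqP;
  rewrite eq_complex /= -(gsum_Re (eE _)) -(gsum_Im (eE _)).
by apply/andP; split; apply/eqP; congr (lim (series _ @ \oo)); apply/funext => n; rewrite term.
Qed.

(** [expC] is built from real functions. The series agrees with them on the real and on the
    imaginary axis, and its addition formula covers the plane. *)
Lemma has_ps_expC : has_ps exp_coef (@expC R).
Proof.
have [E eE] := has_ps_exists entire_exp; suff -> : @expC R = E by [].
apply/funext => z; rewrite [in RHS](complexE z) (exp_ps_add _ _ eE) (exp_ps_real _ eE).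
by rewrite (exp_ps_imag _ eE) /expC; simpc.
Qed.

Lemma expCD z w : expC (z + w) = expC z * expC w.
Proof. exact: exp_ps_add has_ps_expC. Qed.

Lemma expC0 : expC (0 : R[i]) = 1.
Proof. by rewrite (has_ps0 has_ps_expC) /exp_coef fact0 invr1. Qed.

Lemma nc_expC z : nc (expC z) = expR (complex.Re z).
Proof.
rewrite /expC /= !exprMn -mulrDr cos2Dsin2 mulr1 sqrtr_sqr.
by rewrite ger0_norm// expR_ge0.
Qed.

Lemma cosCD z w : cosC (z + w) = cosC z * cosC w - sinC z * sinC w.
Proof.
rewrite /cosC /sinC mulrDr opprD !expCD.
have i2 : 'i%C * 'i%C = -1 :> R[i] by rewrite -expr2 sqr_i.
have -> (u v : R[i]) : u / (2%:R * 'i%C) * (v / (2%:R * 'i%C)) = - (u * v / 4%:R).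
  by rewrite mulf_div mulrACA i2 mulrN1 -natrM invrN mulrN.
by field.
Qed.

Lemma sinCD z w : sinC (z + w) = sinC z * cosC w + cosC z * sinC w.
Proof.
rewrite /cosC /sinC mulrDr opprD !expCD.
have i0 : ('i%C : R[i]) != 0 by rewrite eq_complex/= oner_eq0 andbF.
by field; rewrite i0.
Qed.

Lemma cosCN z : cosC (- z) = cosC z.
Proof. by rewrite /cosC mulrN opprK addrC. Qed.

Lemma sinCN z : sinC (- z) = - sinC z.
Proof. by rewrite /sinC mulrN opprK -[RHS]mulNr opprB. Qed.

Lemma cosC0 : cosC (0 : R[i]) = 1.
Proof. by rewrite /cosC mulr0 oppr0 expC0 -mulr2n mulfV ?pnatr_eq0. Qed.

Lemma i_neq0 : ('i%C : R[i]) != 0.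
Proof. by rewrite eq_complex/= oner_eq0 andbF. Qed.

Lemma cosC_series z : gsum (fun n => (-1) ^+ n * z ^+ n.*2 / n.*2`!%:R) (cosC z).
Proof.
have := gsumZ 2%:R^-1 (gsumD (has_ps_expC ('i%C * z)) (has_ps_expC (- ('i%C * z)))).
rewrite [2%:R^-1 * _ in X in gsum _ X]mulrC => /gsum_even H; apply: gsum_eq (H _) => n;
  last first.
  by rewrite exprNn -signr_odd /= odd_double expr1 mulN1r mulrN subrr mulr0.
rewrite [(- _) ^+ n.*2]exprNn -[(-1) ^+ n.*2]signr_odd odd_double expr0 mul1r exprMn exprI
  /exp_coef.
by field; rewrite pnatr_eq0 -lt0n fact_gt0.
Qed.

Lemma sinC_series z :
  gsum (fun n => (-1) ^+ n * z ^+ n.*2.+1 / n.*2.+1`!%:R) (sinC z).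
Proof.
have := gsumZ (2%:R * 'i%C)^-1 (gsumB (has_ps_expC ('i%C * z)) (has_ps_expC (- ('i%C * z)))).
rewrite [_^-1 * _ in X in gsum _ X]mulrC => /gsum_odd H; apply: gsum_eq (H _) => n; last first.
  by rewrite exprNn -signr_odd odd_double expr0 mul1r subrr mulr0.
rewrite [(- _) ^+ n.*2.+1]exprNn -[(-1) ^+ n.*2.+1]signr_odd /= odd_double expr1 exprMn exprS
  exprI /exp_coef.
by field; rewrite i_neq0 pnatr_eq0 -lt0n fact_gt0.
Qed.

(** These are the coefficients of [lam ^+ n] in [cos_sqrt lam t] and [sin_sqrt lam t]; integrated
    against [q], they give those of the characteristic function. *)
Definition cos_term n t : R := (-1) ^+ n * t ^+ n.*2 / n.*2`!%:R.
Definition sin_term n t : R := (-1) ^+ n * t ^+ n.*2.+1 / n.*2.+1`!%:R.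

Lemma cos_sqrt_series lam t :
  gsum (fun n => (cos_term n t)%:C * lam ^+ n) (cos_sqrt lam t).
Proof.
apply: gsum_eq (cosC_series (sqrtc lam * t%:C)) => n.
rewrite /cos_term !rmorphM fmorphV !rmorphXn rmorphN rmorph1 rmorph_nat exprMn.
by rewrite -{1}muln2 mulnC exprM sqr_sqrtc; ring.
Qed.

(** After division by [sqrtc lam] only even powers of the root remain; at [lam = 0] the series
    reduces to its first term, the value [t] chosen in [sin_sqrt]. *)
Lemma sin_sqrt_series lam t :
  gsum (fun n => (sin_term n t)%:C * lam ^+ n) (sin_sqrt lam t).
Proof.
rewrite /sin_sqrt; have [->|lam0] := eqVneq lam 0.
  have -> : t%:C = \sum_(k < 1) (sin_term k t)%:C * (0 : R[i]) ^+ k.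
    by rewrite big_ord1 /sin_term !expr0 mulr1 mul1r expr1 divr1.
  apply: (gsum_finite (u := fun k => (sin_term k t)%:C * (0 : R[i]) ^+ k)) => -[//|n] _.
  by rewrite expr0n mulr0.
rewrite mulrC; apply: gsum_eq (gsumZ _ (sinC_series (sqrtc lam * t%:C))) => n.
rewrite /sin_term !rmorphM fmorphV !rmorphXn rmorphN rmorph1 rmorph_nat exprMn.
rewrite [sqrtc lam ^+ _]exprS -{1}muln2 mulnC exprM sqr_sqrtc.
by field; rewrite sqrtc_eq0 lam0 pnatr_eq0 -lt0n fact_gt0.
Qed.

(** The free exponent [j] lets one estimate serve both with no power of [t] and with a factor
    [t ^+ 2]. *)
Lemma power_term_le (s j k n m : nat) t : `|t| <= 1 -> (j <= k)%N -> (n <= m)%N ->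
  `|(-1) ^+ s * t ^+ k / m`!%:R| <= `|t| ^+ j * (n`!%:R)^-1.
Proof.
move=> t1 jk nm; rewrite normrM [`|_ * _|]normrM normrX normrN1 expr1n mul1r normrX.
rewrite normfV normr_nat ler_pM ?exprn_ge0 ?invr_ge0//.
  by rewrite -(subnK jk) exprD ler_piMl ?exprn_ge0// exprn_ile1.
by rewrite lef_pV2 ?posrE ?ltr0n ?fact_gt0// ler_nat leq_fact.
Qed.

(** The last two bounds concern the series without their first terms; the factor [t ^+ 2] kept there
    becomes the second-order error at 0 in [trig_small]. *)
Lemma trig_geometric lam : exists2 C : R, 0 <= C & forall t, `|t| <= 1 -> forall n,
  [/\ nc ((cos_term n t)%:C * lam ^+ n) <= C / 2 ^+ n,
      nc ((sin_term n t)%:C * lam ^+ n) <= C / 2 ^+ n,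
      nc ((cos_term n.+1 t)%:C * lam ^+ n.+1) <= t ^+ 2 * C / 2 ^+ n &
      nc ((sin_term n.+1 t)%:C * lam ^+ n.+1) <= t ^+ 2 * C / 2 ^+ n].
Proof.
have [C HC] := entire_geometric entire_exp (nc_ge0 lam).
have C0 : 0 <= C.
  by have := HC 0%N; rewrite expr0 divr1; apply: le_trans; rewrite mulr_ge0 ?nc_ge0.
exists C => // t t1 n.
have HC1 : nc (exp_coef n.+1) * nc lam ^+ n.+1 <= C / 2 ^+ n.
  apply: le_trans (HC _) _; rewrite ler_wpM2l// lef_pV2 ?posrE ?pow2_gt0//.
  by rewrite ler_weXn2l ?ler1n.
have dbl (k : nat) : (k <= k.*2)%N by rewrite -addnn leq_addr.
have dblS (k : nat) : (k <= k.*2.+1)%N by rewrite leqW.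
have [c1 s1] : `|cos_term n t| <= (n`!%:R)^-1 /\ `|sin_term n t| <= (n`!%:R)^-1.
  by split; rewrite -[leRHS]mul1r -(expr0 `|t|); apply: power_term_le.
have [c2 s2] : `|cos_term n.+1 t| <= `|t| ^+ 2 * (n.+1`!%:R)^-1 /\
    `|sin_term n.+1 t| <= `|t| ^+ 2 * (n.+1`!%:R)^-1.
  by split; apply: power_term_le => //; rewrite doubleS.
rewrite real_normK ?num_real// in c2 s2.
rewrite nc_exp_coef in HC1; have := HC n; rewrite nc_exp_coef => HC0.
split; rewrite ncM nc_real ncX.
- by apply: le_trans HC0; rewrite ler_wpM2r ?exprn_ge0 ?nc_ge0.
- by apply: le_trans HC0; rewrite ler_wpM2r ?exprn_ge0 ?nc_ge0.
- apply: le_trans (ler_wpM2r (exprn_ge0 _ (nc_ge0 _)) c2) _.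
  by have := ler_wpM2l (sqr_ge0 t) HC1; rewrite !mulrA.
- apply: le_trans (ler_wpM2r (exprn_ge0 _ (nc_ge0 _)) s2) _.
  by have := ler_wpM2l (sqr_ge0 t) HC1; rewrite !mulrA.
Qed.

Lemma trig_small lam : exists2 K : R, 0 <= K & forall t, `|t| <= 1 ->
  [/\ nc (cos_sqrt lam t) <= K, nc (sin_sqrt lam t) <= K,
      nc (cos_sqrt lam t - 1) <= K * t ^+ 2 & nc (sin_sqrt lam t - t%:C) <= K * t ^+ 2].
Proof.
have [C C0 HC] := trig_geometric lam; exists (4 * C); first by rewrite mulr_ge0.
move=> t t1; have H := HC t t1; split.
- by apply: gsum_le (cos_sqrt_series lam t) _ => n; have [] := H n.
- by apply: gsum_le (sin_sqrt_series lam t) _ => n; have [] := H n.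
- have := gsum_shift (cos_sqrt_series lam t).
  have -> : cos_term 0 t = 1 by rewrite /cos_term expr0 mul1r expr0 fact0 divr1.
  rewrite expr0 mulr1 rmorph1 -mulrA [C * _]mulrC => /gsum_le; apply.
  by move=> n; have [] := H n.
- have := gsum_shift (sin_sqrt_series lam t).
  have -> : sin_term 0 t = t by rewrite /sin_term expr0 mul1r expr1 divr1.
  rewrite expr0 mulr1 -mulrA [C * _]mulrC => /gsum_le; apply.
  by move=> n; have [] := H n.
Qed.

Lemma cos_sqrtN lam t : cos_sqrt lam (- t) = cos_sqrt lam t.
Proof. by rewrite /cos_sqrt rmorphN mulrN cosCN. Qed.

Lemma sin_sqrtN lam t : sin_sqrt lam (- t) = - sin_sqrt lam t.
Proof. by rewrite /sin_sqrt rmorphN mulrN sinCN; case: ifP => // _; rewrite mulNr. Qed.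

Lemma cos_sqrt0 lam : cos_sqrt lam 0 = 1.
Proof. by rewrite /cos_sqrt mulr0 cosC0. Qed.

Lemma sinC_sin_sqrt lam t : sinC (sqrtc lam * t%:C) = sqrtc lam * sin_sqrt lam t.
Proof.
rewrite /sin_sqrt; have [->|lam0] := eqVneq lam 0.
  by rewrite sqrtc0 !mul0r /sinC mulr0 oppr0 subrr mul0r.
by rewrite mulrCA divff ?sqrtc_eq0// mulr1.
Qed.

Lemma cos_sqrtD lam x y : cos_sqrt lam (x + y) =
  cos_sqrt lam x * cos_sqrt lam y - lam * sin_sqrt lam x * sin_sqrt lam y.
Proof.
rewrite -{4}(sqr_sqrtc lam) /cos_sqrt rmorphD mulrDr cosCD !sinC_sin_sqrt; ring.
Qed.

Lemma sin_sqrtD lam x y : sin_sqrt lam (x + y) =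
  sin_sqrt lam x * cos_sqrt lam y + cos_sqrt lam x * sin_sqrt lam y.
Proof.
have [->|lam0] := eqVneq lam 0.
  by rewrite /sin_sqrt /cos_sqrt eqxx sqrtc0 !mul0r cosC0 mulr1 mul1r rmorphD.
rewrite /sin_sqrt /cos_sqrt (negbTE lam0) rmorphD mulrDr sinCD.
by field; rewrite sqrtc_eq0.
Qed.

Lemma cos_sin_sqrt1 lam x : cos_sqrt lam x ^+ 2 + lam * sin_sqrt lam x ^+ 2 = 1.
Proof.
by rewrite -(cos_sqrt0 lam) -(subrr x) cos_sqrtD cos_sqrtN sin_sqrtN; ring.
Qed.

Lemma nc_trig_le z : nc (cosC z) <= expR `|complex.Im z| /\ nc (sinC z) <= expR `|complex.Im z|.
Proof.
have E1 : nc (expC ('i%C * z)) <= expR `|complex.Im z|.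
  rewrite nc_expC ler_expR; case: z => x y /=; rewrite mul0r mul1r sub0r.
  by rewrite -normrN ler_norm.
have E2 : nc (expC (- ('i%C * z))) <= expR `|complex.Im z|.
  rewrite nc_expC ler_expR; case: {E1} z => x y /=; rewrite mul0r mul1r sub0r opprK.
  exact: ler_norm.
have n2 : nc (2%:R : R[i]) = 2 by rewrite nc_nat.
rewrite /cosC /sinC !ncM !ncV ncM nc_i mulr1 n2; split.
  by rewrite ler_pdivrMr//; apply: le_trans (ncD _ _) _; rewrite mulr_natr mulr2n lerD.
by rewrite ler_pdivrMr//; apply: le_trans (ncB _ _) _; rewrite mulr_natr mulr2n lerD.
Qed.

Lemma nc_sin_sqrt_le lam t : lam != 0 -> `|t| <= 1 ->
  nc (sin_sqrt lam t) <= expR `|complex.Im (sqrtc lam)| / nc (sqrtc lam).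
Proof.
move=> lam0 t1; rewrite /sin_sqrt (negbTE lam0) ncM ncV ler_wpM2r ?invr_ge0 ?nc_ge0//.
apply: le_trans (nc_trig_le _).2 _; rewrite ler_expR.
case: (sqrtc lam) => x y /=; rewrite mulr0 add0r normrM ler_piMr//.
Qed.

End exponential.

(** * Integration of complex-valued functions *)

Section complex_integral.
Context {R : realType}.
Local Notation mu := (@lebesgue_measure R).
Implicit Types (f g q k : R -> R[i]) (D : set R).

Lemma integrable_D D (f g : R -> R) : measurable D -> mu.-integrable D (EFin \o f) ->
  mu.-integrable D (EFin \o g) -> mu.-integrable D (EFin \o (fun t => f t + g t)).
Proof. move=> mD fi gi; exact: (@integrableD _ (measurableTypeR R) R mu D mD _ _ fi gi). Qed.

Lemma integrable_B D (f g : R -> R) : measurable D -> mu.-integrable D (EFin \o f) ->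
  mu.-integrable D (EFin \o g) -> mu.-integrable D (EFin \o (fun t => f t - g t)).
Proof. move=> mD fi gi; exact: (@integrableB _ (measurableTypeR R) R mu D mD _ _ fi gi). Qed.

Lemma integrable_Z D (r : R) (f : R -> R) : measurable D -> mu.-integrable D (EFin \o f) ->
  mu.-integrable D (EFin \o (fun t => r * f t)).
Proof. move=> mD fi; exact: (@integrableZl _ (measurableTypeR R) R mu D mD r _ fi). Qed.

Lemma integrable_dom D (f g : R -> R) : measurable D -> measurable_fun D f ->
  (forall t, D t -> `|f t| <= g t) -> mu.-integrable D (EFin \o g) ->
  mu.-integrable D (EFin \o f).
Proof.
move=> mD mf fg; apply: (@le_integrable _ (measurableTypeR R) R mu D mD).
  exact/measurable_EFinP.
by move=> t Dt /=; rewrite lee_fin (le_trans (fg _ Dt))// ler_norm.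
Qed.

Definition cintegrable D f :=
  mu.-integrable D (EFin \o (fun t => complex.Re (f t))) /\
  mu.-integrable D (EFin \o (fun t => complex.Im (f t))).

Definition cmeasurable f :=
  measurable_fun [set: R] (fun t => complex.Re (f t)) /\
  measurable_fun [set: R] (fun t => complex.Im (f t)).

(** Equivalent to the modulus, and integrable directly from the integrability of the two real
    components. *)
Definition abs1 f t : R := `|complex.Re (f t)| + `|complex.Im (f t)|.

Lemma abs1_ge0 f t : 0 <= abs1 f t. Proof. by rewrite addr_ge0. Qed.

Lemma integrable_abs1 D f : measurable D -> cintegrable D f ->
  mu.-integrable D (EFin \o abs1 f).
Proof.
move=> mD [fr fi].
exact: (integrable_D mD (integrable_norm fr) (integrable_norm fi)).
Qed.

Lemma cintegrableS D E f : measurable E -> measurable D -> D `<=` E ->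
  cintegrable E f -> cintegrable D f.
Proof. by move=> mE mD DE [fr fi]; split; [exact: integrableS fr|exact: integrableS fi]. Qed.

Lemma Re_mul (x y : R[i]) :
  complex.Re (x * y) = complex.Re x * complex.Re y - complex.Im x * complex.Im y.
Proof. by case: x; case: y. Qed.

Lemma Im_mul (x y : R[i]) :
  complex.Im (x * y) = complex.Re x * complex.Im y + complex.Im x * complex.Re y.
Proof. by case: x; case: y. Qed.

Lemma ReIm_mul_le (x y : R[i]) :
  `|complex.Re (x * y)| <= nc x * (`|complex.Re y| + `|complex.Im y|) /\
  `|complex.Im (x * y)| <= nc x * (`|complex.Re y| + `|complex.Im y|).
Proof.
have [xr xi] := (nc_ge_Re x, nc_ge_Im x); rewrite Re_mul Im_mul mulrDr; split.
  by apply: le_trans (ler_normB _ _) _; rewrite !normrM lerD// ler_wpM2r.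
by apply: le_trans (ler_normD _ _) _; rewrite !normrM addrC lerD// ler_wpM2r.
Qed.

Lemma integralC_D D f g : measurable D -> cintegrable D f -> cintegrable D g ->
  integralC D (fun t => f t + g t) = integralC D f + integralC D g.
Proof.
move=> mD [fr fi] [gr gi]; rewrite /integralC.
under eq_Rintegral do rewrite ReD; under [X in _ +i* X]eq_Rintegral do rewrite ImD.
by rewrite !RintegralD.
Qed.

Lemma cintegrableD D f g : measurable D -> cintegrable D f -> cintegrable D g ->
  cintegrable D (fun t => f t + g t).
Proof.
move=> mD [fr fi] [gr gi]; split.
  by under eq_fun do rewrite ReD; exact: integrable_D.
by under eq_fun do rewrite ImD; exact: integrable_D.
Qed.

Lemma cintegrableZ D (c : R[i]) f : measurable D -> cintegrable D f ->
  cintegrable D (fun t => c * f t).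
Proof.
move=> mD [fr fi]; split.
  by under eq_fun do rewrite Re_mul; apply: integrable_B => //; exact: integrable_Z.
by under eq_fun do rewrite Im_mul; apply: integrable_D => //; exact: integrable_Z.
Qed.

Lemma cintegrableB D f g : measurable D -> cintegrable D f -> cintegrable D g ->
  cintegrable D (fun t => f t - g t).
Proof.
move=> mD fi gi; have := cintegrableD mD fi (cintegrableZ (-1) mD gi).
by congr cintegrable; apply/funext => t; rewrite mulN1r.
Qed.

Lemma integralC_Z D (c : R[i]) f : measurable D -> cintegrable D f ->
  integralC D (fun t => c * f t) = c * integralC D f.
Proof.
move=> mD [fr fi]; rewrite /integralC.
under eq_Rintegral do rewrite Re_mul; under [X in _ +i* X]eq_Rintegral do rewrite Im_mul.
rewrite RintegralB//; [|exact: integrable_Z..].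
rewrite RintegralD//; [|exact: integrable_Z..].
rewrite !RintegralZl//.
by case: c.
Qed.

Lemma integralC_B D f g : measurable D -> cintegrable D f -> cintegrable D g ->
  integralC D (fun t => f t - g t) = integralC D f - integralC D g.
Proof.
move=> mD fi gi; rewrite -mulN1r -integralC_Z// -integralC_D//; last exact: cintegrableZ.
by congr integralC; apply/funext => t; rewrite mulN1r.
Qed.

Lemma integralC_set0 f : integralC set0 f = 0.
Proof. by rewrite /integralC !Rintegral_set0. Qed.

Lemma eq_integralC D f g : (forall t, D t -> f t = g t) -> integralC D f = integralC D g.
Proof.
by move=> fg; rewrite /integralC; congr (_ +i* _); apply: eq_Rintegral => t /set_mem/fg ->.
Qed.

Lemma nc_integralC_le D f : measurable D -> cintegrable D f ->
  nc (integralC D f) <= \int[mu]_(t in D) abs1 f t.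
Proof.
move=> mD fi; have [fr fim] := fi.
apply: le_trans (nc_le_ReIm _) _; rewrite /abs1 RintegralD//; [|exact: integrable_norm..].
by rewrite lerD// le_normr_Rintegral.
Qed.

Lemma cintegrableM D k q (B : R) : measurable D -> cmeasurable k -> cintegrable D q ->
  (forall t, D t -> nc (k t) <= B) -> cintegrable D (fun t => k t * q t).
Proof.
move=> mD [kr ki] qi kB; have [/measurable_int/measurable_EFinP qr
  /measurable_int/measurable_EFinP qim] := qi.
have dom := integrable_Z B mD (integrable_abs1 mD qi).
have le t : D t -> nc (k t) * abs1 q t <= B * abs1 q t.
  by move=> Dt; rewrite ler_wpM2r ?abs1_ge0 ?kB.
have B0 t : D t -> 0 <= B * abs1 q t.
  by move=> Dt; apply: le_trans (le t Dt); rewrite mulr_ge0 ?nc_ge0 ?abs1_ge0.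
have krD := measurable_funTS (D := D) kr; have kiD := measurable_funTS (D := D) ki.
split; apply: (integrable_dom mD _ _ dom).
- under eq_fun do rewrite Re_mul.
  by apply: measurable_funB; exact: measurable_funM.
- by move=> t Dt; apply: le_trans (ReIm_mul_le _ _).1 (le t Dt).
- under eq_fun do rewrite Im_mul.
  by apply: measurable_funD; exact: measurable_funM.
- by move=> t Dt; apply: le_trans (ReIm_mul_le _ _).2 (le t Dt).
Qed.

(** The factor 2 comes from bounding the real and the imaginary part of the product separately by
    [B * abs1 q]. *)
Lemma nc_integralCM_le D k q (B : R) : measurable D -> cmeasurable k -> cintegrable D q ->
  (forall t, D t -> nc (k t) <= B) ->
  nc (integralC D (fun t => k t * q t)) <= 2 * B * \int[mu]_(t in D) abs1 q t.
Proof.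
move=> mD km qi kB; have kqi := cintegrableM mD km qi kB.
apply: le_trans (nc_integralC_le mD kqi) _; rewrite -RintegralZl//; last exact: integrable_abs1.
apply: le_Rintegral => //; first exact: integrable_abs1.
  exact: (integrable_Z (2 * B) mD (integrable_abs1 mD qi)).
move=> t Dt; have [h1 h2] := ReIm_mul_le (k t) (q t).
apply: le_trans (lerD h1 h2) _.
have := ler_wpM2r (abs1_ge0 q t) (kB t Dt); rewrite /abs1; lra.
Qed.

Lemma cmeasurableD f g : cmeasurable f -> cmeasurable g -> cmeasurable (fun t => f t + g t).
Proof.
move=> [fr fi] [gr gi]; split.
  by under eq_fun do rewrite ReD; exact: measurable_funD.
by under eq_fun do rewrite ImD; exact: measurable_funD.
Qed.

Lemma cmeasurableM f g : cmeasurable f -> cmeasurable g -> cmeasurable (fun t => f t * g t).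
Proof.
move=> [fr fi] [gr gi]; split.
  by under eq_fun do rewrite Re_mul; apply: measurable_funB; exact: measurable_funM.
by under eq_fun do rewrite Im_mul; apply: measurable_funD; exact: measurable_funM.
Qed.

Lemma cmeasurable_cst (c : R[i]) : cmeasurable (fun=> c).
Proof. by split; exact: measurable_cst. Qed.

Lemma cmeasurableB f g : cmeasurable f -> cmeasurable g -> cmeasurable (fun t => f t - g t).
Proof.
move=> fm gm; have := cmeasurableD fm (cmeasurableM (cmeasurable_cst (-1)) gm).
by under eq_fun do rewrite mulN1r.
Qed.

Lemma cmeasurable_real (h : R -> R) : measurable_fun [set: R] h ->
  cmeasurable (fun t => (h t)%:C).
Proof. by move=> hm; split => //=; exact: measurable_cst. Qed.

Lemma cmeasurable_comp f (h : R -> R) : cmeasurable f -> measurable_fun [set: R] h ->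
  cmeasurable (fun t => f (h t)).
Proof.
move=> [fr fi] hm; split.
  exact: (@measurableT_comp _ _ _ _ _ _ (fun t => complex.Re (f t)) _ h).
exact: (@measurableT_comp _ _ _ _ _ _ (fun t => complex.Im (f t)) _ h).
Qed.

(** On a bounded interval constants are integrable, and |x| <= 1 + x^2 + y^2. *)
Lemma inL2_cintegrable b f : inL2 b f -> cintegrable `]0, b[ f.
Proof.
move=> [fr fi f2].
have mb : (mu `]0%R, b[%classic < +oo)%E.
  by rewrite lebesgue_measure_itv/=; case: ifP => _; exact: ltry.
have m1 : mu.-integrable `]0, b[ (EFin \o (cst 1 : R -> R)).
  apply/integrableP; split; first exact/measurable_EFinP/measurable_cst.
  under eq_integral do rewrite /= normr1.
  rewrite integral_cst// mul1e; exact: mb.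
have dom := integrable_D (measurable_itv _) m1 f2.
have sq (x y : R) : `|x| <= 1 + (x ^+ 2 + y ^+ 2).
  have : `|x| ^+ 2 = x ^+ 2 by rewrite real_normK ?num_real.
  have := sqr_ge0 (`|x| - 1); have := sqr_ge0 y; have := sqr_ge0 x; nra.
have sq' (x y : R) : `|y| <= 1 + (x ^+ 2 + y ^+ 2) by rewrite [x ^+ 2 + _]addrC.
by split; apply: (integrable_dom (measurable_itv _) _ _ dom).
Qed.

Lemma Rintegral_itv_split (h : R -> R) (x y : R) : mu.-integrable `]0, 1[ (EFin \o h) ->
  0 <= x -> x <= y -> y <= 1 ->
  \int[mu]_(t in `]x, y[) h t = \int[mu]_(t in `]0, y[) h t - \int[mu]_(t in `]0, x[) h t.
Proof.
move=> hi x0 xy y1; have [->|xny] := eqVneq x y;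
  first by rewrite subrr set_itv_ge ?bnd_simp ?ltxx// Rintegral_set0.
have {xny}xy : x < y by rewrite lt_neqAle xny.
have hy : mu.-integrable `]0, y[ (EFin \o h).
  by apply: integrableS hi => //; apply: subset_itvl; rewrite bnd_simp.
have hx : mu.-integrable `]0, x[ (EFin \o h).
  by apply: integrableS hy => //; apply: subset_itvl; rewrite bnd_simp ltW.
rewrite (Rintegral_itv_bndo_bndc hx) (Rintegral_itvB hy)//.
Qed.

Definition prim f x : R[i] := integralC `]0, x[ f.

Lemma oriented_integralE f (x y : R) : cintegrable `]0, 1[ f ->
  0 <= x <= 1 -> 0 <= y <= 1 -> oriented_integral x y f = prim f y - prim f x.
Proof.
have aux (u v : R) : cintegrable `]0, 1[ f -> 0 <= u -> u <= v -> v <= 1 ->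
    integralC `]u, v[ f = prim f v - prim f u.
  move=> [fr fi] u0 uv v1; rewrite /prim /integralC.
  by rewrite (Rintegral_itv_split fr u0 uv v1) (Rintegral_itv_split fi u0 uv v1).
move=> fi /andP[x0 x1] /andP[y0 y1]; rewrite /oriented_integral; case: leP => xy.
  exact: aux.
by rewrite (aux y x)// ?opprB// ltW.
Qed.

(** The increments of [mass] bound integrals over short intervals; by [mass_cvg] they tend to 0 even
    where [f] is unbounded. *)
Definition mass f x : R := \int[mu]_(t in `]0, x[) abs1 f t.

Lemma nc_oriented_integral_le k q (B x y : R) : cmeasurable k -> cintegrable `]0, 1[ q ->
  0 <= x <= 1 -> 0 <= y <= 1 ->
  (forall t, Num.min x y < t -> t < Num.max x y -> nc (k t) <= B) ->
  nc (oriented_integral x y (fun t => k t * q t)) <= 2 * B * `|mass q y - mass q x|.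
Proof.
move=> km qi.
have absi := integrable_abs1 (measurable_itv `]0, 1[) qi.
have aux (u v : R) : 0 <= u -> u <= v -> v <= 1 ->
    (forall t : R, u < t -> t < v -> nc (k t) <= B) ->
    nc (integralC `]u, v[ (fun t => k t * q t)) <= 2 * B * `|mass q v - mass q u|.
  move=> u0 uv v1 kB; rewrite /mass -Rintegral_itv_split//.
  rewrite ger0_norm; last by apply: Rintegral_ge0 => t _; exact: abs1_ge0.
  apply: nc_integralCM_le => //.
    by apply: cintegrableS qi => //; apply: subset_itv; rewrite bnd_simp.
  by move=> t /=; rewrite in_itv/= => /andP[]; exact: kB.
move=> /andP[x0 x1] /andP[y0 y1] kB; rewrite /oriented_integral; move: kB;
  case: (leP x y) => xy kB.
  exact: aux.
by rewrite ncN distrC; apply: aux => //; exact: ltW.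
Qed.

Lemma mass_cvg q (x : R) : cintegrable `]0, 1[ q -> 0 <= x <= 1 ->
  mass q t @[t --> within `[0, 1]%classic (nbhs x)] --> mass q x.
Proof.
move=> qi x01; have absi := integrable_abs1 (measurable_itv `]0, 1[) qi.
(* Extension by zero makes the integrand integrable on the closed interval, as the continuity
   theorem for parameterized integrals requires. *)
pose h := abs1 q \_ `]0, 1[.
have hi : mu.-integrable `[0, 1] (EFin \o h).
  rewrite /h -restrict_EFin; apply/integrable_restrict => //.
  have m01 : measurable (`[0%R, 1%R]%classic `&` `]0%R, 1%R[%classic : set (measurableTypeR R)).
    exact: measurableI.
  exact: (@integrableS _ (measurableTypeR R) R mu _ _ _ (measurable_itv `]0, 1[) m01
    (@subIsetr _ _ _) absi).
have hE t : 0 <= t <= 1 -> mass q t = parameterized_integral mu 0 t h.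
  move=> /andP[t0 t1]; rewrite /parameterized_integral.
  have hit : mu.-integrable `[0, t] (EFin \o h).
    by apply: integrableS hi => //; apply: subset_itvl; rewrite bnd_simp.
  have sub : `]0%R, t] `<=` `[0%R, t]%classic by apply: subset_itvr; rewrite bnd_simp.
  have sub' : `]0%R, t[ `<=` `[0%R, t]%classic by apply: subset_itv; rewrite bnd_simp.
  have h1 : mu.-integrable `]0, t] (EFin \o h) by apply: integrableS hit.
  have h2 : mu.-integrable `]0, t[ (EFin \o h) by apply: integrableS hit.
  rewrite -(Rintegral_itv_obnd_cbnd h1) -(Rintegral_itv_bndo_bndc h2).
  apply: eq_Rintegral => u /set_mem/=; rewrite in_itv/= => /andP[u0 ut].
  by rewrite /h patchE mem_set//= in_itv/= u0 (lt_le_trans ut).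
have := parameterized_integral_continuous ler01 hi => /subspace_continuousP/(_ x) H.
have xin : `[0, 1]%classic x by rewrite /= in_itv/=.
rewrite hE//; apply: cvg_trans (H xin); apply: near_eq_cvg.
apply: (@filterS _ _ _ _ _ _ (withinT _ (nbhs_filter x))) => t /=; rewrite in_itv/=.
by move=> /hE.
Qed.

End complex_integral.

(** * Closed form of the characteristic function *)

Section characteristic_function.
Context {R : realType}.
Local Notation mu := (@lebesgue_measure R).
Implicit Types (q k : R -> R[i]) (lam gamma : R[i]) (a b x t h : R).

(** By the addition formulas the second-order errors at [x] are combinations of those at 0, hence
    uniform in [x]. *)
Lemma trig_expansion lam : exists2 K : R, 0 <= K & forall x h, `|x| <= 1 -> `|h| <= 1 ->
  [/\ nc (sin_sqrt lam x) <= K * `|x|, nc (cos_sqrt lam x) <= K, nc (sin_sqrt lam x) <= K,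
   nc (sin_sqrt lam (x + h) - sin_sqrt lam x - h%:C * cos_sqrt lam x) <= K * h ^+ 2 &
   nc (cos_sqrt lam (x + h) - cos_sqrt lam x - h%:C * (- (lam * sin_sqrt lam x))) <= K * h ^+ 2].
Proof.
have [K K0 HK] := trig_small lam.
(* [K + 1] serves the bound by |x|, [2 * K ^+ 2] the expansion of [sin_sqrt], and
   [(1 + nc lam) * K ^+ 2] that of [cos_sqrt]. *)
pose K1 := (K + 1) + 2 * K ^+ 2 + nc lam * K ^+ 2.
have K20 : 0 <= K ^+ 2 by rewrite sqr_ge0.
have L0 : 0 <= nc lam * K ^+ 2 by rewrite mulr_ge0 ?nc_ge0.
exists K1; first by rewrite /K1; lra.
move=> x h x1 h1; have [cx sx _ sx1] := HK x x1; have [_ _ ch sh] := HK h h1.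
have h20 := sqr_ge0 h.
split.
- rewrite -(subrK x%:C (sin_sqrt lam x)); apply: le_trans (ncD _ _) _; rewrite nc_real.
  have x2 : x ^+ 2 <= `|x| by rewrite -real_normK ?num_real// expr2 ler_piMr.
  have := ler_wpM2l K0 x2; have := mulr_ge0 K20 (normr_ge0 x).
  have := mulr_ge0 L0 (normr_ge0 x); rewrite /K1; lra.
- by rewrite /K1; lra.
- by rewrite /K1; lra.
- rewrite sin_sqrtD.
  have -> : sin_sqrt lam x * cos_sqrt lam h + cos_sqrt lam x * sin_sqrt lam h - sin_sqrt lam x -
      h%:C * cos_sqrt lam x = sin_sqrt lam x * (cos_sqrt lam h - 1) +
      cos_sqrt lam x * (sin_sqrt lam h - h%:C) by ring.
  apply: le_trans (ncD _ _) _; rewrite (ncM (sin_sqrt lam x)) (ncM (cos_sqrt lam x)).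
  have e1 := ler_pM (nc_ge0 _) (nc_ge0 _) sx ch; have e2 := ler_pM (nc_ge0 _) (nc_ge0 _) cx sh.
  have H : K * K + K * K <= K1 by rewrite /K1 expr2; rewrite expr2 in L0; lra.
  have := ler_wpM2r h20 H; move: e1 e2; lra.
- rewrite cos_sqrtD.
  have -> : cos_sqrt lam x * cos_sqrt lam h - lam * sin_sqrt lam x * sin_sqrt lam h -
    cos_sqrt lam x -
      h%:C * (- (lam * sin_sqrt lam x)) = cos_sqrt lam x * (cos_sqrt lam h - 1) -
      lam * (sin_sqrt lam x * (sin_sqrt lam h - h%:C)) by ring.
  apply: le_trans (ncB _ _) _; rewrite (ncM (cos_sqrt lam x)) (ncM lam) (ncM (sin_sqrt lam x)).
  have e1 := ler_pM (nc_ge0 _) (nc_ge0 _) sx sh; have e2 := ler_pM (nc_ge0 _) (nc_ge0 _) cx ch.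
  have {}e1 := ler_wpM2l (nc_ge0 lam) e1.
  have H : K * K + nc lam * (K * K) <= K1 by rewrite /K1 expr2; rewrite expr2 in K20; lra.
  have := ler_wpM2r h20 H; move: e1 e2; lra.
Qed.

Lemma measurable_trig lam : cmeasurable (cos_sqrt lam) /\ cmeasurable (sin_sqrt lam).
Proof.
have me (z : R[i]) : cmeasurable (fun t => expC (z * t%:C)).
  have linm (r : R) : measurable_fun [set: R] (fun t => r * t) by exact: mulrl_measurable.
  have E t : expC (z * t%:C) = expR (complex.Re z * t) * cos (complex.Im z * t) +i*
      (expR (complex.Re z * t) * sin (complex.Im z * t)).
    by rewrite /expC; case: z => x y /=; rewrite !mulr0 subr0 add0r.
  have em := measurableT_comp (@measurable_expR R) (linm (complex.Re z)).
  split; under eq_fun do rewrite E; apply: measurable_funM => //.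
    exact: measurableT_comp (continuous_measurable_fun (@continuous_cos R)) (linm _).
  exact: measurableT_comp (continuous_measurable_fun (@continuous_sin R)) (linm _).
have men (z : R[i]) : cmeasurable (fun t => expC (- ('i%C * (z * t%:C)))).
  by have := me (- ('i%C * z)); under eq_fun do rewrite mulNr -mulrA.
have mep (z : R[i]) : cmeasurable (fun t => expC ('i%C * (z * t%:C))).
  by have := me ('i%C * z); under eq_fun do rewrite -mulrA.
split.
  by apply: cmeasurableM; [apply: cmeasurableD|exact: cmeasurable_cst].
rewrite /sin_sqrt; case: eqP => _.
  exact/cmeasurable_real/measurable_id.
apply: cmeasurableM; last exact: cmeasurable_cst.
by apply: cmeasurableM; [apply: cmeasurableB|exact: cmeasurable_cst].
Qed.

Local Opaque cos_sqrt sin_sqrt.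

Lemma measurable_subr x : measurable_fun [set: R] (fun t => x - t).
Proof. by apply: measurable_funB; [exact: measurable_cst|exact: measurable_id]. Qed.

Lemma deriv01_eq (y : R -> R[i]) x (L : R[i]) : 0 <= x <= 1 ->
  (forall e : R, 0 < e -> \forall t \near within `[0, 1]%classic (nbhs x),
    nc (y t - y x - (t - x)%:C * L) <= e * `|t - x|) ->
  deriv01 y x = L.
Proof.
move=> /andP[x0 x1] H.
(* The limit is unique only if [x] is an accumulation point of the interval; a step of at most 1/2
   to the right for [x <= 1/2], to the left otherwise, stays inside. *)
have PF : ProperFilter (within `[0, 1]%classic x^').
  apply: Build_ProperFilter_ex.
  move=> P /nbhs_ballP[e /= e0 He].
  pose d := Num.min (e / 2) (2%:R^-1).
  have d0 : 0 < d by rewrite lt_min divr_gt0//= invr_gt0.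
  have de : d < e by rewrite gt_min; apply/orP; left; rewrite ltr_pdivrMr// ltr_pMr// ltr1n.
  have d2 : d <= 2%:R^-1 by rewrite ge_min lexx orbT.
  have [xh|xh] := leP x 2%:R^-1.
    exists (x + d); apply: He; rewrite /= ?in_itv/=.
    - by rewrite /ball/= opprD addrA subrr sub0r normrN gtr0_norm.
    - by rewrite -subr_eq0 addrAC subrr add0r gt_eqF.
    - by move: xh d2 d0 x0; lra.
  exists (x - d); apply: He; rewrite /= ?in_itv/=.
  - by rewrite /ball/= opprB addrCA subrr addr0 gtr0_norm.
  - by rewrite -subr_eq0 addrAC subrr add0r oppr_eq0 gt_eqF.
  - by move: xh d2 d0 x1; lra.
apply: (@cvg_lim (R[i]^o) (@norm_hausdorff _ _) R (within `[0, 1]%classic x^') PF (fun t =>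
  (y t - y x) / (t - x)%:C) L).
apply: (@cvg_nc _ _ _ (within_filter _ _)).
apply/(@cvgrPdist_lt _ _ _ _ (within_filter _ _)) => e e0.
have e2 : 0 < e / 2 by rewrite divr_gt0.
have := H _ e2; rewrite /prop_near1 /within/= => H1.
rewrite /prop_near1 /within/= /dnbhs /within /=.
move: H1; apply: (@filterS _ _ (nbhs_filter x)) => t Ht tx t01.
rewrite sub0r normrN ger0_norm ?nc_ge0//.
have tx0 : t - x != 0 by rewrite subr_eq0; exact/eqP/eqP.
have txC : (t - x)%:C != 0 :> R[i] by rewrite eq_complex/= negb_and tx0.
have -> : (y t - y x) / (t - x)%:C - L = (y t - y x - (t - x)%:C * L) / (t - x)%:C.
  by rewrite [RHS]mulrBl [_ * L]mulrC mulfK.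
rewrite ncM ncV nc_real ltr_pdivrMr ?normr_gt0//.
apply: le_lt_trans (Ht t01) _; rewrite ltr_pM2r ?normr_gt0//.
by rewrite ltr_pdivrMr// ltr_pMr// ltr1n.
Qed.

Lemma near_within_dist (P : R -> Prop) x (d : R) : 0 < d ->
  (forall t, 0 <= t <= 1 -> `|t - x| < d -> P t) ->
  \forall t \near within `[0, 1]%classic (nbhs x), P t.
Proof.
move=> d0 H; rewrite /prop_near1 /within/=; apply/nbhs_ballP; exists d => //= t.
by rewrite /ball/= distrC in_itv/= => td t01; exact: H.
Qed.

Lemma deriv01_solS a lam x : 0 <= a <= 1 -> 0 <= x <= 1 ->
  deriv01 (solS a lam) x = cos_sqrt lam (x - a).
Proof.
move=> /andP[a0 a1] /andP[x0 x1].
have [K K0 HK] := trig_expansion lam.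
have K1 : 0 < K + 1 by rewrite ltr_wpDl.
apply: deriv01_eq => [|e e0]; first exact/andP.
apply: (@near_within_dist _ _ (e / (K + 1))); first by rewrite divr_gt0.
move=> t /andP[t0 t1] tx; rewrite /solS.
have xa : `|x - a| <= 1 by rewrite ler_norml; lra.
have tx1 : `|t - x| <= 1 by rewrite ler_norml; lra.
have [_ _ _ + _] := HK _ _ xa tx1.
have -> : x - a + (t - x) = t - a by ring.
move=> /le_trans; apply; rewrite -real_normK ?num_real// expr2 mulrA ler_wpM2r//.
rewrite ltr_pdivlMr// in tx; have := normr_ge0 (t - x); move: tx; lra.
Qed.

Lemma between_dist x y u : (x < u) || (y < u) -> (u < x) || (u < y) -> `|y - u| <= `|y - x|.
Proof.
move=> u1 u2; have [xy|xy] := leP x y.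
  by rewrite [leRHS]ger0_norm ?subr_ge0// ler_norml; move: u1 u2 => /orP[] ? /orP[] ?; lra.
have -> : `|y - x| = x - y by rewrite ler0_norm ?opprB// subr_le0 ltW.
by rewrite ler_norml; move: u1 u2 => /orP[] ? /orP[] ?; lra.
Qed.

Lemma small_product (c d e : R) : 0 <= d -> d * (c + 1) < e / 2 -> c * d <= e / 2.
Proof. by move=> d0; lra. Qed.

(** Differentiation under a moving limit. The boundary term drops out because [sin_sqrt lam]
    vanishes at 0: between [x] and [t] the kernel is at most [K * |t - x|], and the mass of [q]
    there tends to 0. *)
Lemma deriv01_solC q a lam x : 0 <= a <= 1 -> 0 <= x <= 1 -> cintegrable `]0, 1[ q ->
  deriv01 (solC q a lam) x = - (lam * sin_sqrt lam (x - a)) +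
    oriented_integral a x (fun t => cos_sqrt lam (x - t) * q t).
Proof.
move=> a01 x01 qi; have [/andP[a0 a1] /andP[x0 x1]] := (a01, x01).
have [K K0 HK] := trig_expansion lam; have [mc ms] := measurable_trig lam.
have cmS y : cmeasurable (fun t => sin_sqrt lam (y - t)).
  exact: cmeasurable_comp ms (measurable_subr y).
have cmC y : cmeasurable (fun t => cos_sqrt lam (y - t)).
  exact: cmeasurable_comp mc (measurable_subr y).
have dist (y t : R) : 0 <= y <= 1 -> `]0, 1[%classic t -> `|y - t| <= 1.
  by rewrite /= in_itv/= ler_norml => /andP[? ?] /andP[? ?]; lra.
have h0 : `|0 : R| <= 1 by rewrite normr0.
have iS y : 0 <= y <= 1 -> cintegrable `]0, 1[ (fun t => sin_sqrt lam (y - t) * q t).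
  by move=> y01; apply: (cintegrableM (B := K) (measurable_itv _) (cmS y) qi) =>
    t /(dist _ _ y01)/HK/(_ h0)[].
have iC y : 0 <= y <= 1 -> cintegrable `]0, 1[ (fun t => cos_sqrt lam (y - t) * q t).
  by move=> y01; apply: (cintegrableM (B := K) (measurable_itv _) (cmC y) qi) =>
    t /(dist _ _ y01)/HK/(_ h0)[].
pose M := 2 * K * `|mass q x - mass q a|.
have M0 : 0 <= M by rewrite !mulr_ge0.
have e0' (e : R) : 0 < e -> 0 < e / (2 * (K + M + 1)).
  by move=> e0; rewrite divr_gt0// mulr_gt0//; lra.
apply: deriv01_eq => // e e0.
(* Of the error [e * |t - x|], one half absorbs the two quadratic remainders, with constants [K] and
   [M], and the other half the integral from [x] to [t]. *)
have massn : \forall t \near within `[0, 1]%classic (nbhs x),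
    `|mass q x - mass q t| < e / (4 * (K + 1)).
  have := (@cvgrPdist_lt _ _ _ _ (within_filter _ (nbhs_filter x)) _ _).1 (mass_cvg qi x01).
  by apply; rewrite divr_gt0// mulr_gt0//; lra.
have distn := @near_within_dist (fun t =>
  0 <= t <= 1 /\ `|t - x| < e / (2 * (K + M + 1))) x _ (e0' e e0)
  (fun t t01 tx => conj t01 tx).
apply: (@filterS2 _ _ (within_filter _ (nbhs_filter x)) _ _ _ _ massn distn) => t mt [t01 tx].
have /andP[t0 t1] := t01.
have tx1 : `|t - x| <= 1 by rewrite ler_norml; lra.
pose k u := sin_sqrt lam (t - u) - sin_sqrt lam (x - u) - (t - x)%:C * cos_sqrt lam (x - u).
have cmk : cmeasurable k.
  by apply: cmeasurableB; [exact: cmeasurableB|apply: cmeasurableM => //; exact: cmeasurable_cst].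
have split_t : oriented_integral a t (fun u => sin_sqrt lam (t - u) * q u) =
    oriented_integral a x (fun u => sin_sqrt lam (t - u) * q u) +
    oriented_integral x t (fun u => sin_sqrt lam (t - u) * q u).
  by rewrite !(oriented_integralE (iS t t01))//; ring.
have kE : oriented_integral a x (fun u => k u * q u) =
    oriented_integral a x (fun u => sin_sqrt lam (t - u) * q u) -
    oriented_integral a x (fun u => sin_sqrt lam (x - u) * q u) -
    (t - x)%:C * oriented_integral a x (fun u => cos_sqrt lam (x - u) * q u).
  have primE y : 0 <= y <= 1 -> prim (fun u => k u * q u) y =
      prim (fun u => sin_sqrt lam (t - u) * q u) y -
      prim (fun u => sin_sqrt lam (x - u) * q u) y -
      (t - x)%:C * prim (fun u => cos_sqrt lam (x - u) * q u) y.
    move=> /andP[y0 y1].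
    have sub : `]0, y[ `<=` `]0%R, 1%R[%classic by apply: subset_itvl; rewrite bnd_simp.
    have i1 := cintegrableS (measurable_itv _) (measurable_itv _) sub (iS t t01).
    have i2 := cintegrableS (measurable_itv _) (measurable_itv _) sub (iS x x01).
    have i3 := cintegrableS (measurable_itv _) (measurable_itv _) sub (iC x x01).
    have i4 := cintegrableZ (t - x)%:C (measurable_itv _) i3.
    have i5 : cintegrable `]0, y[
        (fun u => sin_sqrt lam (t - u) * q u - sin_sqrt lam (x - u) * q u).
      exact: cintegrableB.
    rewrite /prim -integralC_Z// -integralC_B// -integralC_B//.
    by apply: eq_integralC => u _; rewrite /k; ring.
  have ik : cintegrable `]0, 1[ (fun u => k u * q u).
    have := cintegrableD (measurable_itv _) (iS t t01) (cintegrableD (measurable_itv _)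
      (cintegrableZ (-1) (measurable_itv _) (iS x x01))
      (cintegrableZ (- (t - x)%:C) (measurable_itv _) (iC x x01))).
    congr cintegrable; apply/funext => u; rewrite /k; ring.
  rewrite (oriented_integralE ik a01 x01) (oriented_integralE (iS t t01) a01 x01).
  rewrite (oriented_integralE (iS x x01) a01 x01) (oriented_integralE (iC x x01) a01 x01).
  rewrite (primE x x01) (primE a a01).
  have regroup (A B C D E F c : R[i]) :
    (A - B - c * C) - (D - E - c * F) = (A - D) - (B - E) - c * (C - F) by ring.
  exact: regroup.
rewrite /solC split_t.
have regroup (ct cx Ot Oxt Ox c s Oc Ik : R[i]) : Ik = Ot - Ox - c * Oc ->
  ct + (Ot + Oxt) - (cx + Ox) - c * (s + Oc) = (ct - cx - c * s) + Ik + Oxt.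
  by move->; ring.
rewrite (regroup _ _ _ _ _ _ _ _ _ kE).
have xa : `|x - a| <= 1 by rewrite ler_norml; lra.
have b1 : nc (cos_sqrt lam (t - a) - cos_sqrt lam (x - a) -
    (t - x)%:C * (- (lam * sin_sqrt lam (x - a)))) <= K * (t - x) ^+ 2.
  by have [_ _ _ _] := HK _ _ xa tx1; have -> : x - a + (t - x) = t - a by ring.
have b2 : nc (oriented_integral a x (fun u => k u * q u)) <= M * (t - x) ^+ 2.
  have -> : M * (t - x) ^+ 2 = 2 * (K * (t - x) ^+ 2) * `|mass q x - mass q a|.
    by rewrite /M; ring.
  apply: nc_oriented_integral_le => // u; rewrite gt_min lt_max => u1 u2.
  have xu := le_trans (between_dist u1 u2) xa.
  by have [_ _ _ + _] := HK _ _ xu tx1; rewrite /k; have -> : x - u + (t - x) = t - u by ring.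
have b3 : nc (oriented_integral x t (fun u => sin_sqrt lam (t - u) * q u)) <=
    2 * (K * `|t - x|) * `|mass q t - mass q x|.
  apply: nc_oriented_integral_le => // u; rewrite gt_min lt_max => u1 u2.
  have tu := between_dist u1 u2.
  have [+ _ _ _ _] := HK _ _ (le_trans tu tx1) h0.
  by move=> /le_trans; apply; rewrite ler_wpM2l.
have sq : (t - x) ^+ 2 = `|t - x| * `|t - x| by rewrite -expr2 real_normK ?num_real.
have d0 := normr_ge0 (t - x).
have b4 : (K + M) * `|t - x| <= e / 2.
  have KM : 0 < K + M + 1 by rewrite ltr_wpDl ?addr_ge0.
  by move: tx; rewrite invfM mulrA ltr_pdivlMr//; exact: small_product d0.
have b5 : 2 * K * `|mass q t - mass q x| <= e / 2.
  have K1 : 0 < K + 1 by rewrite ltr_wpDl.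
  move: mt; rewrite invfM mulrA ltr_pdivlMr// distrC => mt.
  have := normr_ge0 (mass q t - mass q x); move: mt; lra.
apply: le_trans (ncD _ _) _; apply: le_trans (lerD (ncD _ _) (lexx _)) _.
apply: le_trans (lerD (lerD b1 b2) b3) _; rewrite sq.
have := ler_wpM2r d0 b4; have := ler_wpM2r d0 b5; lra.
Qed.

Lemma det2 (M : 'M[R[i]]_2) : \det M = M 0 0 * M 1 1 - M 0 1 * M 1 0.
Proof.
rewrite (expand_det_row _ 0) !big_ord_recl big_ord0 /cofactor !det_mx11 !mxE /=.
rewrite !expr0 !expr1 !mul1r addr0 mulN1r mulrN.
congr (_ * M _ _ - M _ _ * M _ _); exact/val_inj.
Qed.

Definition kernel_char lam gamma (u : R) := sin_sqrt lam u + gamma * sin_sqrt lam (1 - u).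

Lemma itv_oo0 x : `]x, x[%classic = set0 :> set R.
Proof. by rewrite set_itv_ge// bnd_simp ltxx. Qed.

(** After splitting at [a], the addition formulas express every integral through four integrals free
    of [a] in the integrand; what remains is an identity modulo [gamma ^+ 2 = 1] and cos^2 + lam
    sin^2 = 1. *)
Lemma charfunE q a gamma lam : 0 <= a <= 1 -> gamma ^+ 2 = 1 -> cintegrable `]0, 1[ q ->
  charfun q a gamma lam = 2%:R - 2%:R * gamma * cos_sqrt lam 1 -
    integralC `]0, 1[ (fun t => kernel_char lam gamma `|t - a| * q t).
Proof.
move=> a01 g2 qi; have /andP[a0 a1] := a01.
have z01 : 0 <= (0 : R) <= 1 by rewrite lexx ler01.
have o01 : 0 <= (1 : R) <= 1 by rewrite ler01 lexx.
rewrite /charfun det2 !mxE /= !deriv01_solS// !deriv01_solC// /solC /solS.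
have [mc ms] := measurable_trig lam.
have [K K0 HK] := trig_expansion lam.
have bnd (u : R) : `|u| <= 1 -> nc (cos_sqrt lam u) <= K /\ nc (sin_sqrt lam u) <= K.
  by move=> u1; have [_ ? ? _ _] := HK u 0 u1 ltac:(by rewrite normr0).
pose A0 := integralC `]0, a[ (fun t => cos_sqrt lam t * q t).
pose B0 := integralC `]0, a[ (fun t => sin_sqrt lam t * q t).
pose A1 := integralC `]a, 1[ (fun t => cos_sqrt lam (1 - t) * q t).
pose B1 := integralC `]a, 1[ (fun t => sin_sqrt lam (1 - t) * q t).
have q0 : cintegrable `]0, a[ q.
  by apply: cintegrableS qi => //; apply: subset_itvl; rewrite bnd_simp.
have q1 : cintegrable `]a, 1[ q.
  by apply: cintegrableS qi => //; apply: subset_itvr; rewrite bnd_simp.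
have in0 t : `]0, a[%classic t -> `|t| <= 1.
  rewrite /= in_itv/= => /andP[t0 ta]; rewrite ger0_norm ?ltW//.
  exact: lt_le_trans ta a1.
have in1 t : `]a, 1[%classic t -> `|1 - t| <= 1.
  rewrite /= in_itv/= => /andP[at_ t1]; rewrite ger0_norm ?subr_ge0 ?ltW//.
  by move: a0 at_; lra.
have iA0 : cintegrable `]0, a[ (fun t => cos_sqrt lam t * q t).
  by apply: (cintegrableM (B := K) (measurable_itv _) mc q0) => t /in0/bnd[].
have iB0 : cintegrable `]0, a[ (fun t => sin_sqrt lam t * q t).
  by apply: (cintegrableM (B := K) (measurable_itv _) ms q0) => t /in0/bnd[].
have iA1 : cintegrable `]a, 1[ (fun t => cos_sqrt lam (1 - t) * q t).
  by apply: (cintegrableM (B := K) (measurable_itv _) (cmeasurable_comp mc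
    (measurable_subr 1)) q1) => t /in1/bnd[].
have iB1 : cintegrable `]a, 1[ (fun t => sin_sqrt lam (1 - t) * q t).
  by apply: (cintegrableM (B := K) (measurable_itv _) (cmeasurable_comp ms
    (measurable_subr 1)) q1) => t /in1/bnd[].
have o0c : oriented_integral a 0 (fun t => cos_sqrt lam (0 - t) * q t) = - A0.
  (* For [a = 0] the definition takes its other branch, but then all intervals are empty. *)
  rewrite /oriented_integral; case: leP => [a0'|_].
    have a00 : a = 0 by apply/eqP; rewrite eq_le a0 a0'.
    by rewrite /A0 a00 itv_oo0 !integralC_set0 oppr0.
  by congr (- _); apply: eq_integralC => t _; rewrite sub0r cos_sqrtN.
have o0s : oriented_integral a 0 (fun t => sin_sqrt lam (0 - t) * q t) = B0.
  rewrite /oriented_integral; case: leP => [a0'|_].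
    have a00 : a = 0 by apply/eqP; rewrite eq_le a0 a0'.
    by rewrite /B0 a00 itv_oo0 !integralC_set0.
  have -> : (fun t => sin_sqrt lam (0 - t) * q t) = (fun t => -1 * (sin_sqrt lam t * q t)).
    by apply/funext => t; rewrite sub0r sin_sqrtN; ring.
  by rewrite integralC_Z// mulN1r opprK.
have o1c : oriented_integral a 1 (fun t => cos_sqrt lam (1 - t) * q t) = A1.
  rewrite /oriented_integral a1; exact: erefl.
have o1s : oriented_integral a 1 (fun t => sin_sqrt lam (1 - t) * q t) = B1.
  rewrite /oriented_integral a1; exact: erefl.
rewrite o0c o0s o1c o1s.
pose ca := cos_sqrt lam a; pose sa := sin_sqrt lam a.
pose cb := cos_sqrt lam (1 - a); pose sb := sin_sqrt lam (1 - a).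
have kernelE : integralC `]0, 1[ (fun t => kernel_char lam gamma `|t - a| * q t) =
    (sa * A0 - ca * B0 + gamma * (sb * A0 + cb * B0)) +
    (sb * A1 - cb * B1 + gamma * (sa * A1 + ca * B1)).
  have ki : cintegrable `]0, 1[ (fun t => kernel_char lam gamma `|t - a| * q t).
    have am : measurable_fun [set: R] (fun t => `|t - a|).
      apply: measurableT_comp; first exact: normr_measurable.
      by apply: measurable_funB; [exact: measurable_id|exact: measurable_cst].
    have km : cmeasurable (fun t => kernel_char lam gamma `|t - a|).
      apply: cmeasurableD; first exact: cmeasurable_comp ms am.
      apply: cmeasurableM; first exact: cmeasurable_cst.
      apply: (cmeasurable_comp (h := fun t => 1 - `|t - a|) ms).
      by apply: measurable_funB => //; exact: measurable_cst.
    apply: (cintegrableM (B := K + nc gamma * K) (measurable_itv _) km qi) => t.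
    rewrite /= in_itv/= => /andP[t0 t1].
    have ta : `|t - a| <= 1 by rewrite ler_norml; lra.
    have ta' : `|1 - `|t - a| | <= 1 by rewrite ler_norml; have := normr_ge0 (t - a); lra.
    rewrite /kernel_char; apply: le_trans (ncD _ _) _; rewrite ncM.
    have ta2 : `| `|t - a| | <= 1 by rewrite normr_id.
    apply: lerD; first by have [] := bnd _ ta2.
    by apply: ler_wpM2l; [exact: nc_ge0|have [] := bnd _ ta'].
  have -> : integralC `]0, 1[ (fun t => kernel_char lam gamma `|t - a| * q t) =
      integralC `]0, a[ (fun t => kernel_char lam gamma `|t - a| * q t) +
      integralC `]a, 1[ (fun t => kernel_char lam gamma `|t - a| * q t).
    have := oriented_integralE ki a01 o01; rewrite /oriented_integral a1 => ->.
    by rewrite /prim addrC subrK.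
  congr (_ + _).
    transitivity (integralC `]0, a[ (fun t => (sa + gamma * sb) * (cos_sqrt lam t * q t) +
        (gamma * cb - ca) * (sin_sqrt lam t * q t))).
      apply: eq_integralC => t; rewrite /= in_itv/= => /andP[t0 ta].
      rewrite distrC ger0_norm ?subr_ge0 ?ltW// /kernel_char.
      have -> : 1 - (a - t) = 1 - a + t by ring.
      rewrite sin_sqrtD [X in _ + gamma * X]sin_sqrtD sin_sqrtN cos_sqrtN -/sa -/sb -/ca -/cb;
        ring.
    rewrite integralC_D//; [|exact: cintegrableZ..].
    by rewrite !integralC_Z// -/A0 -/B0; ring.
  transitivity (integralC `]a, 1[ (fun t => (sb + gamma * sa) * (cos_sqrt lam (1 - t) * q t) +
        (gamma * ca - cb) * (sin_sqrt lam (1 - t) * q t))).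
    apply: eq_integralC => t; rewrite /= in_itv/= => /andP[at_ t1].
    rewrite ger0_norm ?subr_ge0 ?ltW// /kernel_char.
    have -> : 1 - (t - a) = a + (1 - t) by ring.
    have -> : t - a = 1 - a + - (1 - t) by ring.
    rewrite (sin_sqrtD lam (1 - a) (- (1 - t))) (sin_sqrtD lam a (1 - t)) sin_sqrtN cos_sqrtN.
    rewrite -/sa -/sb -/ca -/cb; ring.
  rewrite integralC_D//; [|exact: cintegrableZ..].
  by rewrite !integralC_Z// -/A1 -/B1; ring.
rewrite kernelE sub0r cos_sqrtN sin_sqrtN -/sa -/sb -/ca -/cb.
have c1 : cos_sqrt lam 1 = ca * cb - lam * sa * sb.
  by rewrite -cos_sqrtD addrC subrK.
have ua : ca ^+ 2 + lam * sa ^+ 2 = 1 by exact: cos_sin_sqrt1.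
have ub : cb ^+ 2 + lam * sb ^+ 2 = 1 by exact: cos_sin_sqrt1.
rewrite c1; apply/eqP; rewrite -subr_eq0; apply/eqP.
(* The difference of the two sides, written through the three relations that vanish. *)
transitivity ((ca ^+ 2 + lam * sa ^+ 2 - 1) + (gamma ^+ 2 * (cb ^+ 2 + lam * sb ^+ 2) - 1) +
  (gamma ^+ 2 - 1) * (cb * B1 - sb * A1)); first by ring.
by rewrite ua ub g2; ring.
Qed.

End characteristic_function.

(** * From equal spectra to equal odd moments *)

Section spectral_equality.
Context {R : realType}.
Local Notation mu := (@lebesgue_measure R).

Lemma cos_sqrt_sqr (rho : R[i]) : cos_sqrt (rho ^+ 2) 1 = cosC rho.
Proof.
rewrite /cos_sqrt rmorph1 mulr1.
have : sqrtc (rho ^+ 2) ^+ 2 = rho ^+ 2 by rewrite sqr_sqrtc.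
by move/eqP; rewrite eqf_sqr => /orP[] /eqP ->; rewrite ?cosCN.
Qed.

Local Opaque cos_sqrt sin_sqrt.
Implicit Types (q : R -> R[i]) (lam gamma z : R[i]) (a b x t h : R).

Definition norm1 q : R := \int[mu]_(t in `]0, 1[) abs1 q t.

Lemma norm1_ge0 q : 0 <= norm1 q.
Proof. by apply: Rintegral_ge0 => t _; exact: abs1_ge0. Qed.

Lemma gsum_tail (u : nat -> R[i]) (l : R[i]) (C : R) : gsum u l ->
  (forall n, nc (u n) <= C / 2 ^+ n) -> forall N, nc (l - \sum_(k < N) u k) <= 4 * C / 2 ^+ N.
Proof.
move=> ul /gsum_exists_tail[m Hm] N.
by have -> : l = m by apply: gsum_uniq ul _; exists (4 * C).
Qed.

Lemma exp_bound_entire (b : nat -> R[i]) (B : R) : 0 <= B ->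
  (forall n, nc (b n) <= B * (n`!%:R)^-1) -> entire b.
Proof.
move=> B0 H r r0; have [C HC] := entire_exp r0; exists (B * C) => n.
apply: le_trans (ler_wpM2r (exprn_ge0 n r0) (H n)) _; rewrite -mulrA.
by apply: ler_wpM2l => //; have := HC n; rewrite nc_exp_coef.
Qed.

Lemma sin_term_le n t : `|t| <= 1 -> `|sin_term n t| <= (n`!%:R)^-1.
Proof.
move=> t1; rewrite -[leRHS]mul1r -(expr0 `|t|); apply: power_term_le => //.
by rewrite leqW// -addnn leq_addr.
Qed.

Lemma cos_term_le n t : `|t| <= 1 -> `|cos_term n t| <= (n`!%:R)^-1.
Proof.
move=> t1; rewrite -[leRHS]mul1r -(expr0 `|t|); apply: power_term_le => //.
by rewrite -addnn leq_addr.
Qed.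

Section moments.
Variables (q : R -> R[i]) (f : R -> R).
Hypotheses (qi : cintegrable `]0, 1[ q) (mf : measurable_fun [set: R] f).
Hypothesis f1 : forall t, `]0, 1[%classic t -> `|f t| <= 1.

(** Stated for a general [f], since it is used both with |t - a| and with 1 - |t - a|. *)
Definition moment n := integralC `]0, 1[ (fun t => (sin_term n (f t))%:C * q t).

Lemma cmeasurable_sin_term n : cmeasurable (fun t => (sin_term n (f t))%:C).
Proof.
apply: cmeasurable_real; rewrite /sin_term; apply: measurable_funM; last exact: measurable_cst.
by apply: measurable_funM; [exact: measurable_cst|exact: measurable_funX].
Qed.

Lemma entire_moment : entire moment.
Proof.
apply: (@exp_bound_entire _ (2 * norm1 q)); first by rewrite mulr_ge0 ?norm1_ge0.
move=> n; rewrite mulrAC; apply: nc_integralCM_le => //; first exact: cmeasurable_sin_term.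
by move=> t /f1 ft; rewrite nc_real; exact: sin_term_le.
Qed.

Lemma cintegrable_sin_term n : cintegrable `]0, 1[ (fun t => (sin_term n (f t))%:C * q t).
Proof.
apply: (cintegrableM (B := (n`!%:R)^-1) (measurable_itv _) (cmeasurable_sin_term n) qi).
by move=> t /f1 ft; rewrite nc_real; exact: sin_term_le.
Qed.

Lemma moment_partial lam N :
  cmeasurable (fun t => \sum_(k < N) ((sin_term k (f t))%:C * lam ^+ k)) /\
  (cintegrable `]0, 1[ (fun t => (\sum_(k < N) ((sin_term k (f t))%:C * lam ^+ k)) * q t) /\
  \sum_(k < N) (moment k * lam ^+ k) =
    integralC `]0, 1[ (fun t => (\sum_(k < N) ((sin_term k (f t))%:C * lam ^+ k)) * q t)).
Proof.
elim: N => [|N [mN [iN IH]]].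
  have E : (fun t => \sum_(k < 0) ((sin_term k (f t))%:C * lam ^+ k)) = fun=> 0.
    by apply/funext => t; rewrite big_ord0.
  have E' : (fun t => (\sum_(k < 0) ((sin_term k (f t))%:C * lam ^+ k)) * q t) = fun t => 0 * q t.
    by apply/funext => t; rewrite big_ord0.
  rewrite E E' big_ord0; split; first exact: cmeasurable_cst.
  by split; [exact: cintegrableZ|rewrite integralC_Z// mul0r].
have E : (fun t => \sum_(k < N.+1) ((sin_term k (f t))%:C * lam ^+ k)) =
    fun t => \sum_(k < N) ((sin_term k (f t))%:C * lam ^+ k) + (sin_term N (f t))%:C * lam ^+ N.
  by apply/funext => t; rewrite big_ord_recr.
have E' : (fun t => (\sum_(k < N.+1) ((sin_term k (f t))%:C * lam ^+ k)) * q t) =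
    fun t => (\sum_(k < N) ((sin_term k (f t))%:C * lam ^+ k)) * q t +
      lam ^+ N * ((sin_term N (f t))%:C * q t).
  by apply/funext => t; rewrite big_ord_recr mulrDl; congr (_ + _); rewrite mulrCA mulrA.
have iZ := cintegrableZ (lam ^+ N) (measurable_itv _) (cintegrable_sin_term N).
rewrite E E' big_ord_recr IH; split.
  apply: cmeasurableD => //; apply: cmeasurableM; last exact: cmeasurable_cst.
  exact: cmeasurable_sin_term.
split; first exact: cintegrableD.
rewrite integralC_D//; congr (_ + _).
rewrite /= mulrC; exact: (esym (integralC_Z _ (measurable_itv _) (cintegrable_sin_term N))).
Qed.

(** For fixed [lam] the tails of the series of [sin_sqrt lam (f t)] are geometric uniformly in [t],
    so they stay geometric after integration against [q]. *)
Lemma has_ps_moment :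
  has_ps moment (fun lam => integralC `]0, 1[ (fun t => sin_sqrt lam (f t) * q t)).
Proof.
move=> lam; have [C C0 HC] := trig_geometric lam.
have [_ ms] := measurable_trig lam.
have [K K0 HK] := trig_small lam.
have mfs : cmeasurable (fun t => sin_sqrt lam (f t)) by exact: cmeasurable_comp.
exists (2 * (4 * C) * norm1 q) => N.
have [mN [iN ->]] := moment_partial lam N.
have iS : cintegrable `]0, 1[ (fun t => sin_sqrt lam (f t) * q t).
  by apply: (cintegrableM (B := K) (measurable_itv _) mfs qi) => t /f1/HK[].
rewrite -integralC_B//.
have -> : (fun t => sin_sqrt lam (f t) * q t -
    (\sum_(k < N) ((sin_term k (f t))%:C * lam ^+ k)) * q t) =
    fun t => (sin_sqrt lam (f t) - \sum_(k < N) ((sin_term k (f t))%:C * lam ^+ k)) * q t.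
  by apply/funext => t; rewrite mulrBl.
have -> : 2 * (4 * C) * norm1 q / 2 ^+ N = 2 * (4 * C / 2 ^+ N) * norm1 q by ring.
apply: nc_integralCM_le => //; first exact: cmeasurableB.
move=> t /f1 ft.
have H n : nc ((sin_term n (f t))%:C * lam ^+ n) <= C / 2 ^+ n by have [] := HC _ ft n.
exact: (gsum_tail (sin_sqrt_series lam (f t)) H N).
Qed.

End moments.

Section fixed_a.
Variable a : R.
Hypothesis a01 : 0 <= a <= 1.

Let d t : R := `|t - a|.
Let e t : R := 1 - `|t - a|.

Let md : measurable_fun [set: R] d.
Proof.
apply: measurableT_comp; first exact: normr_measurable.
by apply: measurable_funB; [exact: measurable_id|exact: measurable_cst].
Qed.

Let me : measurable_fun [set: R] e.
Proof. by apply: measurable_funB => //; exact: measurable_cst. Qed.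

Let d1 t : `]0, 1[%classic t -> `|d t| <= 1.
Proof.
move/andP: a01 => [a0 a1]; rewrite /= in_itv/= /d normr_id ler_norml => /andP[t0 t1]; lra.
Qed.

Let e1 t : `]0, 1[%classic t -> `|e t| <= 1.
Proof.
move=> /d1; rewrite /e /d normr_id => dt.
by rewrite ler_norml; have := normr_ge0 (t - a); lra.
Qed.

Definition char_coef q gamma n : R[i] :=
  (if n == 0%N then 2%:R else 0) + (- (2%:R * gamma)) * (cos_term n 1)%:C +
  (- 1) * (moment q d n + gamma * moment q e n).

Lemma char_kernel_split q gamma lam : cintegrable `]0, 1[ q ->
  integralC `]0, 1[ (fun t => kernel_char lam gamma `|t - a| * q t) =
  integralC `]0, 1[ (fun t => sin_sqrt lam (d t) * q t) +
  gamma * integralC `]0, 1[ (fun t => sin_sqrt lam (e t) * q t).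
Proof.
move=> qi; have [_ ms] := measurable_trig lam; have [K K0 HK] := trig_small lam.
have i1 : cintegrable `]0, 1[ (fun t => sin_sqrt lam (d t) * q t).
  by apply: (cintegrableM (B := K) (measurable_itv _) (cmeasurable_comp ms md) qi) => t /d1/HK[].
have i2 : cintegrable `]0, 1[ (fun t => sin_sqrt lam (e t) * q t).
  by apply: (cintegrableM (B := K) (measurable_itv _) (cmeasurable_comp ms me) qi) => t /e1/HK[].
rewrite -integralC_Z// -integralC_D//; last exact: cintegrableZ.
by apply: eq_integralC => t _; rewrite /kernel_char mulrDl mulrA.
Qed.

Lemma char_coefP q gamma : gamma ^+ 2 = 1 -> cintegrable `]0, 1[ q ->
  entire (char_coef q gamma) /\ has_ps (char_coef q gamma) (charfun q a gamma).
Proof.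
move=> g2 qi.
have ec : entire (fun n => (cos_term n 1)%:C : R[i]).
  apply: (@exp_bound_entire _ 1) => // n; rewrite nc_real mul1r; apply: cos_term_le.
  by rewrite normr1.
have e0 : entire (fun n => if n == 0%N then 2%:R else 0 : R[i]).
  move=> r r0; exists 2 => -[|n]; first by rewrite eqxx expr0 mulr1 nc_nat.
  by rewrite -[n.+1 == 0%N]/false nc0 mul0r.
have p0 : has_ps (fun n => if n == 0%N then 2%:R else 0 : R[i]) (fun=> 2%:R).
  move=> z; have := @gsum_finite _ (fun k => (if k == 0%N then 2%:R else 0) * z ^+ k) 1.
  by rewrite big_ord1 eqxx expr0 mulr1; apply => -[//|n] _; rewrite -[n.+1 == 0%N]/false mul0r.
split.
  apply: entireD; first by apply: entireD => //; exact: entireZ.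
  apply: entireZ; apply: entireD; first exact: entire_moment.
  by apply: entireZ; exact: entire_moment.
have -> : charfun q a gamma = fun lam => 2%:R + (- (2%:R * gamma)) * cos_sqrt lam 1 +
    (- 1) * (integralC `]0, 1[ (fun t => sin_sqrt lam (d t) * q t) +
    gamma * integralC `]0, 1[ (fun t => sin_sqrt lam (e t) * q t)).
  apply/funext => lam; rewrite charfunE// char_kernel_split//.
  by rewrite mulN1r mulNr.
apply: has_psD; first by apply: has_psD => //; apply: has_psZ => z; exact: cos_sqrt_series.
apply: has_psZ; apply: has_psD; first exact: has_ps_moment.
by apply: has_psZ; exact: has_ps_moment.
Qed.

Lemma nc_kernel_le q gamma lam : nc gamma = 1 -> lam != 0 -> cintegrable `]0, 1[ q ->
  nc (integralC `]0, 1[ (fun t => kernel_char lam gamma `|t - a| * q t)) <=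
  4 * (expR `|complex.Im (sqrtc lam)| / nc (sqrtc lam)) * norm1 q.
Proof.
move=> g1 lam0 qi; have [_ ms] := measurable_trig lam.
set B := expR _ / _; have -> : 4 * B = 2 * (B + B) by ring.
apply: nc_integralCM_le => //.
  apply: cmeasurableD; first exact: cmeasurable_comp ms md.
  by apply: cmeasurableM; [exact: cmeasurable_cst|exact: cmeasurable_comp ms me].
move=> t t01; apply: le_trans (ncD _ _) _; apply: lerD.
  exact: nc_sin_sqrt_le lam0 (d1 t01).
by rewrite ncM g1 mul1r; exact: nc_sin_sqrt_le lam0 (e1 t01).
Qed.

End fixed_a.

(** One of the two exponentials has modulus exp |Im z|, the other at most 1. *)
Lemma nc_cosC_ge z : (expR `|complex.Im z| - 1) / 2 <= nc (cosC z).
Proof.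
have aux (u v : R[i]) : nc u - nc v <= nc (u + v).
  by rewrite -(ncN v) -[v in nc (u + v)]opprK nc_lerB.
have E1 : nc (expC ('i%C * z)) = expR (- complex.Im z).
  by rewrite nc_expC; case: z => x y /=; rewrite mul0r mul1r sub0r.
have E2 : nc (expC (- ('i%C * z))) = expR (complex.Im z).
  by rewrite nc_expC; case: z {E1} => x y /=; rewrite mul0r mul1r sub0r opprK.
rewrite /cosC ncM ncV nc_nat ler_pM2r ?invr_gt0//.
have [y0|y0] := leP 0 (complex.Im z).
  rewrite ger0_norm// [X in _ <= nc X]addrC; apply: le_trans (aux _ _); rewrite E1 E2 lerB//.
  by rewrite -expR0 ler_expR oppr_le0.
rewrite ltr0_norm//; apply: le_trans (aux _ _); rewrite E1 E2 lerB//.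
by rewrite -expR0 ler_expR ltW.
Qed.

Lemma Re_cosC z : cos (complex.Re z) = 0 -> complex.Re (cosC z) = 0.
Proof.
move=> c0; have h2 : (2%:R : R[i])^-1 = (2%:R^-1)%:C by rewrite fmorphV rmorph_nat.
rewrite /cosC h2 Re_mul ReD /expC; case: z c0 => x y /= c0.
by rewrite ?mul0r ?mul1r ?sub0r ?add0r ?subr0 ?addr0 ?cosN ?c0 ?mulr0 ?addr0 ?mul0r ?subr0.
Qed.

Definition radius n : R := pi / 2 + (2 * pi) *+ n.

Lemma cos_radius n : cos (radius n) = 0.
Proof.
rewrite /radius; elim: n => [|n IH]; first by rewrite mulr0n addr0 cos_pihalf.
have -> : pi / 2 + (2 * pi) *+ n.+1 = (pi / 2 + (2 * pi) *+ n) + pi + pi :> R.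
  by rewrite mulrSr; ring.
by rewrite !cosDpi opprK.
Qed.

Lemma radius_large (r0 : R) : exists n, r0 <= radius n.
Proof.
exists (Num.Def.archi_bound `|r0|).
apply: le_trans (ler_norm r0) _; apply: le_trans (ltW (Num.Theory.archi_boundP (normr_ge0 r0))) _.
have p2 := pi_ge2 R.
set m := Num.Def.archi_bound _.
have : m%:R <= (2 * pi) *+ m :> R by rewrite -[leRHS]mulr_natr ler_peMl//; lra.
by rewrite /radius; lra.
Qed.

(* On this contour one of the coordinates of [sqrtc lam] is [+- radius n]. *)
Lemma char_main_ge gamma lam n : gamma = 1 \/ gamma = -1 -> 5 <= radius n ->
  nc lam + `|complex.Re lam| = 2 * radius n ^+ 2 ->
  [/\ radius n <= nc (sqrtc lam), lam != 0 &
    expR `|complex.Im (sqrtc lam)| / 2 <= nc (2%:R - 2%:R * gamma * cos_sqrt lam 1)].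
Proof.
move=> gpm r5; set r := radius n; set rho := sqrtc lam;
  have <- : rho ^+ 2 = lam by exact: sqr_sqrtc.
move=> HN.
have r0 : 0 < r by rewrite /r; lra.
have ncE : nc rho ^+ 2 = complex.Re rho ^+ 2 + complex.Im rho ^+ 2.
  by case: (rho) => u v /=; rewrite sqr_sqrtr ?addr_ge0 ?sqr_ge0.
have ReE : complex.Re (rho ^+ 2) = complex.Re rho ^+ 2 - complex.Im rho ^+ 2.
  by rewrite expr2 Re_mul !expr2.
rewrite ncX ncE ReE in HN.
have xy : complex.Re rho ^+ 2 = r ^+ 2 \/ complex.Im rho ^+ 2 = r ^+ 2.
  have [h|h] := leP (complex.Im rho ^+ 2) (complex.Re rho ^+ 2).
    by left; rewrite ger0_norm ?subr_ge0// in HN; lra.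
  by right; rewrite ltr0_norm ?subr_lt0// in HN; lra.
have rr : r <= nc rho.
  rewrite -(@ler_pXn2r _ 2)// ?nnegrE ?nc_ge0 ?(ltW r0)// ncE.
  by have := sqr_ge0 (complex.Re rho); have := sqr_ge0 (complex.Im rho); case: xy => ->; lra.
have rho0 : rho != 0 by rewrite -nc_gt0 (lt_le_trans r0).
split => //; first by rewrite expf_neq0.
rewrite cos_sqrt_sqr.
have -> : 2%:R - 2%:R * gamma * cosC rho = 2%:R * (1 - gamma * cosC rho) by ring.
rewrite ncM nc_nat.
have ncg : nc (gamma * cosC rho) = nc (cosC rho).
  by case: gpm => ->; rewrite ?mul1r ?mulN1r ?ncN.
have Rg : `|complex.Re (gamma * cosC rho)| = `|complex.Re (cosC rho)|.
  by case: gpm => ->; rewrite ?mul1r// mulN1r; case: (cosC rho) => u v /=; rewrite normrN.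
have cge := nc_cosC_ge rho.
case: xy => [xr|yr].
  (* On the vertical sides [gamma * cosC rho] is purely imaginary, so its distance to 1 is at least
     1 and at least [nc (cosC rho)]; the sum of these two bounds is enough. *)
  have cx : cos (complex.Re rho) = 0.
    move/eqP: xr; rewrite eqf_sqr => /orP[] /eqP ->; rewrite ?cosN; exact: cos_radius.
  have Rc := Re_cosC cx; rewrite Rc normr0 in Rg.
  have Rg0 : complex.Re (gamma * cosC rho) = 0 by apply/eqP; rewrite -normr_eq0 Rg.
  have g1 : 1 <= nc (1 - gamma * cosC rho).
    by apply: le_trans (nc_ge_Re _); rewrite ReB Rg0 /= subr0 normr1.
  have g2 : nc (cosC rho) <= nc (1 - gamma * cosC rho).
    apply: le_trans (nc_ge_Im _); rewrite ImB /= sub0r normrN -[leLHS]ncg.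
    by apply: le_trans (nc_le_ReIm _) _; rewrite Rg0 normr0 add0r.
  by move: g1 g2 cge; lra.
(* On the horizontal sides the lower bound is exp |Im rho| - 3, at least half of the exponential
   once that reaches 6; hence the condition [5 <= radius n]. *)
have e6 : 6 <= expR `|complex.Im rho|.
  have -> : `|complex.Im rho| = r.
    by rewrite -sqrtr_sqr yr sqrtr_sqr gtr0_norm.
  by apply: le_trans (expR_ge1Dx _); rewrite -/r in r5; lra.
have g1 : nc (cosC rho) - 1 <= nc (1 - gamma * cosC rho).
  by rewrite -ncg -[X in _ - X]nc1 nc_distC nc_lerB.
by move: g1 cge e6; lra.
Qed.

(** [A] is the main term and [X], [Y] are the integral terms. For [rho >= 16 (n1 + n2)] each of
    these is at most [E / 4], which leaves [E / 4] for the denominator; for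
    [rho >= 16 (n1 + n2) / e] the numerator [Y - X] is at most [e * E / 4]. *)
Lemma contour_bound (A X Y : R[i]) (E rho e n1 n2 : R) :
  0 < E -> 0 < e -> 0 <= n1 -> 0 <= n2 ->
  5 + 16 * (n1 + n2) + 16 * (n1 + n2) / e <= rho -> E / 2 <= nc A ->
  nc X <= 4 * (E / rho) * n1 -> nc Y <= 4 * (E / rho) * n2 ->
  [/\ A - X != 0, A - Y != 0 & nc ((A - X) / (A - Y) - 1) <= e].
Proof.
move=> E0 e0 n10 n20; set W := n1 + n2 => Hrho AE.
have W0 : 0 <= W by rewrite addr_ge0.
have We : 0 <= 16 * W / e by rewrite divr_ge0// ?mulr_ge0// ltW.
have rho0 : 0 < rho by lra.
have -> : 4 * (E / rho) * n1 = 4 * (E / rho * n1) by ring.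
have -> : 4 * (E / rho) * n2 = 4 * (E / rho * n2) by ring.
have Er : E / rho * W <= E / 16.
  by rewrite mulrAC ler_pdivrMr// -mulrA ler_wpM2l ?(ltW E0)//; lra.
have Er' : E / rho * W <= E / 16 * e.
  rewrite mulrAC ler_pdivrMr// -!mulrA ler_wpM2l ?(ltW E0)//.
  have : 16 * W / e <= rho by lra.
  by rewrite ler_pdivrMr//; lra.
have Er0 : 0 <= E / rho by rewrite divr_ge0// ltW.
have := mulr_ge0 Er0 n10; have := mulr_ge0 Er0 n20.
move: Er Er'; rewrite /W mulrDr; set u := E / rho * n1; set v := E / rho * n2.
move=> Er Er' v0 u0 HX HY.
have lX : E / 4 <= nc (A - X) by apply: le_trans (nc_lerB _ _); lra.
have lY : E / 4 <= nc (A - Y) by apply: le_trans (nc_lerB _ _); lra.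
have E4 : 0 < E / 4 by rewrite divr_gt0.
have nX : A - X != 0 by rewrite -nc_gt0 (lt_le_trans E4).
have nY : A - Y != 0 by rewrite -nc_gt0 (lt_le_trans E4).
split => //; have -> : (A - X) / (A - Y) - 1 = (Y - X) / (A - Y) by field.
rewrite ncM ncV ler_pdivrMr ?nc_gt0//; apply: (@le_trans _ _ (e * (E / 4))); last first.
  by apply: ler_wpM2l => //; exact: ltW.
by apply: le_trans (ncB _ _) _; lra.
Qed.

Lemma radius_bounds (W s0 : R) n : 0 <= W -> 5 + W + `|s0| <= radius n ->
  [/\ 5 <= radius n, 5 + W <= radius n & s0 <= 2 * radius n ^+ 2].
Proof.
move=> W0 rn; have s00 := normr_ge0 s0; have s01 := ler_norm s0.
split; [lra..|]; have : radius n <= radius n ^+ 2 by rewrite expr2 ler_peMl//; lra.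
by lra.
Qed.

Lemma charfun_determined q qt a gamma : 0 <= a <= 1 -> gamma = 1 \/ gamma = -1 ->
  cintegrable `]0, 1[ q -> cintegrable `]0, 1[ qt ->
  spectrum q a gamma = spectrum qt a gamma -> charfun q a gamma = charfun qt a gamma.
Proof.
move=> a01 gpm qi qti spec.
have g2 : gamma ^+ 2 = 1 by case: gpm => ->; rewrite ?sqrrN expr1n.
have g1 : nc gamma = 1 by case: gpm => ->; rewrite ?ncN nc1.
have [eF pF] := char_coefP a01 g2 qi; have [eG pG] := char_coefP a01 g2 qti.
have zeros p p' z m : spectrum p a gamma = spectrum p' a gamma -> (0 < m)%N ->
    zero_of_mult (charfun p a gamma) z m -> zero_of_mult (charfun p' a gamma) z m.
  move=> sp m0 Hz; have S : spectrum p a gamma (z, m) := conj m0 Hz.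
  by rewrite sp in S; exact: S.2.
apply: (zeros_determine eF pF eG pG) => [z m m0|e s0 e0].
  by split; [exact: (zeros q qt z m spec m0)|exact: (zeros qt q z m (esym spec) m0)].
have [W WE] : exists W, W = 16 * (norm1 q + norm1 qt) + 16 * (norm1 q + norm1 qt) / e by eexists.
(* Here 5 serves [char_main_ge], [W] serves [contour_bound], and |s0| carries the contour beyond the
   prescribed level. *)
have [n rn] := radius_large (5 + W + `|s0|).
have W0 : 0 <= W.
  rewrite WE; have := norm1_ge0 qt; have := norm1_ge0 q; clear WE.
  move: (norm1 q) (norm1 qt) e e0 => n1 n2 e' e'0 n10 n20.
  by rewrite addr_ge0 ?divr_ge0 ?mulr_ge0 ?addr_ge0 ?(ltW e'0).
have [r5 rW rs] := radius_bounds W0 rn.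
exists (2 * radius n ^+ 2); first exact: rs.
move=> lam Hlam.
have [rr lam0 main] := char_main_ge gpm r5 Hlam.
rewrite (charfunE lam a01 g2 qi) (charfunE lam a01 g2 qti);
  apply: (contour_bound (expR_gt0 _) e0 (norm1_ge0 q) (norm1_ge0 qt) _ main).
- by rewrite -addrA -WE; exact: le_trans rW rr.
- exact: nc_kernel_le.
- exact: nc_kernel_le.
Qed.

Lemma moments_determined q qt a : 0 <= a <= 1 ->
  cintegrable `]0, 1[ q -> cintegrable `]0, 1[ qt ->
  (forall alpha : nat, (alpha < 2)%N -> spectrum_alpha q a alpha = spectrum_alpha qt a alpha) ->
  forall n, integralC `]0, 1[ (fun t => (`|t - a| ^+ n.*2.+1)%:C * (q t - qt t)) = 0.
Proof.
move=> a01 qi qti spec n.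
have coefE gamma : gamma = 1 \/ gamma = -1 -> spectrum q a gamma = spectrum qt a gamma ->
    char_coef a q gamma n = char_coef a qt gamma n.
  move=> gpm sp; have g2 : gamma ^+ 2 = 1 by case: gpm => ->; rewrite ?sqrrN expr1n.
  have [eF pF] := char_coefP a01 g2 qi; have [eG pG] := char_coefP a01 g2 qti.
  rewrite -(charfun_determined a01 gpm qi qti sp) in pG.
  by rewrite (ps_coef_uniq eF eG pF pG).
have := coefE 1 (or_introl erefl) (spec 0%N isT).
have := coefE (-1) (or_intror erefl) (spec 1%N isT).
rewrite /char_coef.
set M := moment q _ n; set M' := moment q _ n; set T := moment qt _ n; set T' := moment qt _ n.
set A := (if _ then _ else _); set B := (cos_term n 1)%:C => h1 h2.
(* Adding the identities for [gamma = 1] and [gamma = -1] cancels the moments of 1 - |t - a| and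
   doubles those of |t - a|. *)
have MT : M = T.
  have h3 : A + - (2%:R * -1) * B + -1 * (M + -1 * M') +
    (A + - (2%:R * 1) * B + -1 * (M + 1 * M')) =
    A + - (2%:R * -1) * B + -1 * (T + -1 * T') + (A + - (2%:R * 1) * B + -1 * (T + 1 * T')).
    by rewrite h1 h2.
  have two0 : (2%:R : R[i]) != 0 by rewrite pnatr_eq0.
  apply: (mulfI two0); apply/eqP; rewrite -subr_eq0 -oppr_eq0; apply/eqP.
  by move/eqP: h3; rewrite -subr_eq0 => /eqP <-; ring.
have md : measurable_fun [set: R] (fun t => `|t - a|).
  apply: measurableT_comp; first exact: normr_measurable.
  by apply: measurable_funB; [exact: measurable_id|exact: measurable_cst].
have d1 t : `]0, 1[%classic t -> `| `|t - a| | <= 1.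
  by move/andP: (a01) => [a0 a1]; rewrite /= in_itv/= normr_id ler_norml => /andP[t0 t1]; lra.
pose c : R[i] := ((-1) ^+ n * (n.*2.+1)`!%:R)%:C.
have -> : (fun t => (`|t - a| ^+ n.*2.+1)%:C * (q t - qt t)) =
    fun t => c * ((sin_term n `|t - a|)%:C * q t - (sin_term n `|t - a|)%:C * qt t).
  apply/funext => t; rewrite -mulrBr mulrA; congr (_ * _); rewrite /c -rmorphM; congr (_%:C).
  have f0 : (n.*2.+1)`!%:R != 0 :> R by rewrite pnatr_eq0 -lt0n fact_gt0.
  have s1 : (-1) ^+ n * (-1) ^+ n = 1 :> R by rewrite -exprMn mulN1r opprK expr1n.
  rewrite /sin_term -[LHS]mul1r -[X in X * _ = _]s1; set e := _ ^+ n; set x := _ ^+ n.*2.+1.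
  by set m := _%:R in f0 *; field.
have iq := cintegrable_sin_term qi md d1 n; have iqt := cintegrable_sin_term qti md d1 n.
rewrite integralC_Z//; last exact: cintegrableB.
rewrite integralC_B//; apply/eqP; rewrite mulf_eq0 subr_eq0 orbC.
by rewrite -/(moment q (fun t => `|t - a|) n) -/(moment qt (fun t => `|t - a|) n) -/M -/T MT eqxx.
Qed.

End spectral_equality.

(** * Invariance of Lebesgue measure under translation and reflection *)

Section translation.
Context {R : realType}.
Local Notation mu := (@lebesgue_measure R).
Implicit Types (a x t s : R) (f g : R -> R).

Lemma measurable_translate a : measurable_fun [set: R] (fun s => a + s).
Proof. by apply: measurable_funD; [exact: measurable_cst|exact: measurable_id]. Qed.

Lemma measurable_reflect a : measurable_fun [set: R] (fun s => a - s).
Proof. by apply: measurable_funB; [exact: measurable_cst|exact: measurable_id]. Qed.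

(** Lebesgue measure is determined by its values on half-open intervals, so the pushforward under
    [phi] has to be computed only there. *)
Lemma preserves_ocitv (phi : R -> R) : measurable_fun [set: R] phi ->
  (forall u v, u < v -> mu (phi @^-1` `]u, v]) = (v - u)%:E) ->
  forall A : set (measurableTypeR R), measurable A -> mu (phi @^-1` A) = mu A.
Proof.
move=> mphi H A mA.
have mphi' : @measurable_fun _ _ (measurableTypeR R) (measurableTypeR R) setT phi := mphi.
pose Phi : {mfun measurableTypeR R >-> measurableTypeR R} :=
  HB.pack (phi : measurableTypeR R -> measurableTypeR R) (isMeasurableFun.Build _ _ _ _ _ mphi').
apply/esym; apply: (lebesgue_measure_unique (mu := pushforward mu Phi)) mA => _ [[u v] _ <-] /=.
rewrite /pushforward /= lebesgue_measure_itv/= lte_fin; case: ltP => uv; first by rewrite H.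
by rewrite set_itv_ge ?bnd_simp -?leNgt// preimage_set0 measure0.
Qed.

Lemma preserves_translate a (A : set (measurableTypeR R)) : measurable A ->
  mu ((fun s => a + s) @^-1` A) = mu A.
Proof.
apply: preserves_ocitv; first exact: measurable_translate.
move=> u v uv; have -> : (fun s => a + s) @^-1` `]u, v] = `]u - a, v - a]%classic.
  by apply/seteqP; split=> s /=; rewrite !in_itv/= => /andP[h1 h2]; apply/andP; split; lra.
rewrite lebesgue_measure_itv/= lte_fin ltrD2r uv.
by rewrite -EFinB; congr (_%:E); ring.
Qed.

Lemma preserves_reflect a (A : set (measurableTypeR R)) : measurable A ->
  mu ((fun s => a - s) @^-1` A) = mu A.
Proof.
apply: preserves_ocitv; first exact: measurable_reflect.
move=> u v uv; have -> : (fun s => a - s) @^-1` `]u, v] = `[a - v, a - u[%classic.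
  by apply/seteqP; split=> s /=; rewrite !in_itv/= => /andP[h1 h2]; apply/andP; split; lra.
rewrite lebesgue_measure_itv/= lte_fin ltrD2l ltrN2 uv.
by rewrite -EFinB; congr (_%:E); ring.
Qed.

Lemma ae_preserve (phi : R -> R) (Q : R -> Prop) : measurable_fun [set: R] phi ->
  (forall A : set (measurableTypeR R), measurable A -> mu (phi @^-1` A) = mu A) ->
  {ae mu, forall t, Q t} -> {ae mu, forall s, Q (phi s)}.
Proof.
move=> mphi H [N [mN N0 sub]]; exists (phi @^-1` N); split.
- by rewrite -[X in measurable X]setTI; exact: mphi.
- by rewrite H.
- by move=> s /= ns; exact: sub.
Qed.

Lemma integral_preserve (phi : R -> R) f : measurable_fun [set: R] phi ->
  (forall A : set (measurableTypeR R), measurable A -> mu (phi @^-1` A) = mu A) ->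
  mu.-integrable [set: R] (EFin \o f) ->
  mu.-integrable [set: R] (EFin \o (fun s => f (phi s))) /\
  \int[mu]_(s in [set: R]) f (phi s) = \int[mu]_(t in [set: R]) f t.
Proof.
move=> mphi H fi; have [mf fin] := integrableP _ _ _ fi.
have mfphi : measurable_fun [set: R] (EFin \o (fun s => f (phi s))).
  exact: (@measurableT_comp _ _ _ _ _ _ (EFin \o f) _ phi mf mphi).
have fiphi : mu.-integrable [set: R] (EFin \o (fun s => f (phi s))).
  apply/integrableP; split => //; apply: le_lt_trans fin.
  have mabs : measurable_fun [set: measurableTypeR R] (fun t => `|(f t)%:E|%E).
    by apply: measurableT_comp => //; exact: measurable_abse.
  have := @ge0_integral_pushforward _ _ (measurableTypeR R) (measurableTypeR R) R phi mphi mu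
    [set: R] (fun t => `|(f t)%:E|%E) (@measurableT _ _) mabs (fun _ _ => abse_ge0 _).
  rewrite preimage_setT => <-.
  by rewrite (@eq_measure_integral _ _ _ _ mu)// => A mA _; exact: H.
split => //; rewrite /Rintegral; congr fine.
have := @integral_pushforward _ _ (measurableTypeR R) (measurableTypeR R) R phi mphi mu
    [set: R] (EFin \o f) mf.
rewrite preimage_setT => /(_ fiphi (@measurableT _ _)) <-.
by apply: eq_measure_integral => A mA _; exact: H.
Qed.

End translation.

(** * Polynomial approximation of a step function *)

Section step_functions.
Context {R : realType}.
Implicit Types (w v : R).

(** Behind it is 1 - w^n = (1 - w)(1 + w + ... + w^(n-1)), where each of the [n] summands is at
    least w^n. *)
Lemma mulrn_expr_le w n : 0 <= w -> w < 1 -> n%:R * w ^+ n <= (1 - w)^-1.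
Proof.
move=> w0 w1; rewrite -[leRHS]mul1r ler_pdivlMr ?subr_gt0//.
apply: (@le_trans _ _ (1 - w ^+ n)); last by rewrite gerBl exprn_ge0.
elim: n => [|n IH]; first by rewrite !mul0r expr0 subrr.
have wn0 : 0 <= w ^+ n by exact: exprn_ge0.
have wn1 : w ^+ n <= 1 by rewrite exprn_ile1// ltW.
rewrite exprS; move: IH; rewrite -natr1.
have n0 : 0 <= n%:R :> R by exact: ler0n.
have := ler_wpM2l w0 wn1.
move: (n%:R : R) (w ^+ n) => m u in n0 wn0 wn1 *; nra.
Qed.

Lemma bernoulli v n : -1 <= v -> 1 + n%:R * v <= (1 + v) ^+ n.
Proof.
move=> v1; elim: n => [|n IH]; first by rewrite mul0r addr0 expr0.
have v0 : 0 <= 1 + v by lra.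
rewrite exprS; apply: le_trans (ler_wpM2l v0 IH).
have : 0 <= n%:R * v ^+ 2 by rewrite mulr_ge0 ?sqr_ge0.
rewrite -natr1; move: (n%:R : R) => m; lra.
Qed.

(* [n k^n] rather than [k^n] so that the limit is also [0] at [w = 1]. *)
Lemma step_cvg w k : 0 <= w -> (0 < k)%N -> w ^+ 2 <= k%:R ->
  (fun n => (1 - (w ^+ 2 / k%:R) ^+ n) ^+ (n * k ^ n)) @ \oo --> ((w < 1)%R%:R : R).
Proof.
move=> w0 k0 wk; have k0' : 0 < (k%:R : R) by rewrite ltr0n.
have v0 : 0 <= w ^+ 2 / k%:R by rewrite divr_ge0// ?sqr_ge0// ltW.
have v1 : w ^+ 2 / k%:R <= 1 by rewrite ler_pdivrMr// mul1r.
have vn0 n : 0 <= (w ^+ 2 / k%:R) ^+ n by exact: exprn_ge0.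
have vn1 n : (w ^+ 2 / k%:R) ^+ n <= 1 by rewrite exprn_ile1.
have E n : (n * k ^ n)%:R * (w ^+ 2 / k%:R) ^+ n = n%:R * (w ^+ n * w ^+ n) :> R.
  rewrite natrM natrX -mulrA -exprMn mulrCA divff ?gt_eqF// mulr1.
  by rewrite expr2 exprMn.
have [w1|w1] := ltP w 1.
  (* Bernoulli bounds the power below by 1 - n w^(2n), and n w^n stays below 1 / (1 - w). *)
  have low n : 1 - w ^+ n * (1 - w)^-1 <= (1 - (w ^+ 2 / k%:R) ^+ n) ^+ (n * k ^ n).
    have v1' : -1 <= - (w ^+ 2 / k%:R) ^+ n by rewrite lerN2.
    apply: le_trans (bernoulli _ v1'); rewrite mulrN E lerD2l lerN2.
    have := mulrn_expr_le n w0 w1; have := exprn_ge0 n w0 => wn0 le1.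
    by rewrite mulrCA; exact: ler_wpM2l.
  have c1 : (fun n => 1 - w ^+ n * (1 - w)^-1) @ \oo --> (1 : R).
    rewrite -[X in _ --> X]subr0 -[X in _ --> _ - X](mul0r (1 - w)^-1).
    apply: cvgB; first exact: cvg_cst.
    by apply: cvgMl; apply: cvg_expr; rewrite ger0_norm.
  apply: (squeeze_cvgr (f := fun n => 1 - w ^+ n * (1 - w)^-1) (h := fun=> 1)); last 2 first.
  - exact: c1.
  - exact: cvg_cst.
  by apply: nearW => n; rewrite low/= exprn_ile1 ?subr_ge0// gerBl.
(* With v = (w^2/k)^n and m = n k^n, (1 - v)^m (1 + v)^m <= 1, while Bernoulli gives (1 + v)^m >= 1
   + n w^(2n) >= n + 1. *)
have up n : (1 - (w ^+ 2 / k%:R) ^+ n) ^+ (n * k ^ n) <= (n.+1%:R)^-1.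
  rewrite -[leRHS]mul1r ler_pdivlMr ?ltr0n//.
  have v2 : -1 <= (w ^+ 2 / k%:R) ^+ n by apply: le_trans (vn0 n); rewrite lerN10.
  have B := bernoulli (n * k ^ n) v2; rewrite E in B.
  have wn : 1 <= w ^+ n by exact: exprn_ege1.
  have nB : n.+1%:R <= (1 + (w ^+ 2 / k%:R) ^+ n) ^+ (n * k ^ n).
    apply: le_trans B; rewrite -natr1 addrC lerD2l ler_peMr// -[leLHS]mulr1.
    by apply: ler_pM => //; exact: ler01.
  have p0 : 0 <= (1 - (w ^+ 2 / k%:R) ^+ n) ^+ (n * k ^ n) by rewrite exprn_ge0 ?subr_ge0.
  apply: le_trans (ler_wpM2l p0 nB) _; rewrite -exprMn; apply: exprn_ile1.
    by rewrite mulr_ge0 ?subr_ge0 ?addr_ge0.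
  by have := vn0 n; have := vn1 n; nra.
apply: (squeeze_cvgr (f := fun=> 0) (h := @harmonic R)); last 2 first.
- exact: cvg_cst.
- exact: cvg_harmonic.
by apply: nearW => n; rewrite up exprn_ge0 ?subr_ge0.
Qed.

End step_functions.

(** * Vanishing odd moments force odd symmetry about [a] *)

Section odd_moments.
Context {R : realType}.
Local Notation mu := (@lebesgue_measure R).
Implicit Types (x s t u : R) (k f : R -> R).

Lemma integrable_boundedM (D : set R) k f (B : R) : measurable D ->
  measurable_fun [set: R] k -> (forall t, D t -> `|k t| <= B) ->
  mu.-integrable D (EFin \o f) -> mu.-integrable D (EFin \o (fun t => k t * f t)).
Proof.
move=> mD mk kB fi; have /measurable_int/measurable_EFinP mf := fi.
have dom := integrable_Z B mD (integrable_norm fi).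
apply: (integrable_dom mD _ _ dom).
  by apply: measurable_funM => //; exact: measurable_funTS.
by move=> t Dt; rewrite normrM ler_wpM2r ?kB.
Qed.

Lemma integrable_patch (D : set R) f : measurable D -> mu.-integrable D (EFin \o f) ->
  mu.-integrable [set: R] (EFin \o (f \_ D)).
Proof. by move=> mD fi; rewrite -restrict_EFin; apply/integrable_restrict; rewrite ?setTI. Qed.

Variables (a : R) (g : R -> R).
Hypothesis a01 : 0 <= a <= 1.
Hypothesis gi : mu.-integrable `]0, 1[ (EFin \o g).
Hypothesis moments0 : forall n, \int[mu]_(t in `]0, 1[) (`|t - a| ^+ n.*2.+1 * g t) = 0.

Let md : measurable_fun [set: R] (fun t => `|t - a|).
Proof.
apply: measurableT_comp; first exact: normr_measurable.
by apply: measurable_funB; [exact: measurable_id|exact: measurable_cst].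
Qed.

Let d1 t : `]0, 1[%classic t -> `|t - a| <= 1.
Proof.
by move/andP: a01 => [a0 a1]; rewrite /= in_itv/= ler_norml => /andP[t0 t1]; lra.
Qed.

Lemma poly_moment (Q : {poly R}) n :
  mu.-integrable `]0, 1[ (EFin \o (fun t => `|t - a| ^+ n.*2.+1 * Q.[`|t - a| ^+ 2] * g t)) /\
  \int[mu]_(t in `]0, 1[) (`|t - a| ^+ n.*2.+1 * Q.[`|t - a| ^+ 2] * g t) = 0.
Proof.
(* [n] is generalized because a factor ['X] raises the odd exponent by two. *)
elim/poly_ind: Q n => [|Q c IH] n.
  have -> : (fun t => `|t - a| ^+ n.*2.+1 * (0 : {poly R}).[`|t - a| ^+ 2] * g t) = fun=> 0.
    by apply/funext => t; rewrite horner0 mulr0 mul0r.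
  by split; [exact: integrable0|rewrite Rintegral_cst// mul0r].
have -> : (fun t => `|t - a| ^+ n.*2.+1 * (Q * 'X + c%:P).[`|t - a| ^+ 2] * g t) =
    fun t => `|t - a| ^+ n.+1.*2.+1 * Q.[`|t - a| ^+ 2] * g t + c * (`|t - a| ^+ n.*2.+1 * g t).
  apply/funext => t; rewrite hornerMXaddC -[n.+1.*2.+1]/(2 + n.*2.+1)%N exprD.
  by set u := _ ^+ n.*2.+1; set v := _ ^+ 2; ring.
have [iQ Q0] := IH n.+1.
have mi : mu.-integrable `]0, 1[ (EFin \o (fun t => `|t - a| ^+ n.*2.+1 * g t)).
  apply: (integrable_boundedM (B := 1) (measurable_itv _) _ _ gi); first exact: measurable_funX.
  by move=> t /d1 dt; rewrite normrX normr_id exprn_ile1.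
have icn := integrable_Z c (measurable_itv _) mi.
split; first exact: integrable_D.
by rewrite RintegralD// Q0 add0r RintegralZl// moments0 mulr0.
Qed.

(** The polynomials of [step_cvg], taken at w = |t - a| / x, have values in [0, 1] and tend to the
    indicator of |t - a| < x; dominated convergence applies with the bound |g|. *)
Lemma truncated_moment x :
  \int[mu]_(t in `]0, 1[) (`|t - a| * (`|t - a| < x)%R%:R * g t) = 0.
Proof.
have [x0|x0] := leP x 0.
  rewrite -[RHS](mul0r (fine (mu `]0, 1[))) -Rintegral_cst//; apply: eq_Rintegral => t _.
  by rewrite ltNge (le_trans x0) ?normr_ge0// mulr0 mul0r.
(* From [x ^- 2 <= k] and |t - a| <= 1 the base (|t - a| / x)^2 / k is at most 1 on the whole
   interval; the successor makes [k] positive. *)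
pose k := (Num.Def.archi_bound (x ^- 2)).+1.
have kx : x ^- 2 <= k%:R.
  rewrite ltW// (lt_le_trans (Num.Theory.archi_boundP _))// ?ler_nat//.
  by rewrite invr_ge0 sqr_ge0.
pose Q n : {poly R} := (1 - ((x ^- 2 / k%:R) *: 'X) ^+ n) ^+ (n * k ^ n).
have QE n t : (Q n).[`|t - a| ^+ 2] = (1 - ((`|t - a| / x) ^+ 2 / k%:R) ^+ n) ^+ (n * k ^ n).
  have -> : (`|t - a| / x) ^+ 2 / k%:R = x ^- 2 / k%:R * `|t - a| ^+ 2.
    by rewrite exprMn exprVn mulrAC; move: (_ ^- 2) (_^-1) (_ ^+ 2) => u v w; ring.
  by rewrite /Q; move: (_ ^+ 2) => u; rewrite !hornerE.
have w0 t : 0 <= `|t - a| / x by rewrite divr_ge0// ltW.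
have wk t : `]0, 1[%classic t -> (`|t - a| / x) ^+ 2 <= k%:R.
  move=> /d1 dt; apply: le_trans kx; rewrite expr_div_n ler_piMl// ?invr_ge0 ?sqr_ge0//.
  exact: exprn_ile1.
pose F n t := (`|t - a| ^+ 0.*2.+1 * (Q n).[`|t - a| ^+ 2] * g t)%:E.
pose f t := (`|t - a| * (`|t - a| < x)%R%:R * g t)%:E.
have Fi n : mu.-integrable `]0, 1[ (F n) by have [] := poly_moment (Q n) 0.
have F0 n : (\int[mu]_(t in `]0%R, 1%R[) F n t = 0)%E.
  have := (poly_moment (Q n) 0).2; rewrite /Rintegral -/(F n) => h.
  have fin : (\int[mu]_(t in `]0%R, 1%R[) F n t)%E \is a fin_num.
    by apply: integrable_fin_num => //; exact: Fi.
  by rewrite -(fineK fin) h.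
have Ff t : `]0, 1[%classic t -> F ^~ t @ \oo --> f t.
  move=> t01; apply: cvg_EFin; first exact: nearW.
  have := step_cvg (w0 t) (ltn0Sn _) (wk t t01).
  rewrite ltr_pdivrMr// mul1r => c.
  have -> : (fine \o F^~ t) = fun n =>
    `|t - a| * (1 - ((`|t - a| / x) ^+ 2 / k%:R) ^+ n) ^+ (n * k ^ n) * g t.
    by apply/funext => n; rewrite /F /= QE expr1.
  by apply: cvgMl; apply: cvgMr.
have dom n t : `]0, 1[%classic t -> (`|F n t| <= `|(g t)%:E|)%E.
  move=> t01; rewrite /F !abse_EFin lee_fin expr1 QE !normrM normr_id ler_piMl//.
  have v0 : 0 <= (`|t - a| / x) ^+ 2 / k%:R by rewrite divr_ge0// sqr_ge0.
  have v1 : (`|t - a| / x) ^+ 2 / k%:R <= 1 by rewrite ler_pdivrMr ?ltr0n// mul1r; exact: wk.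
  rewrite ger0_norm; last by rewrite exprn_ge0// subr_ge0 exprn_ile1.
  rewrite mulr_ile1 ?d1// ?exprn_ge0 ?subr_ge0 ?exprn_ile1//.
    by rewrite subr_ge0 exprn_ile1.
by rewrite gerBl exprn_ge0.
have gabs : mu.-integrable `]0, 1[ (fun t => `|(g t)%:E|%E) by exact: integrable_abse gi.
have C := @dominated_cvg _ (measurableTypeR R) R mu `]0, 1[%classic (measurable_itv _) F f
  (fun t => `|(g t)%:E|%E) (fun n => measurable_int _ (Fi n)) Ff (fun _ _ => isT) gabs dom.
rewrite /Rintegral -/f -[RHS]/(fine 0%E); congr fine.
have E : (fun n => (\int[mu]_(t in `]0%R, 1%R[) F n t)%E) = fun=> 0%E by apply/funext.
rewrite E in C; exact: (cvg_unique (@ereal_hausdorff R) C (cvg_cst 0%E)).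
Qed.

(** Folding the truncated moments at [a] turns them into integrals over s < y of s (g(a+s) +
    g(a-s)); they vanish for every [y], hence so does the integrand almost everywhere. *)
Lemma reflection_sum : {ae mu, forall s, 0 < s ->
  (g \_ `]0, 1[) (a + s) + (g \_ `]0, 1[) (a - s) = 0}.
Proof.
pose K (I : interval R) : R -> R := (fun t => `|t - a| * \1_[set` I] t * g t) \_ `]0, 1[.
have Ki0 (I : interval R) : mu.-integrable `]0, 1[
    (EFin \o (fun t => `|t - a| * \1_[set` I] t * g t)).
  apply: (integrable_boundedM (B := 1) (measurable_itv _) _ _ gi).
    by apply: measurable_funM => //; exact: measurable_indic.
  move=> t /d1 dt; rewrite normrM normr_id indicE normr_nat mulr_ile1//.
  by case: (_ \in _).
have Ki (I : interval R) : mu.-integrable [set: R] (EFin \o K I) by exact: integrable_patch.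
have [Kp Kr] : (forall I : interval R, mu.-integrable [set: R] (EFin \o (fun s => K I (a + s))) /\
    \int[mu]_(s in [set: R]) K I (a + s) = \int[mu]_(t in [set: R]) K I t) /\
    (forall I : interval R, mu.-integrable [set: R] (EFin \o (fun s => K I (a - s))) /\
    \int[mu]_(s in [set: R]) K I (a - s) = \int[mu]_(t in [set: R]) K I t).
  split=> I; apply: integral_preserve => //.
  - exact: measurable_translate.
  - exact: preserves_translate.
  - exact: measurable_reflect.
  - exact: preserves_reflect.
(* The indicators make [G] vanish for [s <= 0], so integrals from minus infinity can be used. *)
pose G s := K `]a, +oo[ (a + s) + K `]-oo, a[ (a - s).
have Gi : mu.-integrable [set: R] (EFin \o G).
  by apply: integrable_D => //; [exact: (Kp _).1|exact: (Kr _).1].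
have GE s : 0 < s -> G s = s * ((g \_ `]0, 1[) (a + s) + (g \_ `]0, 1[) (a - s)).
  move=> s0; rewrite /G /K !patchE mulrDr; congr (_ + _); case: ifP => _; rewrite ?mulr0//.
    rewrite indicE mem_set ?mulr1 /= ?in_itv/= ?andbT ?ltrDl//.
    by rewrite addrAC subrr add0r gtr0_norm.
  rewrite indicE mem_set ?mulr1 /= ?in_itv/= ?gtrBl//.
  by rewrite addrAC subrr add0r normrN gtr0_norm.
(* The point [t = a] belongs to neither half of the neighbourhood, but the factor |t - a| vanishes
   there. *)
have annulus_split (y t : R) : `|t - a| * ((a < t < a + y)%R%:R + (a - y < t < a)%R%:R) =
    `|t - a| * (`|t - a| < y)%R%:R.
  have [ta|ta|->] := ltgtP t a; last by rewrite subrr normr0 !mul0r.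
    by rewrite /= andbT add0r ltr0_norm ?subr_lt0// opprB !ltrBlDr [y + t]addrC.
  by rewrite /= andbF addr0 gtr0_norm ?subr_gt0// ltrBlDl.
have G0 y : \int[mu]_(s in `]-oo, y]) G s = 0.
  have Gy : mu.-integrable `]-oo, y] (EFin \o G) by exact: integrableS Gi.
  have Gy' : mu.-integrable `]-oo, y[ (EFin \o G) by exact: integrableS Gi.
  rewrite -(Rintegral_itv_bndo_bndc Gy') Rintegral_mkcond.
  have -> : (G \_ `]-oo, y[) = fun s => K `]a, a + y[ (a + s) + K `]a - y, a[ (a - s).
    apply/funext => s; rewrite /G /K !patchE.
    rewrite !indicE !mem_setE !in_itv/= ltrDl !ltrD2l ltrN2 gtrBl.
    by case: (s < y); rewrite ?andbT ?andbF// !mulr0 !mul0r !if_same addr0.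
  rewrite RintegralD//; [|exact: (Kp _).1|exact: (Kr _).1].
  rewrite (Kp _).2 (Kr _).2 /K -!Rintegral_mkcond -RintegralD//.
  rewrite -[RHS](truncated_moment y); apply: eq_Rintegral => t _.
  by rewrite -mulrDl -mulrDr !indicE !mem_setE !in_itv/= annulus_split.
have Gy y : mu.-integrable `]-oo, y] (EFin \o G) by exact: integrableS Gi.
(* Almost everywhere [G] is the derivative of its primitive, which is identically zero; it remains
   to divide by [s > 0]. *)
have := FTC1Ny Gy.
have Gloc : locally_integrable [set: R] G.
  by have := integrable_locally (@measurableT _ _) Gi; rewrite patch_setT.
have aeF := ae_filter_ringOfSetsType mu.
move=> /(_ Gloc) /=; apply: filterS => s [_]; rewrite /=.
have -> : (fun x => \int[mu]_(t in `]-oo, x]) G t) = fun=> 0 by apply/funext => y; exact: G0.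
rewrite derive1_cst => /esym Gs0 s0; move: Gs0; rewrite GE// => /eqP.
by rewrite mulf_eq0 gt_eqF//= => /eqP.
Qed.

End odd_moments.

(** * The complex reflection identity and the recovery of the potential *)

Section uniqueness.
Context {R : realType}.
Local Notation mu := (@lebesgue_measure R).
Implicit Types (q f : R -> R[i]) (a b x s t : R).

Lemma inL2_translate q a : 0 < a -> a <= 2%:R^-1 -> inL2 1 q -> inL2 a (fun x => q (a + x)).
Proof.
move=> a0 a2 [qr qi q2].
have a1 : a + a <= 1 by lra.
have sub : (fun x => a + x) @` `]0, a[ `<=` `]0, 1[.
  by move=> _ [x /= + <-]; rewrite !in_itv/= => /andP[x0 xa]; apply/andP; split; lra.
have mt : measurable_fun `]0, a[ (fun x => a + x).
  by apply: measurable_funTS; exact: measurable_translate.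
split.
- exact: (measurable_comp _ sub qr mt).
- exact: (measurable_comp _ sub qi mt).
have h0i := integrable_patch (measurable_itv _) q2.
have [hi _] := integral_preserve (measurable_translate a) (preserves_translate a) h0i.
have hS : mu.-integrable `]0, a[ (EFin \o (fun s =>
    ((fun x => complex.Re (q x) ^+ 2 + complex.Im (q x) ^+ 2) \_ `]0, 1[) (a + s))).
  exact: integrableS hi.
apply: (@eq_integrable _ (measurableTypeR R) R mu `]0, a[%classic (measurable_itv _) _ _ _ hS).
move=> x xa /=; rewrite patchE mem_set//; apply: sub; exists x => //; exact: set_mem.
Qed.

Lemma ae_neq a : {ae mu, forall t, t != a}.
Proof.
exists [set a]; split; [exact: measurable_set1|exact: lebesgue_measure_set1|].
by move=> t /= /negP; rewrite negbK => /eqP.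
Qed.

(** Real and imaginary parts are treated separately, the real weights acting on each. The
    conditional spells out the zero extension: [a - s] leaves the interval exactly when [s >= a]. *)
Lemma reflection_sum_complex q a : 0 <= a <= 1 -> cintegrable `]0, 1[ q ->
  (forall n, integralC `]0, 1[ (fun t => (`|t - a| ^+ n.*2.+1)%:C * q t) = 0) ->
  {ae mu, forall s, 0 < s -> a + s < 1 -> q (a + s) + (if s < a then q (a - s) else 0) = 0}.
Proof.
move=> a01 [qr qi] mom.
have momr n : \int[mu]_(t in `]0, 1[) (`|t - a| ^+ n.*2.+1 * complex.Re (q t)) = 0.
  apply: etrans (congr1 (@complex.Re R) (mom n)).
  by rewrite /integralC /=; apply: eq_Rintegral => t _; rewrite Re_mul /= mul0r subr0.
have momi n : \int[mu]_(t in `]0, 1[) (`|t - a| ^+ n.*2.+1 * complex.Im (q t)) = 0.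
  apply: etrans (congr1 (@complex.Im R) (mom n)).
  by rewrite /integralC /=; apply: eq_Rintegral => t _; rewrite Im_mul /= mul0r addr0.
have := reflection_sum a01 qi momi; have := reflection_sum a01 qr momr.
have aeF := ae_filter_ringOfSetsType mu.
apply: filterS2 => s hr hi s0 s1; have := hi s0; have := hr s0; rewrite !patchE.
have /andP[a0 a1] := a01.
rewrite !mem_setE !in_itv/= s1 (lt_le_trans s0) ?lerDr//= subr_gt0.
have -> : a - s < 1 by lra.
rewrite andbT; case: ifP => _; rewrite ?addr0.
  by case: (q (a + s)) (q (a - s)) => x y [x' y'] /= h h'; apply/eqP;
    rewrite eq_complex /= h h' !eqxx.
by case: (q (a + s)) => x y /= -> ->.
Qed.

End uniqueness.

Unset Implicit Arguments.

Theorem theorem6 (R : realType) (a : R) (q qt : R -> R[i])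
    (P : (R -> R[i]) -> (R -> R[i])) :
  0 < a -> a <= 2%:R^-1 ->
  inL2 1 q -> inL2 1 qt ->
  L2_operator a P ->
  L2_injective a (fun f x => f x + P f x) ->
  aeq a (fun x => q (a - x)) (P (fun x => q (a + x))) ->
  aeq a (fun x => qt (a - x)) (P (fun x => qt (a + x))) ->
  (forall alpha : nat, (alpha < 2)%N ->
     spectrum_alpha q a alpha = spectrum_alpha qt a alpha) ->
  aeq 1 q qt.
Proof.
move=> a0 a2 q2 qt2 [_ P_ext] P_inj Pq Pqt spec.
have a01 : 0 <= a <= 1 by apply/andP; split; lra.
have qi := inL2_cintegrable q2; have qti := inL2_cintegrable qt2.
pose f x := q (a + x); pose g x := qt (a + x).
have f2 : inL2 a f by exact: inL2_translate.
have g2 : inL2 a g by exact: inL2_translate.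
have D := reflection_sum_complex a01 (cintegrableB (measurable_itv _) qi qti)
  (moments_determined a01 qi qti spec).
have aeF := ae_filter_ringOfSetsType (@lebesgue_measure R).
have fg : aeq a f g.
  (* Substituting q(a-s) = P(f)(s) and qt(a-s) = P(g)(s) in the reflection identity gives f + P(f) =
     g + P(g); the bound [a <= 1/2] keeps [a + s] below 1. *)
  apply: P_inj => //; move: D Pq Pqt; apply: filterS3 => s ds qs qts sa.
  have := sa; rewrite in_itv/= => /andP[s0 s1].
  have := ds s0 ltac:(lra); rewrite s1 -(qs sa) -(qts sa).
  by rewrite /f /g => /eqP h; apply/eqP; rewrite -subr_eq0 -(eqP h); apply/eqP; ring.
(* [P] respects equality almost everywhere, so agreement to the right of [a] passes back to the
   reflected points on the left. *)
have Pfg := P_ext f g f2 g2 fg.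
have below : {ae lebesgue_measure, forall s : R, 0 < s -> s < a -> q (a - s) = qt (a - s)}.
  move: Pq Pqt Pfg; apply: filterS3 => s qs qts ps s0 sa.
  have s_in : s \in `]0, a[ by rewrite in_itv/= s0.
  by rewrite (qs s_in) (qts s_in) (ps s_in).
have above : {ae lebesgue_measure, forall s : R, 0 < s -> s < 1 - a -> q (a + s) = qt (a + s)}.
  move: D fg; apply: filterS2 => s ds fgs s0 s1.
  have [sa|sa] := ltP s a; first by apply: fgs; rewrite in_itv/= s0.
  have := ds s0 ltac:(lra); rewrite ltNge sa /= addr0.
  by move/eqP; rewrite subr_eq0 => /eqP.
(* The statements in the distance [s] are pulled back along [t -> a - t] and [t -> t - a], which
   preserve null sets; the point [a] itself is a null set. *)
have := ae_neq a.
have := ae_preserve (measurable_reflect a) (preserves_reflect a) below.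
have := ae_preserve (measurable_translate (- a)) (preserves_translate (- a)) above.
apply: filterS3 => t up down ta; rewrite in_itv/= => /andP[t0 t1].
have [lt|gt|eq] := ltgtP t a; last by rewrite eq eqxx in ta.
  by have := down _ _; rewrite subKr; apply; lra.
have E : a + (- a + t) = t by ring.
by rewrite E in up; apply: up; lra.
Qed.
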